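(* Let $m,n\in\mathbb{N}$ with $\gcd(m,n)=1$, and let $\mathbb{H}_{m/n}=\{(z_1,z_2)\in\mathbb{C}^2:|z_1|^m<|z_2|^n<1\}$. Set $$\mathcal{P}_{m,n}(a,b)=\sum_{r=0}^{m-1}a^r\,b^{\,n-\lfloor nr/m\rfloor},\qquad (a,b)\in\mathbb{C}^2.$$ Then, for every $k\in\mathbb{N}_0$, $$s_k(z,w)=\frac{1}{4\pi^2}\,\frac{(z_2\overline{w}_2)^{-k}\,\mathcal{P}_{m,n}(z_1\overline{w}_1,z_2\overline{w}_2)}{\big((z_2\overline{w}_2)^n-(z_1\overline{w}_1)^m\big)(1-z_2\overline{w}_2)},\qquad z\in\mathbb{H}_{m/n},\ w\in\mathbb{T},$$ is the Szegő kernel for $\mathfrak{H}^2_k(\mathbb{H}_{m/n})$.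
   Context: $\mathbb{N}=\{1,2,\dots\}$, $\mathbb{N}_0=\mathbb{N}\cup\{0\}$, and $\lfloor\cdot\rfloor$ is the floor function. $\mathbb{T}=b\mathbb{D}\times b\mathbb{D}$, where $\mathbb{D}\subset\mathbb{C}$ is the open unit disk, is endowed with the measure $\sigma_{\mathbb{T}}$, the product of the arc-length measures on the two circles, and $L^2(\mathbb{T})=L^2(\mathbb{T},\sigma_{\mathbb{T}})$. For $k\in\mathbb{N}_0$, $\mathcal{A}_k(\mathbb{H}_{m/n})$ is the set of $F\in\mathcal{O}(\mathbb{H}_{m/n})\cap\mathcal{C}(\mathbb{H}_{m/n}\cup\mathbb{T})$ such that $z_2^kF(z_1,z_2)$ is bounded at $(0,0)$ (i.e. bounded on the intersection of $\mathbb{H}_{m/n}$ with some neighborhood of $(0,0)$). $\mathfrak{H}^2_k(\mathbb{H}_{m/n})$ is the closure of $\mathcal{A}_k(\mathbb{H}_{m/n})|_{\mathbb{T}}$ in $L^2(\mathbb{T})$. The Szegő kernel for $\mathfrak{H}^2_k(\mathbb{H}_{m/n})$ is the unique function $s_k:\mathbb{H}_{m/n}\times\mathbb{T}\to\mathbb{C}$ such that, for each $z\in\mathbb{H}_{m/n}$, $\overline{s_k(z,\cdot)}\in\mathfrak{H}^2_k(\mathbb{H}_{m/n})$ and $\operatorname{Ev}_z(f)=\int_{\mathbb{T}}f(w)s_k(z,w)\,d\sigma_{\mathbb{T}}(w)$ for all $f\in\mathfrak{H}^2_k(\mathbb{H}_{m/n})$, where $\operatorname{Ev}_z$ is the bounded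 linear functional on $\mathfrak{H}^2_k(\mathbb{H}_{m/n})$ determined by $\operatorname{Ev}_z(F|_{\mathbb{T}})=F(z)$ for $F\in\mathcal{A}_k(\mathbb{H}_{m/n})$. *)

(* Defs.v *)
From HB Require Import structures.
From mathcomp Require Import all_boot all_order all_algebra.
From mathcomp Require Import all_classical all_reals all_analysis.
From mathcomp Require Import measurable_realfun complex.

Set Implicit Arguments.
Unset Strict Implicit.
Unset Printing Implicit Defensive.
Import Order.TTheory GRing.Theory Num.Theory numFieldNormedType.Exports.

Local Open Scope classical_set_scope.
Local Open Scope ring_scope.
Local Open Scope complex_scope.

(* R[i] is a one-dimensional normed space over itself, with its Borel
   sigma-algebra; R[i] * R[i] then gets the product topology and the product
   sigma-algebra from the library. *)
HB.instance Definition _ (R : realType) := GRing.ComAlgebra.copy R[i] (R[i])^o.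
HB.instance Definition _ (R : realType) := Vector.copy R[i] (R[i])^o.
HB.instance Definition _ (R : realType) := NormedModule.copy R[i] (R[i])^o.
HB.instance Definition _ (R : realType) :=
  @isMeasurable.Build (sigma_display (open : set (set R[i]))) R[i]
    <<s (open : set (set R[i])) >>
    (@sigma_algebra0 _ setT _) (@sigma_algebraC _ _)
    (@sigma_algebra_bigcup _ setT _).

Definition expi {R : realType} (t : measurableTypeR R) : R[i] :=
  cos t +i* sin t.

Lemma normc_le_sum (R : realType) (x y : R) :
  Normc.normc (x +i* y) <= `|x| + `|y|.
Proof.
rewrite /= -[leRHS]ger0_norm ?addr_ge0// -sqrtr_sqr ler_wsqrtr//.
rewrite sqrrD -!normrX !(ger0_norm (sqr_ge0 _)) addrAC lerDl.
by rewrite mulrn_wge0// mulr_ge0.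
Qed.

Lemma continuous_expi (R : realType) : continuous (expi : R -> R[i]).
Proof.
move=> t; apply/cvgrPdist_lt => e e0.
have [eI eR] : complex.Im e = 0 /\ 0 < complex.Re e.
  by move: e0; case: e => a b; rewrite ltcE/= => /andP[/eqP].
have e2 : 0 < complex.Re e / 2 by rewrite divr_gt0.
have /cvgrPdist_lt/(_ _ e2) Hc := @continuous_cos R t.
have /cvgrPdist_lt/(_ _ e2) Hs := @continuous_sin R t.
near=> u.
have Hcu : `|cos t - cos u| < complex.Re e / 2 by near: u.
have Hsu : `|sin t - sin u| < complex.Re e / 2 by near: u.
rewrite (_ : e = (complex.Re e)%:C); last by move: eI; case: (e) => a b /= ->.
rewrite normc_def ltcR.
rewrite (le_lt_trans (normc_le_sum (cos t - cos u) (sin t - sin u)))//.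
by rewrite [ltRHS]splitr ltrD.
Unshelve. all: by end_near. Qed.

Lemma measurable_expi (R : realType) :
  measurable_fun [set: measurableTypeR R] expi.
Proof.
apply: (measurability (open : set (set R[i]))) => // _ [B oB <-].
rewrite setTI; apply: open_measurable.
by have /continuousP := @continuous_expi R; exact.
Qed.

HB.instance Definition _ (R : realType) :=
  isMeasurableFun.Build _ _ _ _ (@expi R) (@measurable_expi R).

(* Arc-length measure of the unit circle, as a measure on R[i]: the image of
   Lebesgue measure on [0, 2 pi[ under t |-> e^(it). *)
Definition arclength (R : realType) : set R[i] -> \bar R :=
  pushforward
    (mrestr lebesgue_measure (measurable_itv `[(0 : R), 2 * pi[)) expi.

Lemma arclength0 (R : realType) : @arclength R set0 = 0%E.
Proof. exact: measure0. Qed.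

Lemma arclength_ge0 (R : realType) A : (0 <= @arclength R A)%E.
Proof. exact: measure_ge0. Qed.

Lemma arclength_sigma_additive (R : realType) :
  semi_sigma_additive (@arclength R).
Proof. exact: measure_semi_sigma_additive. Qed.

HB.instance Definition _ (R : realType) := isMeasure.Build _ _ _ (@arclength R)
  (@arclength0 R) (@arclength_ge0 R) (@arclength_sigma_additive R).

Lemma arclength_fin_num (R : realType) : fin_num_fun (@arclength R).
Proof.
move=> A mA; rewrite ge0_fin_numE// (@le_lt_trans _ _ (arclength [set: R[i]]))//.
  by apply: le_measure; rewrite ?inE.
rewrite /arclength /pushforward /mrestr preimage_setT setTI.
by rewrite lebesgue_measure_itv/=; case: ifP => _; rewrite ?ltry.
Qed.

HB.instance Definition _ (R : realType) :=
  Measure_isFinite.Build _ _ _ (@arclength R) (@arclength_fin_num R).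

Definition unit_circle (R : realType) : set R[i] := [set z | `|z| = 1].

Definition torus (R : realType) : set (R[i] * R[i]) :=
  @unit_circle R `*` @unit_circle R.

Definition torus_measure (R : realType) :
    {measure set (R[i] * R[i]) -> \bar R} :=
  (@arclength R \x @arclength R)%E.

Definition hartogs (R : realType) (m n : nat) : set (R[i] * R[i]) :=
  [set z | `|z.1| ^+ m < `|z.2| ^+ n < 1].

(* Functions on a subset of C^2 are total functions whose values off that
   subset are never used.  Functions on the torus are not quotiented by a.e.
   equality; the L^2 seminorm below only sees them up to a.e. equality. *)

(* F is holomorphic on the open set [hartogs m n] when it is differentiable
   over the scalar field R[i] at every point of it. *)
Definition Ak (R : realType) (m n k : nat) : set (R[i] * R[i] -> R[i]) :=
  [set F | [/\ forall z, hartogs m n z -> differentiable F z,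
    {within hartogs m n `|` @torus R, continuous F} &
    exists M : R, \forall z \near ((0, 0) : R[i] * R[i]),
      hartogs m n z -> `|z.2 ^+ k * F z| <= M%:C]].

Definition L2norm (R : realType) (f : R[i] * R[i] -> R[i]) : \bar R :=
  'N[torus_measure R]_2%:E[(fun w => (Normc.normc (f w))%:E) \_ (@torus R)]%E.

Definition L2 (R : realType) : set (R[i] * R[i] -> R[i]) :=
  [set f | measurable_fun (@torus R) f /\ (L2norm f < +oo)%E].

(* The closure in L^2 of the restrictions to the torus of the functions in
   [Ak m n k]. *)
Definition hardy2 (R : realType) (m n k : nat) : set (R[i] * R[i] -> R[i]) :=
  [set f | @L2 R f /\ forall e : R, 0 < e ->
    exists2 F, @Ak R m n k F & (L2norm (fun w => (f w - F w)%R) < e%:E)%E].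

Definition torus_integral (R : realType) (f : R[i] * R[i] -> R[i]) : R[i] :=
  (\int[torus_measure R]_(w in @torus R) complex.Re (f w)) +i*
  (\int[torus_measure R]_(w in @torus R) complex.Im (f w)).

(* E is a bounded linear functional on [hardy2 m n k] with E (F|_T) = F z for
   every F in [Ak m n k].  Boundedness makes E insensitive to changes of its
   argument off the torus or on a null set. *)
Definition is_evaluation (R : realType) (m n k : nat) (z : R[i] * R[i])
    (E : (R[i] * R[i] -> R[i]) -> R[i]) : Prop :=
  [/\ forall (a : R[i]) f g, hardy2 m n k f -> hardy2 m n k g ->
        E (fun w => a * f w + g w) = a * E f + E g,
      exists M : R, forall f, hardy2 m n k f ->
        ((Normc.normc (E f))%:E <= M%:E * L2norm f)%E &
      forall F, Ak m n k F -> E F = F z].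

Definition reproduces (R : realType) (m n k : nat)
    (s : R[i] * R[i] -> R[i] * R[i] -> R[i]) : Prop :=
  forall z, hartogs m n z ->
  [/\ hardy2 m n k (fun w => (s z w)^*),
      exists E, is_evaluation m n k z E &
      forall E, is_evaluation m n k z E -> forall f, hardy2 m n k f ->
        E f = torus_integral (fun w => f w * s z w)].

(* Uniqueness is that of s z as an element of L^2 of the torus. *)
Definition is_szego_kernel (R : realType) (m n k : nat)
    (s : R[i] * R[i] -> R[i] * R[i] -> R[i]) : Prop :=
  reproduces m n k s /\
  forall s', reproduces m n k s' -> forall z, hartogs m n z ->
    s' z = s z %[ae torus_measure R in @torus R].

(* n * r %/ m is the floor of nr/m; it is at most n for r < m, so the natural
   number subtraction does not truncate. *)
Definition Pmn (R : realType) (m n : nat) (a b : R[i]) : R[i] :=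
  \sum_(r < m) a ^+ r * b ^+ (n - n * r %/ m)%N.

(* Main.v *)
(** A function [F] of A_k is holomorphic on a Reinhardt domain, so it has a
    Laurent expansion in the monomials z1^a z2^b; the discs in z1 centred at 0
    give a >= 0, and boundedness of z2^k F at the origin, tested on the tori
    |z1| = t^n / 2, |z2| = t^m with t -> 0, gives b >= - k - floor(n a / m).
    Summing these monomials (in b by a geometric series, in a by blocks of
    length m) yields the closed form of the kernel, and termwise integration
    shows that it reproduces A_k.  Instead of the double series, for every a
    the sum over b is kept in the form of the Cauchy kernel w2 / (w2 - z2),
    with the exponent floor(n a / m) + k built into the integrand; its integral
    over a torus does not depend on the radii, vanishes on small tori, and
    tends to an integral over the distinguished torus as the radii tend to 1.
    The conjugate of the kernel is itself in A_k, hence reproduction extends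
    to the closure by Cauchy-Schwarz, and two reproducing kernels differ by a
    function orthogonal to itself. *)

Require Import Defs.
From mathcomp Require Import all_boot all_order all_algebra.
From mathcomp Require Import all_classical all_reals all_analysis.
From mathcomp Require Import measurable_realfun complex.
From mathcomp Require Import ring lra.
Set Implicit Arguments.
Unset Strict Implicit.
Unset Printing Implicit Defensive.
Import Order.TTheory GRing.Theory Num.Theory numFieldNormedType.Exports.

Local Open Scope classical_set_scope.
Local Open Scope ring_scope.
Local Open Scope complex_scope.

(** * Modulus and topology of the complex numbers *)

(** Holomorphy is differentiability at every point, with no continuity of the derivative, so
    Cauchy's theorem is needed in Goursat's form. It is proved for g(w) dw / w on polar rectangles:
    since dw / w = dr / r + i dt, the radial sides at angles 0 and 2 pi cancel, and what remains
    says that the mean of g over a circle does not depend on the radius. Used in one variable at a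
    time through Fubini, this statement carries every deformation: a torus may move as long as it
    stays in the domain and off the poles.

    The exponent e = floor(n a / m) is the least one that works: where |w1| is about t^n and |w2| =
    t^m, the factor w2^(e+1) / w1^a has size t^(m e + m - n a), and the exponent of t is positive
    exactly when e >= floor(n a / m). Since this floor grows by n when a grows by m, consecutive
    blocks of m terms are in ratio (z1/w1)^m / (z2/w2)^n on the torus; hence a rational kernel,
    whose numerator comes from a single block.

    On the distinguished torus F is only continuous. The tori of radii x^(n+1) and x^m lie in the
    domain for 0 < x < 1 and reach it as x tends to 1. *)

Notation nc := Normc.normc.

Section normc.
Context {R : realType}.
Implicit Types (z w : R[i]) (x y : R).

Lemma nc_def z : `|z| = (nc z)%:C.
Proof. by rewrite normc_def; case: z. Qed.

Lemma nc_ge0 z : 0 <= nc z.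
Proof. by rewrite -ler0c -nc_def. Qed.

Lemma nc_gt0 z : (0 < nc z) = (z != 0).
Proof. by rewrite -normr_gt0 nc_def -[0 in RHS]/(0%:C) ltcR. Qed.

Lemma nc_eq0 z : (nc z == 0) = (z == 0).
Proof. by rewrite -[RHS]negbK -nc_gt0 lt_neqAle nc_ge0 andbT negbK eq_sym. Qed.

Lemma nc0 : nc (0 : R[i]) = 0. Proof. exact: Normc.normc0. Qed.
Lemma nc1 : nc (1 : R[i]) = 1. Proof. exact: Normc.normc1. Qed.

Lemma ncM z w : nc (z * w) = nc z * nc w. Proof. exact: Normc.normcM. Qed.
Lemma ncV z : nc z^-1 = (nc z)^-1. Proof. exact: Normc.normcV. Qed.
Lemma ncN z : nc (- z) = nc z. Proof. exact: normcN. Qed.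
Lemma ncD z w : nc (z + w) <= nc z + nc w. Proof. exact: le_normcD. Qed.
Lemma ncB z w : nc (z - w) <= nc z + nc w.
Proof. by rewrite -[nc w]ncN ncD. Qed.
Lemma nc_distC z w : nc (z - w) = nc (w - z).
Proof. by rewrite -ncN opprB. Qed.
Lemma ncX z n : nc (z ^+ n) = nc z ^+ n.
Proof. by elim: n => [|n ih]; rewrite ?nc1 // !exprS ncM ih. Qed.
Lemma nc_real x : nc x%:C = `|x|.
Proof. by rewrite /= expr0n /= addr0 sqrtr_sqr. Qed.
Lemma nc_conj z : nc z^* = nc z.
Proof. by case: z => a b /=; rewrite sqrrN. Qed.
Lemma nc_i : nc ('i : R[i]) = 1.
Proof. by rewrite /= expr0n /= add0r expr1n sqrtr1. Qed.

Lemma nc_ler_sub z w : nc z - nc w <= nc (z - w).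
Proof. by rewrite lerBlDr; apply: le_trans (ncD _ _); rewrite subrK. Qed.

Lemma nc_ler_sum (I : Type) (s : seq I) (f : I -> R[i]) :
  nc (\sum_(i <- s) f i) <= \sum_(i <- s) nc (f i).
Proof.
elim/big_rec2 : _ => [|i y x _ h]; first by rewrite nc0.
by apply: le_trans (ncD _ _) _; rewrite lerD2l.
Qed.

Lemma Re_le_nc z : `|complex.Re z| <= nc z.
Proof. by rewrite -lecR -nc_def normc_ge_Re. Qed.

Lemma Im_le_nc z : `|complex.Im z| <= nc z.
Proof.
have := Re_le_nc (z * 'i); rewrite ReiNIm normrN ncM.
by rewrite nc_i mulr1.
Qed.

Lemma nc_le_ReIm z : nc z <= `|complex.Re z| + `|complex.Im z|.
Proof. by case: z => a b; exact: normc_le_sum. Qed.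

Lemma nc_expi (t : R) : nc (expi t) = 1.
Proof. by rewrite /= cos2Dsin2 sqrtr1. Qed.

Lemma ReD (z w : R[i]) :
  complex.Re (z + w) = complex.Re z + complex.Re w.
Proof. by case: z w => [a b] [c d]. Qed.
Lemma ImD (z w : R[i]) :
  complex.Im (z + w) = complex.Im z + complex.Im w.
Proof. by case: z w => [a b] [c d]. Qed.
Lemma ReB (z w : R[i]) : complex.Re (z - w) = complex.Re z - complex.Re w.
Proof. by case: z w => [a b] [c d]. Qed.
Lemma ImB (z w : R[i]) : complex.Im (z - w) = complex.Im z - complex.Im w.
Proof. by case: z w => [a b] [c d]. Qed.
Lemma ReM (z w : R[i]) : complex.Re (z * w) =
  complex.Re z * complex.Re w - complex.Im z * complex.Im w.
Proof. by case: z w => [a b] [c d]. Qed.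
Lemma ImM (z w : R[i]) : complex.Im (z * w) =
  complex.Re z * complex.Im w + complex.Im z * complex.Re w.
Proof. by case: z w => [a b] [c d]. Qed.

(** The norm of [R[i]] takes its values in [R[i]], and a positive element there has zero imaginary
    part; this trades such radii for real ones, and all later estimates are made with [nc] in
    [R]. *)
Lemma cvg_ncP {T : Type} {F : set_system T} {FF : Filter F} (f : T -> R[i]) l :
  f @ F --> l <-> forall e : R, 0 < e -> \forall x \near F, nc (f x - l) < e.
Proof.
split=> [/cvgrPdist_lt cf e e0|cf].
  have e0' : 0 < e%:C :> R[i] by rewrite ltcR.
  apply: filterS (cf _ e0') => x.
  by rewrite nc_def ltcR nc_distC.
apply/cvgrPdist_lt => e; case: e => a b; rewrite ltcE/= => /andP[/eqP -> a0].
apply: filterS (cf _ a0) => x.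
by rewrite nc_def (_ : a +i* 0 = a%:C)// ltcR nc_distC.
Qed.

Lemma nbhs_ncP (z : R[i]) (A : set R[i]) :
  nbhs z A <-> exists2 e : R, 0 < e & forall w, nc (w - z) < e -> A w.
Proof.
split=> [zA|[e e0 eA]].
  move/nbhs_ballP : zA => [e /= e0 eA].
  case: e e0 eA => a b; rewrite ltcE/= => /andP[/eqP -> a0] eA.
  exists a => // w wz; apply: eA; rewrite -ball_normE /=.
  by rewrite nc_def (_ : a +i* 0 = a%:C)// ltcR nc_distC.
apply/nbhs_ballP; exists e%:C => /=; first by rewrite ltcR.
move=> w; rewrite -ball_normE/= nc_def ltcR => ?; apply: eA.
by rewrite nc_distC.
Qed.

Lemma continuous_Re : continuous (@complex.Re R : R[i] -> R).
Proof.
move=> z; apply/(@cvgrPdist_lt _ _ _ (nbhs z) (nbhs_filter z)) => e e0.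
  apply/nbhs_ncP; exists e => // w wz.
by rewrite -ReB; apply: le_lt_trans (Re_le_nc _) _; rewrite nc_distC.
Qed.

Lemma continuous_Im : continuous (@complex.Im R : R[i] -> R).
Proof.
move=> z; apply/(@cvgrPdist_lt _ _ _ (nbhs z) (nbhs_filter z)) => e e0.
  apply/nbhs_ncP; exists e => // w wz.
by rewrite -ImB; apply: le_lt_trans (Im_le_nc _) _; rewrite nc_distC.
Qed.

Lemma continuous_nc : continuous (@Normc.normc R : R[i] -> R).
Proof.
move=> z; apply/(@cvgrPdist_lt _ _ _ (nbhs z) (nbhs_filter z)) => e e0.
  apply/nbhs_ncP; exists e => // w wz.
rewrite ltr_norml; apply/andP; split.
  by rewrite ltrNl opprB (le_lt_trans (nc_ler_sub _ _)).
by rewrite (le_lt_trans (nc_ler_sub _ _))// nc_distC.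
Qed.

Lemma measurable_Re : measurable_fun [set: R[i]] (@complex.Re R : R[i] -> R).
Proof.
apply: (measurability _ (RGenOpens.measurableE R)).
move=> _ [_ [a [b ->] <-]]; rewrite setTI; apply: sub_sigma_algebra.
have /continuousP := continuous_Re; apply; exact: interval_open.
Qed.

Lemma measurable_Im : measurable_fun [set: R[i]] (@complex.Im R : R[i] -> R).
Proof.
apply: (measurability _ (RGenOpens.measurableE R)).
move=> _ [_ [a [b ->] <-]]; rewrite setTI; apply: sub_sigma_algebra.
have /continuousP := continuous_Im; apply; exact: interval_open.
Qed.

Lemma measurable_nc : measurable_fun [set: R[i]] (@Normc.normc R : R[i] -> R).
Proof.
apply: (measurability _ (RGenOpens.measurableE R)).
move=> _ [_ [a [b ->] <-]]; rewrite setTI; apply: sub_sigma_algebra.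
have /continuousP := continuous_nc; apply; exact: interval_open.
Qed.

Lemma continuous_real_complex : continuous (real_complex R : R -> R[i]).
Proof.
move=> x; apply/(@cvg_ncP _ (nbhs x) (nbhs_filter x)) => e e0.
have /(@cvgrPdist_lt _ _ _ (nbhs x) (nbhs_filter x))/(_ _ e0) : id @ x --> x.
  exact: cvg_id.
apply: filterS => y.
by rewrite -rmorphB nc_real distrC.
Qed.

End normc.

(** * Integrals of complex-valued functions *)

Section cint.
Context d {T : measurableType d} {R : realType}.
Variable mu : {measure set T -> \bar R}.
Implicit Types (D : set T) (f g : T -> R[i]).

(** Taken componentwise, so that [torus_integral] is convertible to the case of [torus_measure] on
    the torus. *)
Definition cint D f : R[i] :=
  (\int[mu]_(x in D) complex.Re (f x)) +i* (\int[mu]_(x in D) complex.Im (f x)).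

Definition cintegrable D f : Prop :=
  mu.-integrable D (EFin \o (fun x => complex.Re (f x))) /\
  mu.-integrable D (EFin \o (fun x => complex.Im (f x))).

Lemma eq_cint D f g : {in D, f =1 g} -> cint D f = cint D g.
Proof.
move=> fg; rewrite /cint.
by congr (_ +i* _); apply: eq_Rintegral => x xD; rewrite fg.
Qed.

Lemma integrableZl_EFin D (r : R) (h : T -> R) : measurable D ->
  mu.-integrable D (EFin \o h) ->
  mu.-integrable D (EFin \o (fun x => r * h x)).
Proof.
by move=> mD ih; apply: eq_integrable (integrableZl mD r ih) => // x _.
Qed.

Lemma cintegrableD D f g : measurable D -> cintegrable D f ->
  cintegrable D g -> cintegrable D (fun x => f x + g x).
Proof.
move=> mD [f1 f2] [g1 g2]; split.
  apply: eq_integrable (integrableD mD f1 g1) => // x _ /=.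
  by rewrite ReD.
apply: eq_integrable (integrableD mD f2 g2) => // x _ /=.
by rewrite ImD.
Qed.

Lemma cintegrableZ D f (c : R[i]) : measurable D -> cintegrable D f ->
  cintegrable D (fun x => c * f x).
Proof.
move=> mD [f1 f2]; split.
  apply: eq_integrable (integrableB mD
    (integrableZl mD (complex.Re c) f1) (integrableZl mD (complex.Im c) f2))
    => // x _ /=.
  by rewrite ReM.
apply: eq_integrable (integrableD mD
    (integrableZl mD (complex.Re c) f2) (integrableZl mD (complex.Im c) f1))
    => // x _ /=.
by rewrite ImM.
Qed.

Lemma cintD D f g : measurable D -> cintegrable D f -> cintegrable D g ->
  cint D (fun x => f x + g x) = cint D f + cint D g.
Proof.
move=> mD [f1 f2] [g1 g2]; rewrite /cint.
apply/eqP; rewrite eq_complex /= -!RintegralD//.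
by apply/andP; split; apply/eqP; apply: eq_Rintegral => x _;
  rewrite ?ReD ?ImD.
Qed.

Lemma cintZ D f (c : R[i]) : measurable D -> cintegrable D f ->
  cint D (fun x => c * f x) = c * cint D f.
Proof.
move=> mD [f1 f2]; rewrite /cint.
apply/eqP; rewrite eq_complex ReM ImM /=.
rewrite -!RintegralZl// -RintegralB//; [|exact: integrableZl_EFin..].
rewrite -RintegralD//; [|exact: integrableZl_EFin..].
by apply/andP; split; apply/eqP; apply: eq_Rintegral => x _;
  rewrite ?ReM ?ImM.
Qed.

Lemma cintegrableB D f g : measurable D -> cintegrable D f ->
  cintegrable D g -> cintegrable D (fun x => f x - g x).
Proof.
move=> mD fi gi; have := cintegrableD mD fi (cintegrableZ (-1) mD gi).
by under eq_fun do rewrite mulN1r.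
Qed.

Lemma cintB D f g : measurable D -> cintegrable D f -> cintegrable D g ->
  cint D (fun x => f x - g x) = cint D f - cint D g.
Proof.
move=> mD fi gi; rewrite -[- cint D g]mulN1r -cintZ// -cintD//; last first.
  exact: cintegrableZ.
by under eq_fun do rewrite -mulN1r.
Qed.

Lemma cintegrable0 D : cintegrable D (fun=> 0).
Proof. by split; exact: integrable0. Qed.

Lemma cint0 D : cint D (fun=> 0) = 0.
Proof. by rewrite /cint /Rintegral /= integral0. Qed.

Lemma cint_sum D (I : Type) (s : seq I) (F : I -> T -> R[i]) :
  measurable D -> (forall i, cintegrable D (F i)) ->
  cintegrable D (fun x => \sum_(i <- s) F i x) /\
  cint D (fun x => \sum_(i <- s) F i x) = \sum_(i <- s) cint D (F i).
Proof.
move=> mD iF; elim: s => [|i s [ih1 ih2]].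
  under eq_fun do rewrite big_nil.
  by rewrite big_nil cint0; split => //; exact: cintegrable0.
under eq_fun do rewrite big_cons.
by rewrite big_cons cintD// ih2; split => //; exact: cintegrableD.
Qed.

Lemma measurable_fun_nc D f : measurable D -> measurable_fun D f ->
  measurable_fun D (fun x => nc (f x)).
Proof. by move=> mD mf; exact: measurableT_comp measurable_nc mf. Qed.

Lemma measurable_fun_ReIm D f :
  measurable_fun D f -> measurable_fun D (fun x => complex.Re (f x)) /\
  measurable_fun D (fun x => complex.Im (f x)).
Proof.
move=> mf; split.
  exact: measurableT_comp measurable_Re mf.
exact: measurableT_comp measurable_Im mf.
Qed.

Lemma bounded_cintegrable D f M : measurable D -> (mu D < +oo)%E ->
  measurable_fun D f -> (forall x, D x -> nc (f x) <= M) -> cintegrable D f.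
Proof.
move=> mD Doo mf fM; have [mfR mfI] := measurable_fun_ReIm mf.
split; apply: measurable_bounded_integrable => //;
  exists M; split => //; rewrite ?num_real// => N MN x Dx /=.
  by rewrite (le_trans (Re_le_nc _))// (le_trans (fM _ Dx))// ltW.
by rewrite (le_trans (Im_le_nc _))// (le_trans (fM _ Dx))// ltW.
Qed.

(** The factor 2 is the price of bounding the real and imaginary parts separately. Later estimates
    only need some constant, since they end in a limit. *)
Lemma cint_le_bound D f M : measurable D -> (mu D < +oo)%E ->
  cintegrable D f -> (forall x, D x -> nc (f x) <= M) ->
  nc (cint D f) <= 2 * M * fine (mu D).
Proof.
move=> mD Doo [f1 f2] fM; apply: le_trans (nc_le_ReIm _) _.
have iM : mu.-integrable D (EFin \o (fun=> M)).
  by apply: measurable_bounded_integrable => //; exact: bounded_cst.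
rewrite -mulrA mulr_natl mulr2n -(Rintegral_cst mu mD M) /=.
apply: lerD; (apply: le_trans; [exact: le_normr_Rintegral|]);
  apply: le_Rintegral => //.
- exact: integrable_norm.
- by move=> x Dx; rewrite (le_trans (Re_le_nc _))// fM.
- exact: integrable_norm.
- by move=> x Dx; rewrite (le_trans (Im_le_nc _))// fM.
Qed.

Lemma cint_cst D c : measurable D ->
  cint D (fun=> c) = c * (fine (mu D))%:C.
Proof.
by move=> mD; rewrite /cint !Rintegral_cst//; case: c => a b; simpc.
Qed.

Lemma cvg_cint D (f_ : nat -> T -> R[i]) f M : measurable D -> (mu D < +oo)%E ->
  (forall n, measurable_fun D (f_ n)) -> measurable_fun D f ->
  (forall n x, D x -> nc (f_ n x) <= M) ->
  (forall x, D x -> f_ ^~ x @ \oo --> f x) ->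
  (fun n => cint D (f_ n)) @ \oo --> cint D f.
Proof.
move=> mD Doo mf_ mf fM cf.
have iM : mu.-integrable D (EFin \o (fun=> M)).
  by apply: measurable_bounded_integrable => //; exact: bounded_cst.
(* Dominated convergence is real, so it is applied with [p] equal to the real part, then to the
   imaginary part. *)
have key (p : R[i] -> R) : continuous p -> measurable_fun setT p ->
    (forall z, `|p z| <= nc z) ->
    (\int[mu]_(x in D) p (f_ n x))%R @[n --> \oo] -->
    (\int[mu]_(x in D) p (f x))%R.
  move=> cp mp pn.
  have [|||||fi _ cfi] := @dominated_convergence _ _ _ mu D mD
      (fun n x => (p (f_ n x))%:E) (fun x => (p (f x))%:E) (fun=> M%:E).
  - by move=> n; apply/measurable_EFinP; exact: measurableT_comp (mf_ n).
  - by apply/measurable_EFinP; exact: measurableT_comp mf.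
  - apply: aeW => x Dx; apply: cvg_EFin; first exact: nearW.
    by apply: continuous_cvg; [exact: cp|exact: cf].
  - exact: iM.
  - by apply: aeW => x n Dx; rewrite /= lee_fin (le_trans (pn _))// fM.
  - apply: fine_cvg; rewrite fineK//; exact: integrable_fin_num.
apply/cvg_ncP => e e0.
have e2 : 0 < e / 2 by rewrite divr_gt0.
have /cvgrPdist_lt/(_ _ e2) H1 := key _ continuous_Re measurable_Re Re_le_nc.
have /cvgrPdist_lt/(_ _ e2) H2 := key _ continuous_Im measurable_Im Im_le_nc.
near=> n; rewrite (le_lt_trans (nc_le_ReIm _))// ReB ImB /=.
rewrite [ltRHS]splitr distrC [X in _ + X < _]distrC ltrD//.
- by near: n.
- by near: n.
Unshelve. all: by end_near. Qed.

End cint.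

(** * Goursat's theorem in polar coordinates *)

Section bisection.
Context {R : realType}.

Lemma half_lt (l e : R) : 0 < e -> exists n : nat, l / 2 ^+ n < e.
Proof.
move=> e0; exists (Num.bound (l / e)).
rewrite ltr_pdivrMr ?exprn_gt0// mulrC -ltr_pdivrMr//.
apply: le_lt_trans (ler_norm _) _.
apply: lt_le_trans (archi_boundP (normr_ge0 _)) _.
rewrite -natrX ler_nat; apply: leq_trans (ltnW (ltn_expl _ (ltnSn 1))).
by rewrite leq_eqVlt; apply/orP; left; apply/eqP; rewrite /Num.bound normr_id.
Qed.

(* Bisection keeps the rectangles similar to the big one, which makes the square
   of their diameter comparable to their area. *)
Lemma rectangle_bisection (P : R -> R -> R -> R -> Prop) (a b c d : R) :
  a <= b -> c <= d ->
  (forall x0 x1 y0 y1, a <= x0 -> x0 <= x1 -> x1 <= b ->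
     c <= y0 -> y0 <= y1 -> y1 <= d ->
     let xm := (x0 + x1) / 2 in let ym := (y0 + y1) / 2 in
     P x0 xm y0 ym -> P x0 xm ym y1 -> P xm x1 y0 ym -> P xm x1 ym y1 ->
     P x0 x1 y0 y1) ->
  (forall x y, a <= x <= b -> c <= y <= d -> exists2 e, 0 < e &
     forall x0 x1 y0 y1, a <= x0 -> x0 <= x -> x <= x1 -> x1 <= b ->
       c <= y0 -> y0 <= y -> y <= y1 -> y1 <= d -> x1 - x0 < e -> y1 - y0 < e ->
       (x1 - x0) * (d - c) = (y1 - y0) * (b - a) ->
       P x0 x1 y0 y1) ->
  P a b c d.
Proof.
move=> ab cd Pm Pl; apply: contrapT => nP.
(* A rectangle is encoded as ((x0, x1), (y0, y1)); it is bad when it lies in the big one and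
   violates [P]. *)
pose bad (q : (R * R) * (R * R)) :=
  [/\ a <= q.1.1 /\ q.1.1 <= q.1.2, q.1.2 <= b, c <= q.2.1 /\ q.2.1 <= q.2.2,
      q.2.2 <= d & ~ P q.1.1 q.1.2 q.2.1 q.2.2].
pose rel (q q' : (R * R) * (R * R)) :=
  [/\ q.1.1 <= q'.1.1 /\ q'.1.2 <= q.1.2, q.2.1 <= q'.2.1 /\ q'.2.2 <= q.2.2,
      q'.1.2 - q'.1.1 = (q.1.2 - q.1.1) / 2 &
      q'.2.2 - q'.2.1 = (q.2.2 - q.2.1) / 2].
have step (q : {q | bad q}) : exists q' : {q | bad q}, rel (sval q) (sval q').
  case: q => -[[x0 x1] [y0 y1]] /= [/= [ax x01] xb [cy y01] yd nPq].
  apply: contrapT => /forallNP nex; apply: nPq.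
  (* If no quarter were bad, all four would satisfy [P]. The match reads the corners of the quarter
     at hand from its negated goal. *)
  by apply: Pm => //; apply: contrapT => nPq; match goal with
    H : ~ P ?u ?v ?w ?z |- _ =>
      have bq : bad ((u, v), (w, z)) by
        split; last exact: H; rewrite /=; try split; lra
    end; apply: (nex (exist _ _ bq)); split => /=; try split; lra.
have [nxt nxtP] := choice step.
have bad0 : bad ((a, b), (c, d)) by split.
pose s n := sval (iter n nxt (exist _ _ bad0)).
have sbad n : bad (s n) by rewrite /s; case: (iter _ _ _).
have srel n : rel (s n) (s n.+1) by exact: nxtP.
have mono n k : [/\ (s n).1.1 <= (s (n + k)%N).1.1, (s (n + k)%N).1.2 <= (s n).1.2,
    (s n).2.1 <= (s (n + k)%N).2.1 & (s (n + k)%N).2.2 <= (s n).2.2].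
  elim: k => [|k [h1 h2 h3 h4]]; first by rewrite addn0.
  rewrite addnS; have [[? ?] [? ?] _ _] := srel (n + k)%N.
  by split; [exact: le_trans h1 _|exact: le_trans _ h2|
             exact: le_trans h3 _|exact: le_trans _ h4].
have size n : (s n).1.2 - (s n).1.1 = (b - a) / 2 ^+ n /\
              (s n).2.2 - (s n).2.1 = (d - c) / 2 ^+ n.
  elim: n => [|n [h1 h2]]; first by rewrite expr0 !divr1.
  have [_ _ -> ->] := srel n; rewrite h1 h2 exprSr invfM.
  by split; rewrite mulrA.
have le1 n k : (s n).1.1 <= (s k).1.2.
  have [h1 _ _ _] := mono n k; have [_ h2 _ _] := mono k n.
  have [[_ h3] _ _ _ _] := sbad (n + k)%N.
  by apply: le_trans h1 (le_trans h3 _); rewrite addnC.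
have le2 n k : (s n).2.1 <= (s k).2.2.
  have [_ _ h1 _] := mono n k; have [_ _ _ h2] := mono k n.
  have [_ _ [_ h3] _ _] := sbad (n + k)%N.
  by apply: le_trans h1 (le_trans h3 _); rewrite addnC.
(* The suprema of the left and lower ends give a point common to all the nested rectangles. *)
pose x := sup (range (fun n => (s n).1.1)).
pose y := sup (range (fun n => (s n).2.1)).
have x_ge n : (s n).1.1 <= x.
  apply: ub_le_sup; last by exists n.
  by exists (s 0%N).1.2 => _ [k _ <-]; exact: le1.
have x_le n : x <= (s n).1.2.
  apply: ge_sup; first by exists (s 0%N).1.1; exists 0%N.
  by move=> _ [k _ <-]; exact: le1.
have y_ge n : (s n).2.1 <= y.
  apply: ub_le_sup; last by exists n.
  by exists (s 0%N).2.2 => _ [k _ <-]; exact: le2.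
have y_le n : y <= (s n).2.2.
  apply: ge_sup; first by exists (s 0%N).2.1; exists 0%N.
  by move=> _ [k _ <-]; exact: le2.
have [||e e0 eP] := Pl x y; first by rewrite (x_ge 0%N) (x_le 0%N).
  by rewrite (y_ge 0%N) (y_le 0%N).
have [n1 hn1] := half_lt (b - a) e0; have [n2 hn2] := half_lt (d - c) e0.
pose n := (n1 + n2)%N.
have [[ax x01] xb [cy y01] yd nPn] := sbad n.
have [h1 h2 h3 h4] := mono n1 n2; have [h5 h6 h7 h8] := mono n2 n1.
have [s1 _] := size n1; have [_ s2] := size n2.
apply: nPn; apply: eP => //.
- by rewrite -s1 in hn1; rewrite /n; lra.
- by rewrite -s2 in hn2; rewrite /n addnC; lra.
- by have [-> ->] := size n; rewrite mulrAC [RHS]mulrAC [(b - a) * _]mulrC.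
Qed.

End bisection.

(** * Complex derivatives *)

Section complex_diff.
Context {R : realType}.

(** The differential is [R[i]]-linear, hence multiplication by its value at 1, the complex
    derivative [b]. *)
Lemma differentiable_nc (g : R[i] -> R[i]) w : differentiable g w ->
  exists b, forall e : R, 0 < e -> exists2 d : R, 0 < d & forall w',
    nc (w' - w) < d -> nc (g w' - g w - b * (w' - w)) <= e * nc (w' - w).
Proof.
move=> dg; exists ('d g w 1) => e e0.
have /diff_locallyP[_ /eqaddoP] := dg.
have e0' : 0 < e%:C :> R[i] by rewrite ltcR.
move=> /(_ _ e0') /nbhs_ncP[d d0 dP]; exists d => // w' w'w.
have := dP (w' - w); rewrite subr0 => /(_ w'w) /=.
rewrite !nc_def -rmorphM lecR /= !fctE subrK opprD addrA.
suff -> : 'd g w (w' - w) = 'd g w 1 * (w' - w) by [].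
have {1}-> : w' - w = (w' - w) *: 1 by rewrite -[LHS]mulr1.
by rewrite linearZ mulrC.
Qed.

Lemma differentiableXf (V : normedModType R[i]) (f : V -> R[i]) n x :
  differentiable f x -> differentiable (fun y => f y ^+ n) x.
Proof.
move=> df; elim: n => [|n ih]; first exact: differentiable_cst.
under eq_fun do rewrite exprS.
exact: differentiableM.
Qed.

Lemma differentiable_fst (w : R[i] * R[i]) :
  differentiable (fst : R[i] * R[i] -> R[i]) w.
Proof. by apply: linear_differentiable => x; exact: cvg_fst. Qed.

Lemma differentiable_snd (w : R[i] * R[i]) :
  differentiable (snd : R[i] * R[i] -> R[i]) w.
Proof. by apply: linear_differentiable => x; exact: cvg_snd. Qed.

Lemma differentiable_idc (w : R[i]) : differentiable (fun x : R[i] => x) w.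
Proof. by apply: (@linear_differentiable _ _ _ idfun) => x; exact: cvg_id. Qed.

Lemma differentiable_slice2 (F : R[i] * R[i] -> R[i]) u v :
  differentiable F (u, v) -> differentiable (fun w => F (u, w)) v.
Proof.
move=> dF; apply: (@differentiable_comp _ _ _ _ (fun w => (u, w)) F) => //.
Qed.

Lemma differentiable_slice1 (F : R[i] * R[i] -> R[i]) u v :
  differentiable F (u, v) -> differentiable (fun w => F (w, v)) u.
Proof.
move=> dF; apply: (@differentiable_comp _ _ _ _ (fun w => (w, v)) F) => //.
Qed.

End complex_diff.

(** * Complex integrals over intervals *)

Section interval_integral.
Context {R : realType}.
Implicit Types (f g : R -> R[i]) (a b : R).

Definition lint a b f : R[i] := cint lebesgue_measure `[a, b] f.

Lemma continuous_cintegrable_itv a b f : {within `[a, b], continuous f} ->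
  cintegrable lebesgue_measure `[a, b] f.
Proof.
move=> cf; split; apply: continuous_compact_integrable;
  try exact: segment_compact.
- by move=> x; apply: continuous_comp; [exact: cf|exact: continuous_Re].
- by move=> x; apply: continuous_comp; [exact: cf|exact: continuous_Im].
Qed.

Lemma lebesgue_segment_lty a b : (@lebesgue_measure R `[a, b] < +oo)%E.
Proof. by rewrite lebesgue_measure_itv/=; case: ifP => _; rewrite ?ltry. Qed.

Lemma fine_lebesgue_segment a b : a <= b ->
  fine (@lebesgue_measure R `[a, b]) = b - a.
Proof.
move=> ab; rewrite lebesgue_measure_itv/= lte_fin; case: ltP => //= ba.
by rewrite (_ : b = a) ?subrr//; lra.
Qed.

Lemma lint_split a b c f : a <= b -> b <= c ->
  cintegrable lebesgue_measure `[a, c] f ->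
  lint a c f = lint a b f + lint b c f.
Proof.
move=> ab bc [i1 i2].
have key (h : R -> R) : (lebesgue_measure : measure _ _).-integrable `[a, c] (EFin \o h) ->
    (\int[lebesgue_measure]_(x in `[a, c]) h x =
    \int[lebesgue_measure]_(x in `[a, b]) h x +
    \int[lebesgue_measure]_(x in `[b, c]) h x)%R.
  move=> ih; apply/eqP; rewrite addrC -subr_eq; apply/eqP.
  rewrite Rintegral_itvB ?bnd_simp//.
  rewrite Rintegral_itv_obnd_cbnd//.
  apply: integrableS ih => //.
  by apply: subset_itv; rewrite bnd_simp.
apply/eqP; rewrite eq_complex /= key// key//.
by rewrite !eqxx.
Qed.

Lemma lint_le_bound a b f M : a <= b ->
  cintegrable lebesgue_measure `[a, b] f ->
  (forall x, a <= x <= b -> nc (f x) <= M) ->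
  nc (lint a b f) <= 2 * M * (b - a).
Proof.
move=> ab fi fM.
rewrite -(fine_lebesgue_segment ab).
apply: cint_le_bound; [by []| |by []|].
  exact: lebesgue_segment_lty.
by move=> x /=; rewrite in_itv/=; exact: fM.
Qed.

(** The primitive of i e^(it), obtained from those of sine and cosine. It evaluates the angular
    sides for affine functions and shows that [expi] is Lipschitz. *)
Lemma lint_expi a b : a <= b -> 'i * lint a b expi = expi b - expi a.
Proof.
rewrite le_eqVlt => /predU1P[<-|ab].
  by rewrite subrr /lint /cint set_itv1 !Rintegral_set1 /= mulr0.
have Hc : (\int[lebesgue_measure]_(x in `[a, b]) cos x = sin b - sin a :> R)%R.
  rewrite /Rintegral (continuous_FTC2 (F := sin))//.
  - by apply: continuous_subspaceT; exact: continuous_cos.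
  - split; first by move=> x _; exact: derivable_sin.
    + exact/cvg_at_right_filter/continuous_sin.
    + exact/cvg_at_left_filter/continuous_sin.
  - by move=> x _; rewrite derive1E derive_val.
have Hs : (\int[lebesgue_measure]_(x in `[a, b]) sin x = cos a - cos b :> R)%R.
  rewrite /Rintegral (continuous_FTC2 (F := - cos))//=.
  - by rewrite !fctE opprK addrC.
  - by apply: continuous_subspaceT; exact: continuous_sin.
  - split; first by move=> x _; exact/derivableN/derivable_cos.
    + by apply/cvg_at_right_filter/continuousN; exact: continuous_cos.
    + by apply/cvg_at_left_filter/continuousN; exact: continuous_cos.
  - by move=> x _; rewrite derive1E derive_val opprK.
apply/eqP; rewrite eq_complex ReB ImB ReM ImM /= Hc Hs.
by apply/andP; split; apply/eqP; ring.
Qed.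

Lemma expi_lip (s t : R) : nc (expi t - expi s) <= 2 * `|t - s|.
Proof.
wlog st : s t / s <= t.
  move=> h; have [st|/ltW ts] := leP s t; first exact: h.
  by rewrite nc_distC distrC; exact: h.
rewrite -lint_expi// ncM nc_i mul1r ger0_norm ?subr_ge0//.
rewrite -[X in X * _]mulr1; apply: lint_le_bound => //.
- apply: continuous_cintegrable_itv; apply: continuous_subspaceT.
  exact: continuous_expi.
- by move=> x _; rewrite nc_expi.
Qed.

Lemma expi2pi : expi (2 * pi) = expi 0 :> R[i].
Proof. by rewrite /expi mulr_natl cos2pi sin2pi cos0 sin0. Qed.

End interval_integral.

(** * Boundary integrals over polar rectangles *)

Section goursat.
Context {R : realType}.

Definition polar (r t : R) : R[i] := r%:C * expi t.

Lemma nc_polar r t : 0 <= r -> nc (polar r t) = r.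
Proof. by move=> r0; rewrite ncM nc_expi mulr1 nc_real ger0_norm. Qed.

Lemma continuous_polar_r t : continuous (polar ^~ t).
Proof.
move=> r; apply: (@continuousM _ _ (fun r : R => r%:C) (fun=> expi t)).
  exact: continuous_real_complex.
exact: cvg_cst.
Qed.

Lemma continuous_polar_t r : continuous (polar r).
Proof.
move=> t; apply: (@continuousM _ _ (fun=> r%:C) (fun t : R => expi t)).
  exact: cvg_cst.
exact: continuous_expi.
Qed.

Variables (g : R[i] -> R[i]) (a b : R).
Hypotheses (a0 : 0 < a) (ab : a <= b).
Hypothesis dg : forall w, a <= nc w <= b -> differentiable g w.

Lemma continuous_g_polar_t r : a <= r <= b -> continuous (fun t => g (polar r t)).
Proof.
move=> /andP[ar rb] t; apply: continuous_comp.
  exact: continuous_polar_t.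
apply/differentiable_continuous/dg.
by rewrite nc_polar ?ar// (le_trans _ ar)// ltW.
Qed.

Lemma cintegrable_g_polar_t r u v : a <= r <= b ->
  cintegrable lebesgue_measure `[u, v] (fun t => g (polar r t)).
Proof.
move=> rab; apply: continuous_cintegrable_itv.
exact/continuous_subspaceT/continuous_g_polar_t.
Qed.

Lemma cintegrable_g_polar_r t u v : a <= u -> v <= b ->
  cintegrable lebesgue_measure `[u, v] (fun r => r^-1%:C * g (polar r t)).
Proof.
move=> au vb; apply: continuous_cintegrable_itv.
apply: continuous_in_subspaceT => r; rewrite inE/= in_itv/= => /andP[ur rv].
have ar : a <= r := le_trans au ur.
apply: (@continuousM _ _ (fun r : R => r^-1%:C) (fun r => g (polar r t))).
  apply: (@continuous_comp _ _ _ (fun r : R => r^-1) (real_complex R)).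
    by apply: inv_continuous; rewrite gt_eqF// (lt_le_trans a0).
  exact: continuous_real_complex.
apply: continuous_comp; first exact: continuous_polar_r.
apply/differentiable_continuous/dg; rewrite nc_polar.
  by rewrite ar (le_trans rv).
by rewrite (le_trans _ ar)// ltW.
Qed.

(* The integral of [g(w) dw / w] along the boundary of the polar rectangle
   [r0, r1] x [t0, t1]. *)
Definition boundary (r0 r1 t0 t1 : R) : R[i] :=
  'i * lint t0 t1 (fun t => g (polar r1 t) - g (polar r0 t)) -
  lint r0 r1 (fun r => r^-1%:C * g (polar r t1) - r^-1%:C * g (polar r t0)).

(** Sides shared by two quarters are run through in opposite directions and cancel; the outer sides
    add up. *)
Lemma boundary_split r0 rm r1 t0 tm t1 :
  a <= r0 -> r0 <= rm -> rm <= r1 -> r1 <= b -> t0 <= tm -> tm <= t1 ->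
  boundary r0 r1 t0 t1 =
  boundary r0 rm t0 tm + boundary r0 rm tm t1 +
  (boundary rm r1 t0 tm + boundary rm r1 tm t1).
Proof.
move=> ar0 r0m rm1 r1b t0m tm1.
have lintB u v f h : cintegrable lebesgue_measure `[u, v] f ->
    cintegrable lebesgue_measure `[u, v] h ->
    lint u v (fun x => f x - h x) = lint u v f - lint u v h.
  by move=> *; apply: cintB.
have R0 : a <= r0 <= b by apply/andP; split; lra.
have R1 : a <= r1 <= b by apply/andP; split; lra.
have Rm : a <= rm <= b by apply/andP; split; lra.
rewrite /boundary !lintB; try exact: cintegrable_g_polar_t;
  try (apply: cintegrable_g_polar_r; lra).
rewrite !(@lint_split _ t0 tm t1)//; try exact: cintegrable_g_polar_t.
rewrite !(@lint_split _ r0 rm r1)//; try (apply: cintegrable_g_polar_r; lra).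
ring.
Qed.

(* An affine function contributes nothing to the boundary integral. *)
Lemma boundary_affine_bound r0 r1 t0 t1 k l eta :
  a <= r0 -> r0 <= r1 -> r1 <= b -> t0 <= t1 ->
  (forall r t, r0 <= r <= r1 -> t0 <= t <= t1 ->
     nc (g (polar r t) - (k + l * polar r t)) <= eta) ->
  nc (boundary r0 r1 t0 t1) <= 4 * eta * (t1 - t0) + 4 * eta / a * (r1 - r0).
Proof.
move=> ar0 r01 r1b t01 H.
pose h w := g w - (k + l * w).
have R0 : a <= r0 <= b by apply/andP; split; lra.
have R1 : a <= r1 <= b by apply/andP; split; lra.
have i_expi u v : cintegrable lebesgue_measure `[u, v] (expi : R -> R[i]).
  by apply/continuous_cintegrable_itv/continuous_subspaceT; exact: continuous_expi.
have i_cst u v (c : R[i]) : cintegrable lebesgue_measure `[u, v] (fun _ : R => c).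
  by apply/continuous_cintegrable_itv/continuous_subspaceT => ?; exact: cvg_cst.
have E1 t : g (polar r1 t) - g (polar r0 t) =
    (h (polar r1 t) - h (polar r0 t)) + l * (r1 - r0)%:C * expi t.
  by rewrite /h /polar rmorphB/=; ring.
have E2 : {in `[r0, r1]%classic, forall r,
    r^-1%:C * g (polar r t1) - r^-1%:C * g (polar r t0) =
    r^-1%:C * (h (polar r t1) - h (polar r t0)) + l * (expi t1 - expi t0)}.
  move=> r; rewrite inE/= in_itv/= => /andP[r0r rr1].
  have r0' : r%:C != 0 :> R[i].
    rewrite -nc_gt0 nc_real normr_gt0 gt_eqF//.
    by rewrite (lt_le_trans a0)// (le_trans ar0).
  rewrite /h /polar fmorphV /=; field.
  exact: r0'.
have ih t0' t1' : cintegrable lebesgue_measure `[t0', t1']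
    (fun t => h (polar r1 t) - h (polar r0 t)).
  have : cintegrable lebesgue_measure `[t0', t1'] (fun t =>
    g (polar r1 t) - g (polar r0 t) - l * (r1 - r0)%:C * expi t).
    apply: cintegrableB => //; last exact: cintegrableZ.
    by apply: cintegrableB => //; exact: cintegrable_g_polar_t.
  by congr cintegrable; apply/funext => t; rewrite E1 addrK.
have ihr : cintegrable lebesgue_measure `[r0, r1]
    (fun r => r^-1%:C * (h (polar r t1) - h (polar r t0))).
  have [i1 i2] : cintegrable lebesgue_measure `[r0, r1] (fun r =>
      r^-1%:C * g (polar r t1) - r^-1%:C * g (polar r t0) - l * (expi t1 - expi t0)).
    by apply: cintegrableB => //; apply: cintegrableB => //;
      apply: cintegrable_g_polar_r; lra.
  by split; [apply: eq_integrable i1 => //|apply: eq_integrable i2 => //];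
    move=> r rr /=; rewrite E2// addrK.
(* The constant k drops out of both differences. The term l w contributes l (r1 - r0) (e^(i t1) -
   e^(i t0)) to the angular integral and the same amount to the radial one, so only the remainder
   [h] is left. *)
have -> : boundary r0 r1 t0 t1 =
    'i * lint t0 t1 (fun t => h (polar r1 t) - h (polar r0 t)) -
    lint r0 r1 (fun r => r^-1%:C * (h (polar r t1) - h (polar r t0))).
  rewrite /boundary; under eq_fun do rewrite E1.
  have -> : lint r0 r1 (fun r => r^-1%:C * g (polar r t1) - r^-1%:C * g (polar r t0)) =
    lint r0 r1 (fun r => r^-1%:C * (h (polar r t1) - h (polar r t0)) +
                         l * (expi t1 - expi t0)).
    by apply: eq_cint => r rr; apply: E2.
  rewrite {1}/lint cintD//; last exact: cintegrableZ.
  rewrite cintZ// mulrDr [X in _ + X - _]mulrCA lint_expi//.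
  rewrite [X in _ - X = _]/lint [X in _ - X = _]cintD// cint_cst//.
  rewrite (fine_lebesgue_segment r01).
  by rewrite opprD addrACA mulrAC subrr addr0.
(* Each factor 4 is 2 from the integral bound times 2 from a difference of two values of [h]; on the
   radial sides 1/r <= 1/a. *)
apply: le_trans (ncB _ _) _; rewrite ncM nc_i mul1r; apply: lerD.
  apply: le_trans (lint_le_bound (M := eta + eta) t01 _ _) _ => //.
    move=> t tt; apply: le_trans (ncB _ _) _; apply: lerD; apply: H => //; apply/andP; split; lra.
  by rewrite le_eqVlt; apply/orP; left; apply/eqP; ring.
apply: le_trans (lint_le_bound (M := (eta + eta) / a) r01 _ _) _ => //.
  move=> r rr; rewrite ncM nc_real mulrC; apply: ler_pM => //.
  - exact: nc_ge0.
  - by apply: le_trans (ncB _ _) _; apply: lerD; apply: H => //; apply/andP; split; lra.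
  - have r0' : 0 < r.
      by move: rr => /andP[r0r _]; rewrite (lt_le_trans a0)// (le_trans ar0).
    rewrite normfV (ger0_norm (ltW r0')) lef_pV2 ?posrE//.
    by move: rr => /andP[? ?]; lra.
by rewrite le_eqVlt; apply/orP; left; apply/eqP; ring.
Qed.

End goursat.

(** * Independence of circle means from the radius *)

Section circle_mean.
Context {R : realType}.

Lemma polar_dist (r t x y b : R) : 0 <= x -> x <= b ->
  nc (polar r t - polar x y) <= `|r - x| + 2 * b * `|t - y|.
Proof.
move=> x0 xb.
have -> : polar r t - polar x y = (r - x)%:C * expi t + x%:C * (expi t - expi y).
  by rewrite /polar rmorphB/=; ring.
apply: le_trans (ncD _ _) _; rewrite !ncM nc_expi mulr1 !nc_real lerD2l.
rewrite [2 * b]mulrC -mulrA ger0_norm//; apply: ler_pM => //; first exact: nc_ge0.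
exact: expi_lip.
Qed.

(** Goursat's argument. On a small rectangle around a point, g differs from its affine part by at
    most a small multiple of the diameter, so the boundary integral is at most e times the area;
    bisection extends this bound to the rectangle [a, b] x [0, 2 pi] for every e > 0, and the
    boundary integral vanishes. *)
Theorem circle_mean_const (g : R[i] -> R[i]) (a b : R) : 0 < a -> a <= b ->
  (forall w, a <= nc w <= b -> differentiable g w) ->
  lint 0 (2 * pi) (fun t => g (polar a t)) =
  lint 0 (2 * pi) (fun t => g (polar b t)).
Proof.
move=> a0; rewrite le_eqVlt => /predU1P[->//|ab] dg.
have pi2 : 0 < 2 * pi :> R by rewrite mulr_gt0// pi_gt0.
have L0 : 0 < b - a by rewrite subr_gt0.
(* [q] is the ratio of the sides, kept by bisection. In [K], the factor 1 + 2 b q compares the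
   distance to the base point with r1 - r0, and 4 q + 4 / a comes from the affine bound; with the
   precision e q / K the estimate is exactly e times the area. *)
have [q q0 qE] : exists2 q : R, 0 < q & q = 2 * pi / (b - a).
  by eexists; last reflexivity; rewrite divr_gt0.
pose K := (1 + 2 * b * q) * (4 * q + 4 / a).
have b0 : 0 < b by exact: lt_trans ab.
have bq0 : 0 < 1 + 2 * b * q by rewrite addr_gt0 ?mulr_gt0.
have K0 : 0 < K.
  by apply: mulr_gt0 => //; apply: addr_gt0; [exact: mulr_gt0|exact: divr_gt0].
have key e : 0 < e -> nc (boundary g a b 0 (2 * pi)) <= e * (b - a) * (2 * pi - 0).
  move=> e0; apply: (@rectangle_bisection _
    (fun x0 x1 y0 y1 => nc (boundary g x0 x1 y0 y1) <= e * (x1 - x0) * (y1 - y0))).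
  - exact: ltW.
  - exact: ltW.
  - move=> x0 x1 y0 y1 ax x01 xb cy y01 yd xm ym P1 P2 P3 P4.
    have [xm0 xm1] := midf_le x01; have [ym0 ym1] := midf_le y01.
    rewrite (boundary_split a0 dg ax xm0 xm1 xb ym0 ym1).
    apply: le_trans (ncD _ _) _.
    apply: le_trans (lerD (ncD _ _) (ncD _ _)) _.
    apply: le_trans (lerD (lerD P1 P2) (lerD P3 P4)) _.
    by rewrite le_eqVlt; apply/orP; left; apply/eqP; rewrite /xm /ym; field.
  move=> x y /andP[ax xb] /andP[y0 y1].
  have x0 : 0 <= x by rewrite (le_trans (ltW a0)).
  have [|l lP] := @differentiable_nc _ g (polar x y).
    by apply: dg; rewrite nc_polar// ax.
  have e'0 : 0 < e * q / K by rewrite divr_gt0// mulr_gt0.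
  have [d d0 dP] := lP _ e'0.
  exists (d / (1 + 2 * b * q)); first by rewrite divr_gt0.
  move=> r0 r1 t0 t1 ar0 r0x xr1 r1b t00 t0y yt1 t1p rd td; rewrite subr0 => prop.
  have td_ : t1 - t0 = q * (r1 - r0).
    by rewrite qE mulrAC [_ * (r1 - r0)]mulrC prop mulfK// gt_eqF.
  have near_ r t : r0 <= r <= r1 -> t0 <= t <= t1 ->
      nc (polar r t - polar x y) <= (r1 - r0) * (1 + 2 * b * q).
    move=> /andP[? ?] /andP[? ?]; apply: le_trans (@polar_dist r t x y b x0 xb) _.
    rewrite mulrDr mulr1 mulrCA [(r1 - r0) * q]mulrC -td_; apply: lerD.
      by rewrite ler_norml; apply/andP; split; lra.
    rewrite ler_pM2l ?mulr_gt0// ler_norml; apply/andP; split; lra.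
  apply: le_trans (@boundary_affine_bound _ g a b a0 dg r0 r1 t0 t1
    (g (polar x y) - l * polar x y) l
    (e * q / K * ((r1 - r0) * (1 + 2 * b * q))) ar0 _ r1b _ _) _.
  - lra.
  - lra.
  - move=> r t rr tt.
    have -> : g (polar r t) - (g (polar x y) - l * polar x y + l * polar r t) =
      g (polar r t) - g (polar x y) - l * (polar r t - polar x y) by ring.
    apply: le_trans (dP _ _) _.
      by apply: le_lt_trans (near_ _ _ rr tt) _; rewrite -ltr_pdivlMr.
    by rewrite ler_pM2l// near_.
  rewrite td_ le_eqVlt; apply/orP; left; apply/eqP; rewrite /K; field.
  have a4 : 0 < 4 * q * a + 4 by rewrite addr_gt0 ?mulr_gt0.
  by rewrite (gt_eqF a0) (gt_eqF a4) (gt_eqF bq0).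
have B0 : boundary g a b 0 (2 * pi) = 0.
  apply/eqP; rewrite -nc_eq0 eq_le nc_ge0 andbT; apply/ler_addgt0Pl => e e0.
  rewrite addr0; set V := (b - a) * (2 * pi).
  have V0 : 0 < V by rewrite mulr_gt0.
  have := key (e / V) (divr_gt0 e0 V0).
  by rewrite subr0 -mulrA -/V divfK// gt_eqF.
move: B0; rewrite /boundary.
(* The two radial sides lie on the same ray, because [expi] has period 2 pi. *)
have -> : lint a b (fun r => r^-1%:C * g (polar r (2 * pi)) - r^-1%:C * g (polar r 0)) = 0.
  rewrite -[RHS](cint0 (@lebesgue_measure R) `[a, b]); congr cint.
  by apply/funext => r; rewrite /polar expi2pi subrr.
rewrite subr0 => /eqP; rewrite mulf_eq0 -nc_eq0 nc_i oner_eq0/=.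
rewrite /lint cintB//; try (apply: (cintegrable_g_polar_t (a:=a) (b:=b)) => //;
  rewrite ?lexx ?(ltW ab)//).
by rewrite subr_eq0 => /eqP.
Qed.

End circle_mean.

(** * The circle and the torus *)

Section circle_torus.
Context {R : realType}.
Implicit Types z : R[i].

Lemma nbhs_nc2P (z : R[i] * R[i]) (A : set (R[i] * R[i])) :
  nbhs z A <-> exists2 e : R, 0 < e &
    forall w, nc (w.1 - z.1) < e -> nc (w.2 - z.2) < e -> A w.
Proof.
split=> [[[P Q] /= [/nbhs_ncP[d d0 dP] /nbhs_ncP[e e0 eQ]] PQA]|[e e0 eA]].
  exists (Num.min d e); first by rewrite lt_min d0.
  move=> w; rewrite !lt_min => /andP[w1 _] /andP[_ w2].
  by apply: PQA; split; [exact: dP|exact: eQ].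
exists ([set w | nc (w - z.1) < e], [set w | nc (w - z.2) < e]).
  by split; apply/nbhs_ncP; exists e.
by move=> w [w1 w2]; exact: eA.
Qed.

Lemma rat_approx (x e : R) : 0 < e -> exists q : rat, `|x - ratr q| < e.
Proof.
move=> e0; have [|q] := @rat_in_itvoo R (x - e) (x + e); first lra.
by rewrite in_itv/= => /andP[? ?]; exists q; rewrite ltr_norml; apply/andP; split; lra.
Qed.

Lemma open_nc_ball (c : R[i]) (e : R) : open [set w | nc (w - c) < e].
Proof.
rewrite openE => w /= we; apply/nbhs_ncP; exists (e - nc (w - c)).
  by rewrite subr_gt0.
move=> v vw /=; rewrite -[v](subrK w) -addrA.
by rewrite (le_lt_trans (ncD _ _))// -ltrBrDr.
Qed.

(** Pairs carry the product sigma-algebra, not by definition the Borel one. An open set is a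
    countable union of products of discs with rational centres and a common radius 1/(n+1), which is
    what makes continuous functions of two variables measurable. *)
Lemma open_measurable2 (U : set (R[i] * R[i])) : open U -> measurable U.
Proof.
move=> oU.
pose B (i : (rat * rat) * (rat * rat) * nat) : set (R[i] * R[i]) :=
  [set w | nc (w - (ratr i.1.1.1 +i* ratr i.1.1.2)) < i.2.+1%:R^-1] `*`
  [set w | nc (w - (ratr i.1.2.1 +i* ratr i.1.2.2)) < i.2.+1%:R^-1].
pose F i := if `[< B i `<=` U >] then B i else set0.
suff -> : U = \bigcup_i F i.
  apply: countable_bigcupT_measurable => // i; rewrite /F.
  case: ifP => _ //; apply: measurableX; apply: sub_sigma_algebra;
  exact: open_nc_ball.
apply/seteqP; split; last first.
  move=> w [i _]; rewrite /F; case: ifPn => // /asboolP; exact.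
move=> z Uz.
have /nbhs_nc2P[e e0 eU] : nbhs z U by exact: open_nbhs_nbhs.
(* Two points of a disc of radius 1/(n+1) are less than e apart. *)
have [n] : exists n : nat, n.+1%:R^-1 < e / 2.
  exists (Num.truncn (e / 2)^-1).
  by rewrite invf_plt ?posrE ?divr_gt0 ?ltr0n// truncnS_gt.
move=> ne.
have d0 : 0 < n.+1%:R^-1 / 2 :> R by rewrite divr_gt0// invr_gt0 ltr0n.
have app (w : R[i]) : exists q : rat * rat,
    nc (w - (ratr q.1 +i* ratr q.2)) < n.+1%:R^-1.
  have [q1 h1] := rat_approx (complex.Re w) d0.
  have [q2 h2] := rat_approx (complex.Im w) d0.
  exists (q1, q2); apply: le_lt_trans (nc_le_ReIm _) _.
  by rewrite [ltRHS]splitr ReB ImB ltrD.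
have [q h] := app z.1; have [q' h'] := app z.2.
exists ((q, q'), n) => //; rewrite /F; case: ifPn => [_|/asboolP[]]; first by split.
move=> w [/= w1 w2]; apply: eU.
  rewrite -(subrK (ratr q.1 +i* ratr q.2) w.1) -addrA.
  apply: le_lt_trans (ncD _ _) _; rewrite [nc (_ +i* _ - _)]nc_distC.
  by rewrite [ltRHS]splitr ltrD// (lt_trans _ ne).
rewrite -(subrK (ratr q'.1 +i* ratr q'.2) w.2) -addrA.
apply: le_lt_trans (ncD _ _) _; rewrite [nc (_ +i* _ - _)]nc_distC.
by rewrite [ltRHS]splitr ltrD// (lt_trans _ ne).
Qed.

Lemma within_measurable1 (D : set R[i]) (f : R[i] -> R[i]) : measurable D ->
  {within D, continuous f} -> measurable_fun D f.
Proof.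
move=> mD /continuousP cf.
apply: (measurability (open : set (set R[i]))) => // _ [B oB <-].
have /open_subspaceP[V oV VE] := cf _ oB.
rewrite setIC -VE; apply: measurableI => //.
exact: sub_sigma_algebra.
Qed.

Lemma within_measurable2 (D : set (R[i] * R[i])) (f : R[i] * R[i] -> R[i]) :
  measurable D -> {within D, continuous f} -> measurable_fun D f.
Proof.
move=> mD /continuousP cf.
apply: (measurability (open : set (set R[i]))) => // _ [B oB <-].
have /open_subspaceP[V oV VE] := cf _ oB.
rewrite setIC -VE; apply: measurableI => //.
exact: open_measurable2.
Qed.

Lemma unit_circleE z : unit_circle z <-> nc z = 1.
Proof.
by rewrite /unit_circle /= nc_def; split=> [/complexI|->].
Qed.

Lemma measurable_circle : measurable (@unit_circle R).
Proof.
have -> : @unit_circle R = @Normc.normc R @^-1` [set 1].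
  by apply/seteqP; split => z /unit_circleE.
by rewrite -[X in measurable X]setTI; exact: measurable_nc.
Qed.

Lemma measurable_torus : measurable (@torus R).
Proof. by apply: measurableX; exact: measurable_circle. Qed.

Lemma unit_circle_expi (t : R) : unit_circle (expi t : R[i]).
Proof. by apply/unit_circleE; rewrite nc_expi. Qed.

(** The angle is [acos] of the real part, with the sign of the imaginary part. It shows the circle
    to be the image of a compact interval. *)
Lemma unit_circle_arg z : unit_circle z ->
  exists2 t : R, `[- pi, pi]%classic t & z = expi t.
Proof.
move=> /unit_circleE; case: z => x y /= h.
have xy : x ^+ 2 + y ^+ 2 = 1.
  have h0 : 0 <= x ^+ 2 + y ^+ 2 by rewrite addr_ge0// sqr_ge0.
  by rewrite -(sqr_sqrtr h0) h expr1n.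
have x1 : -1 <= x <= 1.
  have : x ^+ 2 <= 1 by rewrite -xy lerDl sqr_ge0.
  by move=> h1; rewrite -ler_norml -(@expr_le1 _ 2)// real_normK// num_real.
have cx : cos (acos x) = x by rewrite acosK// in_itv.
have sx : sin (acos x) = `|y|.
  by rewrite sin_acos// -sqrtr_sqr -xy addrAC subrr add0r.
have a0 := acos_ge0 x1; have api := acos_lepi x1.
have [y0|y0] := leP 0 y.
  exists (acos x); last by rewrite /expi cx sx ger0_norm.
  by rewrite /= in_itv/= api andbT (le_trans _ a0)// oppr_le0 pi_ge0.
exists (- acos x); last by rewrite /expi cosN sinN cx sx ltr0_norm// opprK.
by rewrite /= in_itv/= lerN2 api/= (le_trans _ (pi_ge0 _))// oppr_le0.
Qed.

Lemma compact_circle : compact (@unit_circle R).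
Proof.
have -> : @unit_circle R = expi @` `[- pi, pi]%classic.
  apply/seteqP; split => [z /unit_circle_arg[t tp ->]|_ [t _ <-]].
    by exists t.
  exact: unit_circle_expi.
apply: continuous_compact; last exact: segment_compact.
by apply: continuous_subspaceT; exact: continuous_expi.
Qed.

Lemma compact_torus : compact (@torus R).
Proof. by apply: compact_setX; exact: compact_circle. Qed.

Lemma compact_nc_bounded (T : topologicalType) (D : set T) (f : T -> R[i]) :
  compact D -> {within D, continuous f} ->
  exists M : R, forall x, D x -> nc (f x) <= M.
Proof.
move=> cD cf.
have cnf : {within D, continuous (fun x => nc (f x))}.
  by move=> x; apply: continuous_comp; [exact: cf|exact: continuous_nc].
have [M [Mr MP]] := compact_bounded (continuous_compact cnf cD).
exists (M + 1) => x Dx; apply: le_trans (ler_norm _) _.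
by apply: (MP (M + 1)); [rewrite ltrDl|exists x].
Qed.

End circle_torus.

(** * Integration over the circle and the torus *)

Section circle_integral.
Context {R : realType}.

Definition circle_integral (f : R[i] -> R[i]) : R[i] :=
  cint (@arclength R) (@unit_circle R) f.

Lemma arclength_lty (A : set R[i]) : measurable A -> (@arclength R A < +oo)%E.
Proof. by move=> mA; rewrite ltey_eq arclength_fin_num. Qed.

Lemma torus_measure_torus : torus_measure R (@torus R) =
  (@arclength R (@unit_circle R) * @arclength R (@unit_circle R))%E.
Proof. exact: (product_measure1E _ _ measurable_circle measurable_circle). Qed.

Lemma torus_measure_lty : (torus_measure R (@torus R) < +oo)%E.
Proof.
rewrite torus_measure_torus ltey_eq fin_numM//; apply: arclength_fin_num;
  exact: measurable_circle.
Qed.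

Lemma continuous_circle_integrable (f : R[i] -> R[i]) :
  {within @unit_circle R, continuous f} ->
  cintegrable (@arclength R) (@unit_circle R) f.
Proof.
move=> cf; have [M fM] := compact_nc_bounded compact_circle cf.
apply: (bounded_cintegrable (M := M)) => //.
- exact: measurable_circle.
- apply: arclength_lty; exact: measurable_circle.
- exact: within_measurable1 measurable_circle cf.
Qed.

Lemma continuous_torus_integrable (f : R[i] * R[i] -> R[i]) :
  {within @torus R, continuous f} ->
  cintegrable (torus_measure R) (@torus R) f.
Proof.
move=> cf; have [M fM] := compact_nc_bounded compact_torus cf.
apply: (bounded_cintegrable (M := M)) => //.
- exact: measurable_torus.
- exact: torus_measure_lty.
- exact: within_measurable2 measurable_torus cf.
Qed.

(** The restricted measure does not charge the complement of [D] and agrees with Lebesgue measure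
    inside it. *)
Lemma integral_mrestr (D : set (measurableTypeR R)) (mD : measurable D)
  (h : measurableTypeR R -> \bar R) :
  (mrestr lebesgue_measure mD).-integrable setT h ->
  (\int[mrestr lebesgue_measure mD]_x h x = \int[lebesgue_measure]_(x in D) h x)%E.
Proof.
move=> ih.
rewrite (@negligible_integral _ _ _ (mrestr lebesgue_measure mD) setT (~` D))//.
- rewrite setTD setCK; apply: eq_measure_integral => A mA AD.
  by rewrite -[LHS]/(lebesgue_measure (A `&` D)) setIidl.
- exact: measurableC.
- by rewrite -[LHS]/(lebesgue_measure (~` D `&` D)) setICl measure0.
Qed.

(** [arclength] is an image measure, so this is a change of variables; the half-open interval may be
    closed because a point is a null set. *)
Lemma circle_integralE (f : R[i] -> R[i]) :
  {within @unit_circle R, continuous f} ->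
  circle_integral f = lint 0 (2 * pi) (fun t => f (expi t)).
Proof.
move=> cf.
have cfe : continuous (fun t : R => f (expi t)).
  move=> t; apply/(@cvg_ncP _ _ (nbhs t) (nbhs_filter t)) => e e0.
  have : f @ within (@unit_circle R) (nbhs (expi t)) --> f (expi t).
    by rewrite (nbhs_subspace_in (unit_circle_expi t)); exact: cf.
  move/cvg_ncP => /(_ _ e0) H.
  have He : \forall u \near nbhs t, unit_circle (expi u : R[i]) ->
      nc (f (expi u) - f (expi t)) < e by exact: (continuous_expi H).
  apply: (@filterS _ (nbhs t) (nbhs_filter t) _ _ _ He) => u hu.
  exact: (hu (unit_circle_expi u)).
have mf := within_measurable1 measurable_circle cf.
have [M fM] := compact_nc_bounded compact_circle cf.
have key (p : R[i] -> R) : continuous p -> measurable_fun setT p ->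
    (forall z, `|p z| <= nc z) ->
    (\int[@arclength R]_(x in @unit_circle R) p (f x) =
     \int[lebesgue_measure]_(t in `[0, 2 * pi]) p (f (expi t)))%R.
  move=> cp mp pn; rewrite Rintegral_mkcond /Rintegral; congr fine.
  (* Extension by zero: f is controlled only on the circle, while the change of variables is stated
     on the whole space. *)
  pose h := (fun x => (p (f x))%:E) \_ (@unit_circle R).
  have mh : measurable_fun setT h.
    apply/(measurable_restrictT _ measurable_circle).
    by apply/measurable_EFinP; exact: measurableT_comp mf.
  have hM x : (`|h x| <= `|M|%:E)%E.
    rewrite /h patchE; case: ifPn => [|_].
      rewrite inE => cx; rewrite lee_fin (le_trans (pn _))// (le_trans (fM _ cx))//.
      exact: ler_norm.
    by rewrite abse0 lee_fin.
  have mexpi := @measurable_expi R.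
  set nu := mrestr lebesgue_measure (measurable_itv `[(0 : R), 2 * pi[).
  have nuoo : (nu setT < +oo)%E.
    rewrite /nu /mrestr /= setTI.
    by have := lebesgue_segment_lty 0 (2 * pi : R); apply: le_lt_trans; apply: le_measure;
      rewrite ?inE//; apply: subset_itvl; rewrite bnd_simp.
  have ih : nu.-integrable setT (h \o expi).
    apply/integrableP; split; first exact: measurableT_comp.
    apply: le_lt_trans (integral_le_bound (`|M|%:E) _ _ _ _) _ => //.
    - by apply: measurableT_comp => //; exact: measurableT_comp.
    - by apply: aeW => t _; exact: hM.
    - by rewrite lte_mul_pinfty.
  transitivity (\int[@arclength R]_x h x)%E.
    by apply: eq_integral => x _; rewrite /h restrict_EFin.
  rewrite (integral_pushforward mexpi mh)//.
  rewrite preimage_setT integral_mrestr//.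
  rewrite integral_itv_bndo_bndc; last first.
    by apply: measurable_funTS; exact: measurableT_comp.
  by apply: eq_integral => t _; rewrite /h /= patchE mem_set//; exact: unit_circle_expi.
apply/eqP; rewrite eq_complex /=; apply/andP; split; apply/eqP; apply: key.
- exact: continuous_Re.
- exact: measurable_Re.
- exact: Re_le_nc.
- exact: continuous_Im.
- exact: measurable_Im.
- exact: Im_le_nc.
Qed.

(** By compactness f is bounded on the torus, which has finite measure, so Fubini applies to its
    extension by zero. Both orders are needed, because a radius is moved in the inner variable. *)
Lemma torus_integral_fubini (f : R[i] * R[i] -> R[i]) :
  {within @torus R, continuous f} ->
  torus_integral f =
    circle_integral (fun w1 => circle_integral (fun w2 => f (w1, w2))) /\
  torus_integral f =
    circle_integral (fun w2 => circle_integral (fun w1 => f (w1, w2))).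
Proof.
move=> cf.
have [M fM] := compact_nc_bounded compact_torus cf.
have mf := within_measurable2 measurable_torus cf.
have mC := @measurable_circle R.
have key (p : R[i] -> R) : continuous p -> measurable_fun setT p ->
    (forall z, `|p z| <= nc z) ->
    (\int[torus_measure R]_(w in @torus R) p (f w) =
    \int[@arclength R]_(w1 in @unit_circle R)
      \int[@arclength R]_(w2 in @unit_circle R) p (f (w1, w2)))%R /\
    (\int[torus_measure R]_(w in @torus R) p (f w) =
    \int[@arclength R]_(w2 in @unit_circle R)
      \int[@arclength R]_(w1 in @unit_circle R) p (f (w1, w2)))%R.
  move=> cp mp pn.
  pose h := (fun x => (p (f x))%:E) \_ (@torus R).
  have mh : measurable_fun setT h.
    apply/(measurable_restrictT _ measurable_torus).
    by apply/measurable_EFinP; exact: measurableT_comp mf.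
  have hM x : (`|h x| <= `|M|%:E)%E.
    rewrite /h patchE; case: ifPn => [|_].
      rewrite inE => cx; rewrite lee_fin (le_trans (pn _))// (le_trans (fM _ cx))//.
      exact: ler_norm.
    by rewrite abse0 lee_fin.
  have ih : (@arclength R \x @arclength R)%E.-integrable setT h.
    suff : (@arclength R \x @arclength R)%E.-integrable (@torus R) (fun x => (p (f x))%:E).
      move=> i; apply/integrable_restrict => //; first exact: measurable_torus.
      by rewrite setTI.
    apply: measurable_bounded_integrable.
    - exact: measurable_torus.
    - exact: torus_measure_lty.
    - exact: measurableT_comp mf.
    - exists M; split => //; rewrite ?num_real// => N MN x Dx /=.
      by rewrite (le_trans (pn _))// (le_trans (fM _ Dx))// ltW.
  have aoo : (@arclength R setT < +oo)%E by exact: arclength_lty.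
  have finh (phi : R[i] -> R[i] * R[i]) : measurable_fun setT phi ->
      (\int[@arclength R]_y h (phi y) \is a fin_num)%E.
    move=> mphi; apply: integrable_fin_num => //.
    apply/integrableP; split; first exact: measurableT_comp.
    apply: le_lt_trans (integral_le_bound (`|M|%:E) _ _ _ _) _ => //.
    - by apply: measurableT_comp => //; exact: measurableT_comp.
    - by apply: aeW => t _; exact: hM.
    - by rewrite lte_mul_pinfty.
  (* [phi] pairs its arguments in one order or the other, so that both iterated integrals are
     treated at once. *)
  have inner (phi : R[i] -> R[i] -> R[i] * R[i]) :
      (forall x, measurable_fun setT (phi x)) ->
      (forall x y, torus (phi x y) <-> unit_circle x /\ unit_circle y) ->
      fine (\int[@arclength R]_x \int[@arclength R]_y h (phi x y))%E =
      (\int[@arclength R]_(x in @unit_circle R)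
        \int[@arclength R]_(y in @unit_circle R) p (f (phi x y)))%R.
    move=> mphi phiT; rewrite [RHS]Rintegral_mkcond /Rintegral; congr fine.
    apply: eq_integral => x _; rewrite patchE; case: ifPn => [|xC].
      rewrite inE => xC; rewrite -[LHS]fineK ?finh//; congr (_%:E).
      rewrite [in RHS]integral_mkcond; congr fine; apply: eq_integral => y _.
      rewrite /h !patchE; case: ifPn => [|yT].
        by rewrite inE => /phiT[_ yC]; rewrite mem_set.
      rewrite memNset// => yC; move/negP: yT; apply.
      by rewrite inE; apply/phiT.
    apply: integral0_eq => y _; rewrite /h patchE memNset//.
    by move=> /phiT[xC' _]; move/negP: xC; apply; rewrite inE.
  have E0 : (\int[torus_measure R]_(w in @torus R) p (f w))%R =
      fine (\int[(@arclength R \x @arclength R)%E]_w h w)%E.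
    rewrite Rintegral_mkcond /Rintegral; congr fine.
    by apply: eq_integral => x _; rewrite /h restrict_EFin.
  split; rewrite E0.
    rewrite -(integral12_prod_meas1 ih).
    apply: (inner (fun x y => (x, y))); last by move=> x y; split=> -[].
    by move=> x; exact: pair1_measurable.
  rewrite -(integral21_prod_meas1 ih).
  apply: (inner (fun x y => (y, x))); last by move=> x y; split=> -[].
  by move=> x; exact: pair2_measurable.
split; apply/eqP; rewrite eq_complex /=; apply/andP; split; apply/eqP.
- exact: (key _ continuous_Re measurable_Re Re_le_nc).1.
- exact: (key _ continuous_Im measurable_Im Im_le_nc).1.
- exact: (key _ continuous_Re measurable_Re Re_le_nc).2.
- exact: (key _ continuous_Im measurable_Im Im_le_nc).2.
Qed.

End circle_integral.

Section within_continuity.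
Context {T U V : topologicalType}.

Lemma within_continuous_comp (D : set T) (E : set U) (f : T -> U) (g : U -> V) :
  (forall x, D x -> E (f x)) -> {within D, continuous f} ->
  {within E, continuous g} -> {within D, continuous (fun x => g (f x))}.
Proof.
move=> DE /subspace_continuousP cf /subspace_continuousP cg.
apply/subspace_continuousP => x Dx A /(cg _ (DE _ Dx)) gA.
have := cf _ Dx _ gA; rewrite /nbhs /= /within /= => H.
by apply: filterS H => y h Dy; exact: h (Dy) (DE _ Dy).
Qed.

Lemma within_continuous_cvg (D : set T) (f : T -> U) (u : nat -> T) x :
  {within D, continuous f} -> (forall n, D (u n)) -> D x ->
  u @ \oo --> x -> (fun n => f (u n)) @ \oo --> f x.
Proof.
move=> /subspace_continuousP cf Du Dx ux A /(cf _ Dx) fA.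
have := ux _ fA; rewrite /nbhs /= => H.
by apply: filterS H => n h; exact: h (Du n).
Qed.

End within_continuity.

(** * Limits under the integral sign *)

Section param_integral.
Context {R : realType}.

Lemma within_slice (T U V : topologicalType) (A : set T) (K : set U)
    (h : T * U -> V) (a : T) : A a ->
  {within A `*` K, continuous h} -> {within K, continuous (fun x => h (a, x))}.
Proof.
move=> Aa ch; apply: (within_continuous_comp (E := A `*` K)) ch => //.
apply: continuous_subspaceT => x.
by apply: cvg_pair; [exact: cvg_cst|exact: cvg_id].
Qed.

(** Joint continuity on a compact product gives one bound for all parameters, and bounded
    convergence applies. *)
Lemma cvg_circle_integral (a b : R) (h : R * R[i] -> R[i]) (u : nat -> R) l :
  {within `[a, b]%classic `*` @unit_circle R, continuous h} ->
  (forall n, u n \in `[a, b]) -> l \in `[a, b] -> u @ \oo --> l ->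
  (fun n => circle_integral (fun w => h (u n, w))) @ \oo -->
  circle_integral (fun w => h (l, w)).
Proof.
move=> ch uab lab ul.
have [M hM] := compact_nc_bounded
  (compact_setX (@segment_compact R a b) (@compact_circle R)) ch.
apply: (cvg_cint (M := M)).
- exact: measurable_circle.
- by apply: arclength_lty; exact: measurable_circle.
- move=> n; apply: within_measurable1; first exact: measurable_circle.
  by apply: within_slice ch; exact: uab.
- apply: within_measurable1; first exact: measurable_circle.
  by apply: within_slice ch; exact: lab.
- by move=> n w wC; apply: hM; split => //=; exact: uab.
- move=> w wC; apply: (within_continuous_cvg ch).
  + by move=> n; split => //=; exact: uab.
  + by split => //=; exact: lab.
  + apply: (@cvg_pair _ _ _ _ (nbhs l) (nbhs w) _ (nbhs_filter l) (nbhs_filter w)) => //.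
    exact: cvg_cst.
Qed.

Lemma cvg_torus_integral (a b : R) (h : R * (R[i] * R[i]) -> R[i])
    (u : nat -> R) l :
  {within `[a, b]%classic `*` @torus R, continuous h} ->
  (forall n, u n \in `[a, b]) -> l \in `[a, b] -> u @ \oo --> l ->
  (fun n => torus_integral (fun w => h (u n, w))) @ \oo -->
  torus_integral (fun w => h (l, w)).
Proof.
move=> ch uab lab ul.
have [M hM] := compact_nc_bounded
  (compact_setX (@segment_compact R a b) (@compact_torus R)) ch.
apply: (cvg_cint (mu := torus_measure R) (M := M)).
- exact: measurable_torus.
- exact: torus_measure_lty.
- move=> n; apply: within_measurable2; first exact: measurable_torus.
  by apply: within_slice ch; exact: uab.
- apply: within_measurable2; first exact: measurable_torus.
  by apply: within_slice ch; exact: lab.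
- by move=> n w wC; apply: hM; split => //=; exact: uab.
- move=> w wC; apply: (within_continuous_cvg ch).
  + by move=> n; split => //=; exact: uab.
  + by split => //=; exact: lab.
  + apply: (@cvg_pair _ _ _ _ (nbhs l) (nbhs w) _ (nbhs_filter l) (nbhs_filter w)) => //.
    exact: cvg_cst.
Qed.

End param_integral.

(** * Cauchy's formula *)

Section cauchy.
Context {R : realType}.
Implicit Types (g h : R[i] -> R[i]) (r : R) (z w : R[i]).

(** The measure stays that of the unit circle for every radius: this is the integral of g(w) dw / (i
    w) over |w| = r. Accordingly the Cauchy kernel appears as w / (w - z) below. *)
Definition circ r g : R[i] := circle_integral (fun w => g (r%:C * w)).

Lemma pi2_gt0 : 0 < 2 * pi :> R.
Proof. by rewrite mulr_gt0// pi_gt0. Qed.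

Lemma arclength_circle : fine (@arclength R (@unit_circle R)) = 2 * pi.
Proof.
apply: complexI.
rewrite -[LHS]mul1r -cint_cst; last exact: measurable_circle.
rewrite -/(circle_integral (fun=> 1)) circle_integralE; last first.
  by apply: continuous_subspaceT; exact: cst_continuous.
by rewrite /lint cint_cst// mul1r (fine_lebesgue_segment (ltW pi2_gt0)) subr0.
Qed.

Lemma eq_circ r g h : 0 <= r -> (forall w, nc w = r -> g w = h w) ->
  circ r g = circ r h.
Proof.
move=> r0 gh; apply: eq_cint => w; rewrite inE => /unit_circleE w1.
by apply: gh; rewrite ncM w1 mulr1 nc_real ger0_norm.
Qed.

Lemma within_circ r g : 0 <= r -> (forall w, nc w = r -> {for w, continuous g}) ->
  {within @unit_circle R, continuous (fun w => g (r%:C * w))}.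
Proof.
move=> r0 cg; apply: continuous_in_subspaceT => w; rewrite inE => /unit_circleE w1.
apply: continuous_comp.
  by apply: (@continuousM _ _ (fun=> r%:C) id); [exact: cst_continuous|exact: cvg_id].
by apply: cg; rewrite ncM w1 mulr1 nc_real ger0_norm.
Qed.

Lemma circ_integrable r g : 0 <= r ->
  (forall w, nc w = r -> {for w, continuous g}) ->
  cintegrable (@arclength R) (@unit_circle R) (fun w => g (r%:C * w)).
Proof. by move=> r0 cg; apply/continuous_circle_integrable/within_circ. Qed.

Lemma circ_bound r g M : 0 <= r ->
  (forall w, nc w = r -> {for w, continuous g}) ->
  (forall w, nc w = r -> nc (g w) <= M) -> nc (circ r g) <= 2 * M * (2 * pi).
Proof.
move=> r0 cg gM; rewrite -arclength_circle; apply: cint_le_bound.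
- exact: measurable_circle.
- by apply: arclength_lty; exact: measurable_circle.
- exact: circ_integrable.
- move=> w /unit_circleE w1; apply: gM.
  by rewrite ncM w1 mulr1 nc_real ger0_norm.
Qed.

Lemma circB r g h : 0 <= r ->
  (forall w, nc w = r -> {for w, continuous g}) ->
  (forall w, nc w = r -> {for w, continuous h}) ->
  circ r (fun w => g w - h w) = circ r g - circ r h.
Proof.
move=> r0 cg ch; apply: cintB; first exact: measurable_circle.
- exact: circ_integrable.
- exact: circ_integrable.
Qed.

Lemma circZ r g c : 0 <= r ->
  (forall w, nc w = r -> {for w, continuous g}) ->
  circ r (fun w => c * g w) = c * circ r g.
Proof.
move=> r0 cg; apply: cintZ; first exact: measurable_circle.
exact: circ_integrable.
Qed.

Lemma circ_cst r c : circ r (fun=> c) = c * (2 * pi)%:C.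
Proof.
rewrite /circ /circle_integral cint_cst ?arclength_circle//.
exact: measurable_circle.
Qed.

Lemma circ_const g (a b : R) : 0 < a -> a <= b ->
  (forall w, a <= nc w <= b -> differentiable g w) -> circ a g = circ b g.
Proof.
move=> a0 ab dg; rewrite /circ !circle_integralE; last 2 first.
- apply: within_circ; first by rewrite (le_trans _ ab)// ltW.
  by move=> w wb; apply/differentiable_continuous/dg; rewrite wb ab lexx.
- apply: within_circ; first exact: ltW.
  by move=> w wb; apply/differentiable_continuous/dg; rewrite wb ab lexx.
exact: circle_mean_const.
Qed.

Lemma cvg_circ g (a b : R) (u : nat -> R) l : 0 < a ->
  (forall w, a <= nc w <= b -> {for w, continuous g}) ->
  (forall n, u n \in `[a, b]) -> l \in `[a, b] -> u @ \oo --> l ->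
  (fun n => circ (u n) g) @ \oo --> circ l g.
Proof.
move=> a0 cg uab lab ul.
apply: (@cvg_circle_integral _ a b (fun x => g (x.1%:C * x.2))) => //.
apply: continuous_in_subspaceT => -[r w] /=.
rewrite inE => -[/=]; rewrite in_itv/= => /andP[ar rb] /unit_circleE w1.
apply: continuous_comp; last first.
  apply: cg; rewrite /= ncM w1 mulr1 nc_real ger0_norm ?ar ?rb//.
  by rewrite (le_trans _ ar)// ltW.
apply: (@continuousM _ _ (fun x : R * R[i] => x.1%:C) snd).
  apply: (@continuous_comp _ _ _ fst (real_complex R)); first exact: cvg_fst.
  exact: continuous_real_complex.
exact: cvg_snd.
Qed.

Lemma sub_neq0_nc (w z : R[i]) : nc w != nc z -> w - z != 0.
Proof. by apply: contraNN; rewrite subr_eq0 => /eqP ->. Qed.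

Lemma differentiable_cauchy_kernel z w : w != z ->
  differentiable (fun w => w / (w - z)) w.
Proof.
move=> wz; apply: differentiableM; first exact: differentiable_idc.
apply: differentiableV; last by rewrite subr_eq0.
by apply: differentiableB; [exact: differentiable_idc|exact: differentiable_cst].
Qed.

(** The kernel has no pole in |w| < |z|, so the circle may shrink; at radius s <= r the kernel is at
    most s / (|z| - r). *)
Lemma circ_kernel_in z r : 0 < r -> r < nc z -> circ r (fun w => w / (w - z)) = 0.
Proof.
move=> r0 rz; apply/eqP; rewrite -nc_eq0 eq_le nc_ge0 andbT.
apply/ler_addgt0Pl => e e0; rewrite addr0.
have z0 : 0 < nc z by exact: lt_trans rz.
have pi0 := pi2_gt0.
pose d := e * (nc z - r) / (2 * (2 * pi)).
have zr0 : 0 < nc z - r by rewrite subr_gt0.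
have C0 : 0 < 2 * (2 * pi) :> R by rewrite mulr_gt0.
have d0 : 0 < d by rewrite divr_gt0 // mulr_gt0.
have [s [s0 sr sd]] : exists s, [/\ 0 < s, s <= r & s <= d].
  by exists (Num.min r d); rewrite lt_min r0 d0 !ge_min !lexx orbT.
rewrite -(@circ_const _ s r s0 sr); last first.
  move=> w /andP[_ wr]; apply: differentiable_cauchy_kernel.
  by rewrite -subr_eq0; apply: sub_neq0_nc; rewrite lt_eqF// (le_lt_trans wr).
have wz w : nc w = s -> nc z - r <= nc (w - z).
  move=> ws; rewrite nc_distC; apply: le_trans (nc_ler_sub _ _).
  by rewrite ws lerB.
have /le_trans : nc (circ s (fun w => w / (w - z))) <= 2 * (s / (nc z - r)) * (2 * pi).
  apply: circ_bound; first exact: ltW.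
    move=> w ws; apply/differentiable_continuous/differentiable_cauchy_kernel.
    by rewrite -subr_eq0 -nc_gt0 (lt_le_trans zr0)// wz.
  move=> w ws; rewrite ncM ncV ws ler_pM2l// lef_pV2 ?posrE ?wz//.
  by rewrite (lt_le_trans zr0)// wz.
apply; have -> : 2 * (s / (nc z - r)) * (2 * pi) = s * (2 * (2 * pi)) / (nc z - r).
  by ring.
by rewrite ler_pdivrMr// -ler_pdivlMr.
Qed.

(** The circle may grow without bound, and w / (w - z) - 1 = z / (w - z) tends to 0 at infinity. *)
Lemma circ_kernel_out z r : nc z < r ->
  circ r (fun w => w / (w - z)) = (2 * pi)%:C.
Proof.
move=> zr; apply/eqP; rewrite -subr_eq0 -nc_eq0 eq_le nc_ge0 andbT.
apply/ler_addgt0Pl => e e0; rewrite addr0.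
have r0 : 0 < r by exact: le_lt_trans (nc_ge0 z) zr.
have pi0 := pi2_gt0.
pose d := nc z + nc z * (2 * (2 * pi)) / e.
have [s [rs ds]] : exists s, r <= s /\ d <= s.
  by exists (Num.max r d); rewrite !le_max !lexx orbT.
have s0 : 0 < s by exact: lt_le_trans rs.
have zs : 0 < s - nc z by rewrite subr_gt0 (lt_le_trans zr).
have kd w : nc z < nc w -> differentiable (fun w => w / (w - z)) w.
  move=> zw; apply: differentiable_cauchy_kernel.
  by rewrite -subr_eq0; apply: sub_neq0_nc; rewrite gt_eqF.
rewrite (@circ_const _ r s r0 rs); last first.
  by move=> w /andP[wr _]; apply: kd; exact: lt_le_trans wr.
have kc w : nc w = s -> {for w, continuous (fun w => w / (w - z))}.
  by move=> ws; apply/differentiable_continuous/kd; rewrite ws (lt_le_trans zr).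
have cc (w : R[i]) : nc w = s -> {for w, continuous (fun _ : R[i] => 1 : R[i])}.
  by move=> _; exact: cst_continuous.
have -> : circ s (fun w => w / (w - z)) - (2 * pi)%:C =
    circ s (fun w => w / (w - z) - 1).
  by rewrite circB ?circ_cst ?mul1r// ltW.
have wz w : nc w = s -> s - nc z <= nc (w - z).
  by move=> <-; exact: nc_ler_sub.
have /le_trans : nc (circ s (fun w => w / (w - z) - 1)) <=
    2 * (nc z / (s - nc z)) * (2 * pi).
  apply: circ_bound; first exact: ltW.
    move=> w ws; apply/differentiable_continuous/differentiableB.
      by apply: kd; rewrite ws (lt_le_trans zr).
    exact: differentiable_cst.
  move=> w ws; have wz0 : 0 < nc (w - z) by rewrite (lt_le_trans zs)// wz.
  have -> : w / (w - z) - 1 = z / (w - z).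
    by field; rewrite -nc_gt0.
  rewrite ncM ncV ler_wpM2l ?nc_ge0// lef_pV2 ?posrE// wz//.
apply; have -> : 2 * (nc z / (s - nc z)) * (2 * pi) = nc z * (2 * (2 * pi)) / (s - nc z).
  by ring.
rewrite ler_pdivrMr// mulrC [e * _]mulrC -ler_pdivrMr// lerBrDl.
by move: ds; rewrite /d [nc z * _]mulrC.
Qed.

End cauchy.

(** * Cauchy's formula in an annulus *)

Section cauchy_formula.
Context {R : realType}.
Implicit Types (g h : R[i] -> R[i]) (r : R) (z w : R[i]).

(* The quotient [w (g w - g z) / (w - z)] has a removable singularity at [z],
   so its means over the circles inside and outside [z] agree by continuity. *)
Lemma circ_removable g z (a b : R) : 0 < a -> a < nc z -> nc z < b ->
  (forall w, a <= nc w <= b -> differentiable g w) ->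
  circ a (fun w => (g w - g z) * (w / (w - z))) =
  circ b (fun w => (g w - g z) * (w / (w - z))).
Proof.
move=> a0 az zb dg; set q := fun w => _.
have zab : a <= nc z <= b by rewrite !ltW.
have dq w : a <= nc w <= b -> w != z -> differentiable q w.
  move=> wab wz; apply: differentiableM; last exact: differentiable_cauchy_kernel.
  by apply: differentiableB; [exact: dg|exact: differentiable_cst].
have [l lP] := differentiable_nc (dg _ zab).
(* Division by zero makes [q] vanish at z; [p] puts there the limit l z instead, where l is the
   derivative of g at z. *)
pose p w := if w == z then l * z else q w.
have cp w : a <= nc w <= b -> {for w, continuous p}.
  move=> wab; have [wz|wz] := eqVneq w z.
    have pz : p z = l * z by rewrite /p eqxx.
    rewrite wz -[{for z, continuous p}]/(p @ z --> p z) pz.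
    apply/(@cvg_ncP _ _ (nbhs z) (nbhs_filter z)) => e e0.
    have nz0 : 0 < nc z + 1 by rewrite ltr_wpDl// nc_ge0.
    have nl0 : 0 < nc l + 1 by rewrite ltr_wpDl// nc_ge0.
    pose e1 := e / 2 / (nc z + 1).
    have e10 : 0 < e1 by rewrite !divr_gt0.
    have [d d0 dP] := lP _ e10.
    pose d1 := Num.min d (Num.min 1 (e / 2 / (nc l + 1))).
    apply/nbhs_ncP; exists d1.
      by rewrite !lt_min d0 ltr01 !divr_gt0.
    move=> v; rewrite !lt_min => /and3P[vd v1 vl].
    rewrite /p; case: eqVneq => [_|vz]; first by rewrite subrr nc0.
    have vz0 : v - z != 0 by rewrite subr_eq0.
    have -> : q v - l * z = (g v - g z - l * (v - z)) * (v / (v - z)) + l * (v - z).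
      by rewrite /q; field.
    apply: le_lt_trans (ncD _ _) _; rewrite [ltRHS]splitr; apply: ler_ltD; last first.
      rewrite ncM; apply: (@le_lt_trans _ _ ((nc l + 1) * nc (v - z))).
        by rewrite ler_wpM2r ?nc_ge0// lerDl.
      by rewrite mulrC -ltr_pdivlMr.
    have vz0' : 0 < nc (v - z) by rewrite nc_gt0.
    have -> : e / 2 = e1 * (nc z + 1) by rewrite /e1 divfK// gt_eqF.
    rewrite ncM [nc (v / _)]ncM ncV.
    apply: (@le_trans _ _ (e1 * nc (v - z) * (nc v / nc (v - z)))).
      by rewrite ler_wpM2r ?dP// divr_ge0 ?nc_ge0.
    have -> : e1 * nc (v - z) * (nc v / nc (v - z)) = e1 * nc v.
      by field; rewrite gt_eqF.
    rewrite ler_pM2l// -[v](subrK z) addrC; apply: le_trans (ncD _ _) _.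
    by rewrite lerD2l ltW.
  have /(@cvg_ncP _ _ (nbhs w) (nbhs_filter w)) cq :=
    differentiable_continuous (dq _ wab wz).
  have pw : p w = q w by rewrite /p (negbTE wz).
  rewrite -[{for w, continuous p}]/(p @ w --> p w) pw.
  apply/(@cvg_ncP _ _ (nbhs w) (nbhs_filter w)) => e e0.
  have near_z : \forall v \near nbhs w, v != z.
    apply/nbhs_ncP; exists (nc (w - z)); first by rewrite nc_gt0 subr_eq0.
    by move=> v; apply: contraTneq => ->; rewrite nc_distC ltxx.
  apply: (@filterS2 _ (nbhs w) (nbhs_filter w) _ _ _ _ near_z (cq _ e0)) => v vz.
  by rewrite /p (negbTE vz).
(* On either side of |z| the mean of [q] is constant, while the radii |z| + (c - |z|) / (j + 1) tend
   to |z|, where the mean of the continuous function [p] is the common limit. *)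
have lim c : a <= c <= b -> c != nc z ->
    (forall s, 0 < s -> s <= 1 -> circ (nc z + (c - nc z) * s) q = circ c q) ->
    circ c q = circ (nc z) p.
  move=> /andP[ac cb] cz cq.
  pose u n := nc z + (c - nc z) * n.+1%:R^-1.
  have n0 n : 0 < n.+1%:R^-1 :> R by rewrite invr_gt0.
  have n1 n : n.+1%:R^-1 <= 1 :> R by rewrite invf_le1// ler1n.
  have uab n : u n \in `[a, b].
    rewrite in_itv/= /u; move: (n.+1%:R^-1) (n0 n) (n1 n) => s s0 s1.
    have h1 : 0 <= (nc z - a) * (1 - s) by rewrite mulr_ge0 ?subr_ge0// ltW.
    have h2 : 0 <= (c - a) * s by rewrite mulr_ge0 ?subr_ge0// ltW.
    have h3 : 0 <= (b - nc z) * (1 - s) by rewrite mulr_ge0 ?subr_ge0// ltW.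
    have h4 : 0 <= (b - c) * s by rewrite mulr_ge0 ?subr_ge0// ltW.
    by apply/andP; split; lra.
  have uz : u @ \oo --> nc z.
    rewrite -[X in _ --> X]addr0 -[X in _ --> _ + X](mulr0 (c - nc z)).
    by apply: cvgD; [exact: cvg_cst|apply: cvgMr; exact: cvg_harmonic].
  have lab : nc z \in `[a, b] by rewrite in_itv.
  have := cvg_circ a0 cp uab lab uz.
  have -> : (fun n => circ (u n) p) = fun=> circ c q.
    apply/funext => n; rewrite -(cq _ (n0 n) (n1 n)).
    move: (uab n); rewrite in_itv/= => /andP[au _].
    apply: eq_circ; first by rewrite (le_trans (ltW a0)).
    move=> w wu; rewrite /p; case: eqVneq => // wz; move/eqP: wu.
    rewrite wz -subr_eq0 /u opprD addrA subrr add0r oppr_eq0 mulf_eq0.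
    by rewrite subr_eq0 (negbTE cz) (gt_eqF (n0 n)).
  by move/cvg_lim => <- //; rewrite lim_cst.
have ab := ltW (lt_trans az zb).
transitivity (circ (nc z) p); last first.
  apply/esym/lim; [by rewrite ab lexx|by rewrite gt_eqF|].
  move=> s s0 s1; have bs : 0 < (b - nc z) * s by rewrite mulr_gt0 ?subr_gt0.
  apply: circ_const.
  - by rewrite ltr_wpDr// ?ltW// (lt_trans a0).
  - have bs1 : (b - nc z) * s <= b - nc z by rewrite ger_pMr// subr_gt0.
    lra.
  - move=> w /andP[w1 w2]; apply: dq; first by apply/andP; split; lra.
    by apply: contraTneq w1 => ->; rewrite -ltNge ltrDl.
apply: lim; [by rewrite lexx|by rewrite lt_eqF|].
move=> s s0 s1; have bs : 0 < (nc z - a) * s by rewrite mulr_gt0 ?subr_gt0.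
have bs1 : (nc z - a) * s <= nc z - a by rewrite ger_pMr// subr_gt0.
apply/esym/circ_const; [exact: a0|lra|].
move=> w /andP[w1 w2]; apply: dq; first by apply/andP; split; lra.
by apply: contraTneq w2 => ->; rewrite -ltNge; lra.
Qed.

(** After g z is subtracted the singularity is removable and both circles give the same mean. The
    subtracted terms are g z times the mean of the kernel, which is 0 inside and 2 pi outside. *)
Theorem cauchy_annulus g z (a b : R) : 0 < a -> a < nc z -> nc z < b ->
  (forall w, a <= nc w <= b -> differentiable g w) ->
  circ b (fun w => g w * (w / (w - z))) - circ a (fun w => g w * (w / (w - z))) =
  g z * (2 * pi)%:C.
Proof.
move=> a0 az zb dg.
have b0 : 0 < b by exact: lt_trans (lt_trans a0 az) zb.
have ab : a <= b by exact: ltW (lt_trans az zb).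
have H := circ_removable a0 az zb dg.
have split_ r : a <= r <= b -> r != nc z ->
    circ r (fun w => (g w - g z) * (w / (w - z))) =
    circ r (fun w => g w * (w / (w - z))) - g z * circ r (fun w => w / (w - z)).
  move=> /andP[ar rb] rz; have r0 : 0 <= r by rewrite (le_trans (ltW a0)).
  have dk w : nc w = r -> differentiable (fun w => w / (w - z)) w.
    move=> wr; apply: differentiable_cauchy_kernel.
    by apply: contraNneq rz => <-; rewrite wr.
  have dgk w : nc w = r -> differentiable (fun w => g w * (w / (w - z))) w.
    move=> wr; apply: differentiableM; last exact: dk.
    by apply: dg; rewrite wr ar.
  have ck w : nc w = r -> {for w, continuous (fun w => w / (w - z))}.
    by move=> wr; exact/differentiable_continuous/dk.
  have dzk w : nc w = r -> differentiable (fun w => g z * (w / (w - z))) w.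
    by move=> wr; apply: differentiableM; [exact: differentiable_cst|exact: dk].
  rewrite -(@circZ _ r (fun w => w / (w - z)) (g z) r0 ck).
  rewrite -(@circB _ r (fun w => g w * (w / (w - z)))
                       (fun w => g z * (w / (w - z))) r0).
  - by congr circ; apply/funext => w; rewrite mulrBl.
  - by move=> w wr; exact/differentiable_continuous/dgk.
  - by move=> w wr; exact/differentiable_continuous/dzk.
have aa : a <= a <= b by rewrite lexx.
have bb : a <= b <= b by rewrite ab lexx.
move: H; rewrite (split_ a aa) ?lt_eqF// (split_ b bb) ?gt_eqF//.
rewrite circ_kernel_in// circ_kernel_out// mulr0 subr0 => ->.
by rewrite opprB addrC subrK.
Qed.

End cauchy_formula.

(** * Tori of varying radii, and Cauchy's formula in a disc *)

Section torus_means.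
Context {R : realType}.
Implicit Types (G : R[i] * R[i] -> R[i]) (r s : R).

Definition tor r s G : R[i] :=
  torus_integral (fun w => G (r%:C * w.1, s%:C * w.2)).

Lemma torusE (w : R[i] * R[i]) : torus w <-> nc w.1 = 1 /\ nc w.2 = 1.
Proof.
split=> [[/unit_circleE w1 /unit_circleE w2]|[w1 w2]]; first by split.
by split; apply/unit_circleE.
Qed.

Lemma nc_scale r (w : R[i]) : 0 <= r -> nc w = 1 -> nc (r%:C * w) = r.
Proof. by move=> r0 w1; rewrite ncM w1 mulr1 nc_real ger0_norm. Qed.

Lemma within_tor r s G : 0 <= r -> 0 <= s ->
  (forall w, nc w.1 = r -> nc w.2 = s -> {for w, continuous G}) ->
  {within @torus R, continuous (fun w => G (r%:C * w.1, s%:C * w.2))}.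
Proof.
move=> r0 s0 cG; apply: continuous_in_subspaceT => -[w1 w2].
rewrite inE => /torusE[/= h1 h2].
apply: (@continuous_comp _ _ _ (fun w : R[i] * R[i] => (r%:C * w.1, s%:C * w.2)) G).
  apply: differentiable_continuous; apply: differentiable_pair.
    by apply: differentiableM; [exact: differentiable_cst|exact: differentiable_fst].
  by apply: differentiableM; [exact: differentiable_cst|exact: differentiable_snd].
by apply: cG; rewrite nc_scale.
Qed.

Lemma tor_bound r s G M : 0 <= r -> 0 <= s ->
  (forall w, nc w.1 = r -> nc w.2 = s -> {for w, continuous G}) ->
  (forall w, nc w.1 = r -> nc w.2 = s -> nc (G w) <= M) ->
  nc (tor r s G) <= 2 * M * fine (torus_measure R (@torus R)).
Proof.
move=> r0 s0 cG GM; apply: (cint_le_bound (mu := torus_measure R)).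
- exact: measurable_torus.
- exact: torus_measure_lty.
- by apply: continuous_torus_integrable; exact: within_tor.
- by move=> w /torusE[w1 w2]; apply: GM; rewrite nc_scale.
Qed.

(** With w1 as the inner variable of Fubini, each slice is a circle mean in w1 alone, whose radius
    may be changed. *)
Lemma tor_move1 r r' s G : 0 < r -> r <= r' -> 0 <= s ->
  (forall w, r <= nc w.1 <= r' -> nc w.2 = s -> differentiable G w) ->
  tor r s G = tor r' s G.
Proof.
move=> r0 rr' s0 dG.
rewrite /tor (torus_integral_fubini _).2; last first.
  apply: within_tor; [exact: ltW|by []|] => w wr ws.
  by apply/differentiable_continuous/dG; rewrite ?wr ?lexx.
rewrite (torus_integral_fubini _).2; last first.
  apply: within_tor; [by rewrite ltW// (lt_le_trans r0)|by []|] => w wr ws.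
  by apply/differentiable_continuous/dG; rewrite ?wr ?rr' ?lexx.
apply: eq_cint => w2; rewrite inE => /unit_circleE h2 /=.
apply: (@circ_const _ (fun w1 => G (w1, s%:C * w2)) r r' r0 rr') => w wrr.
apply: differentiable_slice1; apply: dG => //=.
by rewrite nc_scale.
Qed.

Lemma tor_move2 r s s' G : 0 < s -> s <= s' -> 0 <= r ->
  (forall w, nc w.1 = r -> s <= nc w.2 <= s' -> differentiable G w) ->
  tor r s G = tor r s' G.
Proof.
move=> s0 ss' r0 dG.
rewrite /tor (torus_integral_fubini _).1; last first.
  apply: within_tor; [by []|exact: ltW|] => w wr ws.
  by apply/differentiable_continuous/dG; rewrite ?ws ?lexx.
rewrite (torus_integral_fubini _).1; last first.
  apply: within_tor; [by []|by rewrite ltW// (lt_le_trans s0)|] => w wr ws.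
  by apply/differentiable_continuous/dG; rewrite ?ws ?ss' ?lexx.
apply: eq_cint => w1; rewrite inE => /unit_circleE h1 /=.
apply: (@circ_const _ (fun w2 => G (r%:C * w1, w2)) s s' s0 ss') => w wss.
apply: differentiable_slice2; apply: dG => //=.
by rewrite nc_scale.
Qed.

Lemma bernoulli_le (d : R) N : 0 <= d -> d <= 1 -> 1 - N%:R * d <= (1 - d) ^+ N.
Proof.
move=> d0 d1; elim: N => [|N ih]; first by rewrite mul0r subr0 expr0.
rewrite exprS; apply: (@le_trans _ _ ((1 - d) * (1 - N%:R * d))); last first.
  by rewrite ler_wpM2l// subr_ge0.
have : 0 <= d * (N%:R * d) by rewrite !mulr_ge0.
by rewrite -natr1; lra.
Qed.

Lemma ex_lt_pow (c : R) N : c < 1 -> exists l : R, [/\ 0 < l, l < 1 & c < l ^+ N].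
Proof.
move=> c1.
have [d [d0 d1 dc]] : exists d : R, [/\ 0 < d, d < 1 & c < 1 - N%:R * d].
  have N0 : 0 < N.+2%:R :> R by [].
  (* The denominator N + 2 makes both d < 1 and N d < 1 - c strict, also for N = 0. *)
  exists (Num.min (1 - c) 1 / N.+2%:R).
  have m0 : 0 < Num.min (1 - c) 1 by rewrite lt_min subr_gt0 c1/=.
  have m1 : Num.min (1 - c) 1 <= 1 - c by rewrite ge_min lexx.
  have m2 : Num.min (1 - c) 1 <= 1 by rewrite ge_min lexx orbT.
  split; first exact: divr_gt0.
    by rewrite ltr_pdivrMr// mul1r (le_lt_trans m2)// ltr1n.
  rewrite ltrBrDl -ltrBrDr mulrCA; apply: lt_le_trans m1.
  by rewrite gtr_pMr// ltr_pdivrMr// mul1r ltr_nat.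
exists (1 - d); split; [by rewrite subr_gt0|by rewrite ltrBlDr ltrDl|].
by apply: lt_le_trans dc _; apply: bernoulli_le; exact: ltW.
Qed.

(** The annulus formula with a shrinking inner circle, whose term tends to 0 because g is bounded
    near 0. It needs the inner radius below |z|, so z = 0 is treated apart: there the kernel is 1
    and the claim is the mean value property. *)
Lemma cauchy_disc (g : R[i] -> R[i]) (z : R[i]) (b : R) : nc z < b ->
  (forall w, nc w <= b -> differentiable g w) ->
  circ b (fun w => g w * (w / (w - z))) = g z * (2 * pi)%:C.
Proof.
move=> zb dg; have b0 : 0 < b by exact: le_lt_trans (nc_ge0 z) zb.
have pi0 := @pi2_gt0 R; have C0 : 0 < 2 * (2 * pi) :> R by rewrite mulr_gt0.
have c0 : {for 0, continuous g}.
  by apply/differentiable_continuous/dg; rewrite nc0 ltW.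
have c0' e : 0 < e -> exists2 d : R, 0 < d & forall w, nc w < d -> nc (g w - g 0) < e.
  move=> e0.
  have /(@cvg_ncP _ _ (nbhs 0) (nbhs_filter _))/(_ _ e0)/nbhs_ncP[d d0 dP] := c0.
  by exists d => // w wd; apply: dP; rewrite subr0.
have cg (w : R[i]) : nc w <= b -> {for w, continuous g}.
  by move=> wb; exact/differentiable_continuous/dg.
apply/eqP; rewrite -subr_eq0 -nc_eq0 eq_le nc_ge0 andbT.
apply/ler_addgt0Pl => e e0; rewrite addr0.
have [z0|z0] := eqVneq z 0.
  have [d d0 dP] := c0' _ (divr_gt0 e0 C0).
  have [s [s0 sb sd]] : exists s, [/\ 0 < s, s <= b & s < d].
    exists (Num.min b (d / 2)); rewrite lt_min b0 divr_gt0//.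
    by split=> //; [rewrite ge_min lexx|rewrite gt_min; apply/orP; right; lra].
  have -> : circ b (fun w => g w * (w / (w - z))) = circ b g.
    apply: eq_circ; first exact: ltW.
    by move=> w wb; rewrite z0 subr0 divff ?mulr1// -nc_gt0 wb.
  rewrite -(@circ_const _ g s b s0 sb); last by move=> w /andP[_ /dg].
  rewrite z0 -(circ_cst s) -(@circB _ s g (fun=> g 0) (ltW s0)).
  - apply: le_trans (@circ_bound _ s (fun w => g w - g 0) (e / (2 * (2 * pi))) (ltW s0) _ _) _.
    + move=> w ws; apply/differentiable_continuous/differentiableB.
        by apply: dg; rewrite ws.
      exact: differentiable_cst.
    + by move=> w ws; rewrite ltW// dP// ws.
    + have -> : 2 * (e / (2 * (2 * pi))) * (2 * pi) =
          e / (2 * (2 * pi)) * (2 * (2 * pi)) by ring.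
      by rewrite divfK// gt_eqF.
  - by move=> w ws; apply: cg; rewrite ws.
  - by move=> w _; exact: cst_continuous.
have z0' : 0 < nc z by rewrite nc_gt0.
have [d d0 dP] := c0' _ ltr01.
pose M := nc (g 0) + 1.
have M0 : 0 < M by rewrite ltr_wpDl// nc_ge0.
pose q := M / (nc z / 2) * (2 * (2 * pi)).
have q0 : 0 < q by rewrite mulr_gt0// divr_gt0// divr_gt0.
have [s [s0 sz sd se]] : exists s, [/\ 0 < s, s <= nc z / 2, s < d & s <= e / q].
  exists (Num.min (nc z / 2) (Num.min (d / 2) (e / q))).
  rewrite !lt_min !divr_gt0// !ge_min !gt_min !lexx !orbT; split=> //.
  by apply/orP; right; apply/orP; left; lra.
have sz' : s < nc z by lra.
rewrite -(@cauchy_annulus _ g z s b s0 sz' zb); last by move=> w /andP[_ /dg].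
rewrite opprB addrC subrK.
have wz (w : R[i]) : nc w = s -> nc z / 2 <= nc (w - z).
  by move=> ws; rewrite nc_distC; apply: le_trans (nc_ler_sub _ _); rewrite ws; lra.
have Mw (w : R[i]) : nc w = s -> nc (g w) <= M.
  move=> ws; rewrite -[g w](subrK (g 0)) addrC /M; apply: le_trans (ncD _ _) _.
  by rewrite lerD2l ltW// dP// ws.
apply: le_trans (@circ_bound _ s (fun w => g w * (w / (w - z)))
  (M * (s / (nc z / 2))) (ltW s0) _ _) _.
- move=> w ws; apply/differentiable_continuous/differentiableM.
    by apply: dg; rewrite ws; lra.
  by apply: differentiable_cauchy_kernel; apply: contraTneq sz' => <-; rewrite ws ltxx.
- move=> w ws; rewrite ncM; apply: ler_pM; rewrite ?nc_ge0 ?Mw//.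
  rewrite ncM ncV ws ler_pM2l// lef_pV2 ?posrE ?divr_gt0//; first exact: wz.
  by rewrite (lt_le_trans _ (wz _ ws))// divr_gt0.
- have -> : 2 * (M * (s / (nc z / 2))) * (2 * pi) = s * q by rewrite /q; ring.
  by rewrite -ler_pdivlMr.
Qed.

End torus_means.

(** * Laurent coefficients on the Hartogs triangle *)

Section laurent.
Context {R : realType}.
Variables (m n k : nat).
Hypotheses (m_gt0 : (0 < m)%N) (n_gt0 : (0 < n)%N).
Implicit Types (F : R[i] * R[i] -> R[i]) (w z : R[i] * R[i]).

Lemma hartogsE z :
  hartogs m n z <-> nc z.1 ^+ m < nc z.2 ^+ n /\ nc z.2 ^+ n < 1.
Proof.
rewrite /hartogs /= !nc_def -!rmorphXn /= ltcR -[1 in X in X <-> _]/((1 : R)%:C) ltcR.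
by split=> [/andP//|[-> ->]].
Qed.

Lemma hartogs_nc z : hartogs m n z ->
  [/\ 0 < nc z.2, nc z.2 < 1, nc z.1 < 1 & nc z.1 ^+ m < nc z.2 ^+ n].
Proof.
move=> /hartogsE[h1 h2].
have z2 : 0 < nc z.2.
  rewrite lt_neqAle nc_ge0 andbT; apply/negP => /eqP z0; move: h1.
  by rewrite -z0 expr0n gtn_eqF//= ltNge exprn_ge0// nc_ge0.
split=> //; first by rewrite -(@expr_lt1 _ n)// nc_ge0.
by rewrite -(@expr_lt1 _ m)// ?nc_ge0// (lt_trans h1).
Qed.

(** For |w2| > |z2| the last factor is the sum of (z2/w2)^j over j >= 0. Integration over a torus
    therefore collects, up to a constant, the Laurent coefficients of z1^a z2^(j - k - floor(n a /
    m)), each multiplied by z2^j. *)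
Definition laurent_integrand F (z2 : R[i]) (a : nat) (w : R[i] * R[i]) : R[i] :=
  F w * w.2 ^+ (k + n * a %/ m) / w.1 ^+ a * (w.2 / (w.2 - z2)).

Lemma differentiable_laurent_integrand F (z2 : R[i]) (a : nat) w : Ak m n k F -> hartogs m n w ->
  w.1 != 0 -> w.2 != z2 -> differentiable (laurent_integrand F z2 a) w.
Proof.
move=> [dF _ _] hw w1 w2.
have d1 := differentiable_fst w; have d2 := differentiable_snd w.
apply: differentiableM; last first.
  apply: differentiableM; first exact: d2.
  apply: differentiableV; last by rewrite subr_eq0.
  by apply: differentiableB; [exact: d2|exact: differentiable_cst].
apply: differentiableM; last first.
  by apply: differentiableV; [exact: differentiableXf|rewrite expf_neq0].
by apply: differentiableM; [exact: dF|exact: differentiableXf].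
Qed.

(* The exponents satisfy [m (n a %/ m) + m >= n a + 1], so the integrand is
   [O(t)] on the torus [|w1| = t^n / 2], [|w2| = t^m]. *)
Lemma laurent_integrand_small F (z2 : R[i]) (a : nat) : Ak m n k F -> z2 != 0 ->
  exists d C : R, 0 < d /\ forall t w, 0 < t -> t < d ->
    nc w.1 = t ^+ n / 2 -> nc w.2 = t ^+ m ->
    nc (laurent_integrand F z2 a w) <= C * t.
Proof.
move=> [_ _ [M /nbhs_nc2P[e e0 eM]]] z20.
have y0 : 0 < nc z2 by rewrite nc_gt0.
exists (Num.min 1 (Num.min e (nc z2 / 2))), (`|M| * 2 ^+ a / (nc z2 / 2)).
split; first by rewrite !lt_min ltr01 e0 divr_gt0.
move=> t w t0; rewrite !lt_min => /and3P[t1 te tz] w1 w2.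
have t1' := ltW t1.
have tm j : (0 < j)%N -> t ^+ j <= t.
  by move=> j0; rewrite -[leRHS]expr1; apply: ler_wiXn2l => //; exact: ltW.
have tn := tm _ n_gt0; have tmm := tm _ m_gt0.
have tn0 : 0 < t ^+ n by rewrite exprn_gt0.
have tm0 : 0 < t ^+ m by rewrite exprn_gt0.
(* Without the factor 1/2 in |w1|, both |w1|^m and |w2|^n would equal t^(m n). *)
have hw : hartogs m n w.
  apply/hartogsE; rewrite w1 w2 -exprM mulnC exprM; split.
    by rewrite ltr_pXn2r// ?nnegrE; lra.
  by rewrite exprn_ilt1 ?ltW ?exprn_gt0// -?lt0n// exprn_ilt1// -?lt0n// ltW.
have := eM w; rewrite !subr0 w1 w2.
move=> /(_ ltac:(lra) ltac:(lra) hw); rewrite nc_def lecR => FM.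
have yt : nc z2 / 2 <= nc (w.2 - z2).
  by rewrite nc_distC; apply: le_trans (nc_ler_sub _ _); rewrite w2; lra.
have yt0 : 0 < nc (w.2 - z2) by rewrite (lt_le_trans _ yt)// divr_gt0.
have -> : laurent_integrand F z2 a w =
    w.2 ^+ k * F w * (w.2 ^+ (n * a %/ m) / w.1 ^+ a * w.2) / (w.2 - z2).
  by rewrite /laurent_integrand exprD; ring.
have B : nc (w.2 ^+ (n * a %/ m) / w.1 ^+ a * w.2) <= 2 ^+ a * t.
  rewrite !ncM ncV !ncX w1 w2 exprMn exprVn invfM invrK -!exprM.
  have -> : t ^+ (m * (n * a %/ m)) * ((t ^+ (n * a))^-1 * 2 ^+ a) * t ^+ m =
      2 ^+ a * (t ^+ (m * (n * a %/ m) + m) / t ^+ (n * a)) by rewrite exprD; ring.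
  rewrite ler_pM2l ?exprn_gt0// ler_pdivrMr ?exprn_gt0// -exprS.
  apply: ler_wiXn2l => //; first exact: ltW.
  by rewrite -mulnSr [(m * _)%N]mulnC ltn_ceil.
rewrite ncM ncV ncM.
have -> : `|M| * 2 ^+ a / (nc z2 / 2) * t = `|M| * (2 ^+ a * t) / (nc z2 / 2) by ring.
apply: ler_pM; rewrite ?invr_ge0 ?mulr_ge0 ?nc_ge0//.
  by apply: ler_pM; rewrite ?nc_ge0// (le_trans FM)// ler_norm.
by rewrite lef_pV2// posrE// divr_gt0.
Qed.

End laurent.

(** * Coefficients from tori inside the domain *)

Section laurent_coefficients.
Context {R : realType}.
Variables (m n k : nat).
Hypotheses (m_gt0 : (0 < m)%N) (n_gt0 : (0 < n)%N).
Implicit Types (F : R[i] * R[i] -> R[i]).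

Local Notation LI := (laurent_integrand m n k).

Lemma neq_of_nc (u v : R[i]) : nc u != nc v -> u != v.
Proof. by apply: contraNN => /eqP ->. Qed.

Lemma le_exprn (N : nat) (x y : R) : 0 <= x -> x <= y -> x ^+ N <= y ^+ N.
Proof. by move=> x0 xy; rewrite lerXn2r// nnegrE// (le_trans x0). Qed.

(** As |w2| < |z2|, the pole is not met while the torus shrinks to radii t^n / 2 and t^m, where the
    integrand is O(t). This is where the growth condition at the origin enters. *)
Lemma tor_inner0 F (z2 : R[i]) (a : nat) (p r : R) : Ak m n k F ->
  0 < p -> 0 < r -> p ^+ m < r ^+ n -> r < nc z2 -> r < 1 ->
  tor p r (LI F z2 a) = 0.
Proof.
move=> AF p0 r0 pr ry r1.
have z20 : z2 != 0 by rewrite -nc_gt0 (lt_trans r0).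
have [d [C [d0 dC]]] := laurent_integrand_small m_gt0 n_gt0 a AF z20.
set V := fine (torus_measure R (@torus R)).
have V0 : 0 <= V by rewrite fine_ge0.
have pw : 0 < 2 * `|C| * V + 1 by rewrite ltr_wpDl// !mulr_ge0.
apply/eqP; rewrite -nc_eq0 eq_le nc_ge0 andbT.
apply/ler_addgt0Pl => e e0; rewrite addr0.
have [t [t0 [td tp tr t1 te]]] : exists t, 0 < t /\
    [/\ t < d, t <= p, t <= r, t < 1 & t <= e / (2 * `|C| * V + 1)].
  exists (Num.min (d / 2) (Num.min p (Num.min r (e / (2 * `|C| * V + 1))))).
  rewrite !lt_min !gt_min !ge_min !lexx p0 r0 r1 !divr_gt0// !orbT; split => //.
  by split => //; apply/orP; left; lra.
have tpow j : (0 < j)%N -> t ^+ j <= t.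
  by move=> j0; rewrite -[leRHS]expr1; apply: ler_wiXn2l => //; exact: ltW.
have tn := tpow _ n_gt0; have tm := tpow _ m_gt0.
have tn0 : 0 < t ^+ n by rewrite exprn_gt0.
have tm0 : 0 < t ^+ m by rewrite exprn_gt0.
have th : 0 < t ^+ n / 2 by rewrite divr_gt0.
have th0 : 0 <= t ^+ n / 2 := ltW th.
have t2 : (t ^+ n / 2) ^+ m < (t ^+ m) ^+ n.
  by rewrite -exprM mulnC exprM ltr_pXn2r// ?nnegrE; lra.
have dG w : nc w.1 != 0 -> nc w.1 ^+ m < nc w.2 ^+ n -> nc w.2 <= r ->
    differentiable (LI F z2 a) w.
  move=> w10 w12 w2r; apply: differentiable_laurent_integrand => //.
  - apply/hartogsE; split=> //; apply: (@le_lt_trans _ _ (r ^+ n)).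
      exact: le_exprn (nc_ge0 _) w2r.
    by rewrite exprn_ilt1 ?ltW// -?lt0n// -lt0n.
  - by rewrite -nc_eq0.
  - by apply: neq_of_nc; rewrite lt_eqF// (le_lt_trans w2r).
(* The radius in w1 shrinks before that in w2, so that |w1|^m < |w2|^n holds all along. *)
have E1 : tor (t ^+ n / 2) r (LI F z2 a) = tor p r (LI F z2 a).
  apply: tor_move1; [exact: th|lra|exact: ltW|].
  move=> w /andP[w1 w1'] w2; apply: dG; last by rewrite w2.
    by rewrite gt_eqF// (lt_le_trans th w1).
  by rewrite w2; exact: le_lt_trans (le_exprn m (nc_ge0 _) w1') pr.
have E2 : tor (t ^+ n / 2) (t ^+ m) (LI F z2 a) = tor (t ^+ n / 2) r (LI F z2 a).
  apply: (@tor_move2 _ (t ^+ n / 2) (t ^+ m) r _ tm0 (le_trans tm tr) th0).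
  move=> w w1 /andP[w2 w2']; apply: dG; last exact: w2'.
    by rewrite w1 (gt_eqF th).
  by rewrite w1; exact: lt_le_trans t2 (le_exprn n (ltW tm0) w2).
rewrite -E1 -E2.
apply: (@le_trans _ _ (2 * (`|C| * t) * V)).
  apply: tor_bound; [exact: th0|exact: ltW| |].
    move=> w w1 w2; apply/differentiable_continuous/dG.
    - by rewrite w1 (gt_eqF th).
    - by rewrite w1 w2.
    - by rewrite w2; lra.
  move=> w w1 w2; apply: le_trans (dC t w t0 td w1 w2) _.
  by apply: ler_wpM2r; [exact: ltW|exact: ler_norm].
have -> : 2 * (`|C| * t) * V = t * (2 * `|C| * V) by ring.
apply: (@le_trans _ _ (t * (2 * `|C| * V + 1))).
  apply: ler_wpM2l; first exact: ltW.
  by rewrite lerDl; exact: ler01.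
by rewrite -(ler_pdivlMr _ _ pw); exact: te.
Qed.

(** The torus with |w2| = r < |z2| contributes 0, so the right-hand side is a difference of two
    tori; Cauchy's formula in the annulus r <= |w2| <= b evaluates it at w2 = z2 for each w1. *)
Lemma laurent_coeff_inner F (z2 : R[i]) (a : nat) (p b : R) : Ak m n k F ->
  0 < p -> p ^+ m < nc z2 ^+ n -> nc z2 < b -> b < 1 ->
  circ p (fun w1 => F (w1, z2) / w1 ^+ a) * z2 ^+ (k + n * a %/ m) * (2 * pi)%:C =
  tor p b (LI F z2 a).
Proof.
move=> AF p0 py yb b1.
have y0 : 0 < nc z2.
  rewrite lt_neqAle nc_ge0 andbT; apply/negP => /eqP z0; move: py.
  by rewrite -z0 expr0n gtn_eqF//= ltNge exprn_ge0// ltW.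
have b0 : 0 < b by exact: lt_trans yb.
(* The inner radius r = l |z2| must lie below |z2| and still satisfy p^m < r^n. *)
have [l [l0 l1 lc]] : exists l : R, [/\ 0 < l, l < 1 & p ^+ m / nc z2 ^+ n < l ^+ n].
  by apply: ex_lt_pow; rewrite ltr_pdivrMr ?exprn_gt0// mul1r.
pose r := l * nc z2.
have r0 : 0 < r by rewrite mulr_gt0.
have ry : r < nc z2 by rewrite gtr_pMl.
have pr : p ^+ m < r ^+ n by rewrite exprMn -ltr_pdivrMr// exprn_gt0.
have rb : r <= b by rewrite ltW// (lt_trans ry).
have bn1 : b ^+ n < 1 by rewrite exprn_ilt1 ?ltW// -?lt0n// -lt0n.
have hart w : nc w.1 = p -> r <= nc w.2 -> nc w.2 <= b -> hartogs m n w.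
  move=> w1 w2 w2'; apply/hartogsE; rewrite w1; split.
    exact: lt_le_trans pr (le_exprn n (ltW r0) w2).
  exact: le_lt_trans (le_exprn n (nc_ge0 _) w2') bn1.
have dG w : nc w.1 = p -> r <= nc w.2 -> nc w.2 <= b -> nc w.2 != nc z2 ->
    differentiable (LI F z2 a) w.
  move=> w1 w2 w2' w2z; apply: differentiable_laurent_integrand => //.
  - exact: hart.
  - by rewrite -nc_gt0 w1.
  - exact: neq_of_nc.
have wb : {within @torus R, continuous (fun w => LI F z2 a (p%:C * w.1, b%:C * w.2))}.
  apply: within_tor; [exact: ltW|exact: ltW|] => w w1 w2.
  by apply/differentiable_continuous/dG; rewrite ?w2 ?lexx// gt_eqF.
have wr : {within @torus R, continuous (fun w => LI F z2 a (p%:C * w.1, r%:C * w.2))}.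
  apply: within_tor; [exact: ltW|exact: ltW|] => w w1 w2.
  by apply/differentiable_continuous/dG; rewrite ?w2 ?lexx// lt_eqF.
have r1 : r < 1 by rewrite (le_lt_trans rb).
rewrite -[RHS]subr0 -(tor_inner0 a AF p0 r0 pr ry r1) /tor.
rewrite -[RHS](cintB (mu := torus_measure R) measurable_torus
  (continuous_torus_integrable wb) (continuous_torus_integrable wr)).
have wbr : {within @torus R, continuous (fun w =>
    LI F z2 a (p%:C * w.1, b%:C * w.2) - LI F z2 a (p%:C * w.1, r%:C * w.2))}.
  by move=> w; apply: cvgB; [exact: wb|exact: wr].
rewrite [RHS](torus_integral_fubini wbr).1.
have inner w1 : nc w1 = 1 ->
    circle_integral (fun w2 =>
      LI F z2 a (p%:C * w1, b%:C * w2) - LI F z2 a (p%:C * w1, r%:C * w2)) =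
    z2 ^+ (k + n * a %/ m) * (2 * pi)%:C * (F (p%:C * w1, z2) / (p%:C * w1) ^+ a).
  move=> h1.
  have pw : nc (p%:C * w1) = p by rewrite nc_scale// ltW.
  have cG s : r <= s -> s <= b -> s != nc z2 -> forall w, nc w = s ->
      {for w, continuous (fun w2 => LI F z2 a (p%:C * w1, w2))}.
    move=> rs sb sz w ws; apply/differentiable_continuous/differentiable_slice2.
    by apply: dG => //=; rewrite ws.
  rewrite /circle_integral cintB; first last.
  - apply: (@circ_integrable _ r (fun w2 => LI F z2 a (p%:C * w1, w2))); first exact: ltW.
    by apply: cG => //; rewrite ?lt_eqF.
  - apply: (@circ_integrable _ b (fun w2 => LI F z2 a (p%:C * w1, w2))); first exact: ltW.
    by apply: cG => //; rewrite ?gt_eqF.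
  - exact: measurable_circle.
  have := @cauchy_annulus _ (fun w2 => F (p%:C * w1, w2) * w2 ^+ (k + n * a %/ m)
      / (p%:C * w1) ^+ a) z2 r b r0 ry yb.
  rewrite /circ /circle_integral => ->.
    by ring.
  move=> w /andP[rw wb']; apply: differentiableM; last exact: differentiable_cst.
  apply: differentiableM; last exact/differentiableXf/differentiable_idc.
  have [dF _ _] := AF; apply: differentiable_slice2; apply: dF.
  exact: hart.
transitivity (circle_integral (fun w1 => z2 ^+ (k + n * a %/ m) * (2 * pi)%:C *
   (F (p%:C * w1, z2) / (p%:C * w1) ^+ a))).
  rewrite /circle_integral cintZ; first by rewrite /circ /circle_integral; ring.
    exact: measurable_circle.
  apply: (@circ_integrable _ p (fun w => F (w, z2) / w ^+ a)); first exact: ltW.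
  move=> w wp; apply/differentiable_continuous/differentiableM.
    have [dF _ _] := AF; apply: differentiable_slice1; apply: dF.
    by apply: hart; rewrite /= ?wp// ltW.
  apply: differentiableV; first exact: differentiableXf.
  by rewrite expf_neq0// -nc_gt0 wp.
by apply: eq_cint => w1; rewrite inE => /unit_circleE /inner.
Qed.

End laurent_coefficients.

(** * Passage to the distinguished torus *)

Section laurent_boundary.
Context {R : realType}.
Variables (m n k : nat).
Hypotheses (m_gt0 : (0 < m)%N) (n_gt0 : (0 < n)%N).
Implicit Types (F : R[i] * R[i] -> R[i]).

Local Notation LI := (laurent_integrand m n k).

Lemma within_mul_differentiable (D E : set (R[i] * R[i])) F Q :
  {within E, continuous F} -> D `<=` E -> (forall w, D w -> differentiable Q w) ->
  {within D, continuous (fun w => F w * Q w)}.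
Proof.
move=> cF DE dQ; have /subspace_continuousP cF' := continuous_subspaceW DE cF.
apply/subspace_continuousP => w Dw; apply: cvgM; first exact: cF'.
apply: cvg_within_filter; exact/differentiable_continuous/dQ.
Qed.

Lemma continuous_dilation (p q : nat) :
  continuous (fun x : R * (R[i] * R[i]) =>
    ((x.1 ^+ p)%:C * x.2.1, (x.1 ^+ q)%:C * x.2.2)).
Proof.
have cp j : continuous (fun x : R * (R[i] * R[i]) => (x.1 ^+ j)%:C).
  move=> x; apply: (@continuous_comp _ _ _
    (fun x : R * (R[i] * R[i]) => x.1 ^+ j) (real_complex R)).
    apply: (@continuous_comp _ _ _ fst (fun y : R => y ^+ j)); first exact: cvg_fst.
    exact: exprn_continuous.
  exact: continuous_real_complex.
move=> x.
apply: (@cvg_pair _ _ _ (nbhs x) (nbhs ((x.1 ^+ p)%:C * x.2.1))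
    (nbhs ((x.1 ^+ q)%:C * x.2.2)) (nbhs_filter _) (nbhs_filter _) (nbhs_filter _)).
  apply: (@continuousM _ _ (fun x : R * (R[i] * R[i]) => (x.1 ^+ p)%:C)
    (fun x => x.2.1)); first exact: cp.
  by apply: (@continuous_comp _ _ _ snd fst); [exact: cvg_snd|exact: cvg_fst].
apply: (@continuousM _ _ (fun x : R * (R[i] * R[i]) => (x.1 ^+ q)%:C)
  (fun x => x.2.2)); first exact: cp.
by apply: (@continuous_comp _ _ _ snd snd); [exact: cvg_snd|exact: cvg_snd].
Qed.

Lemma expr_lt_1 (N : nat) (x : R) : (0 < N)%N -> 0 <= x -> x < 1 -> x ^+ N < 1.
Proof. by move=> N0 x0 x1; rewrite exprn_ilt1// -lt0n. Qed.

(** The torus of radii (p, b) moves inside the domain to radii (x^(n+1), x^m) without changing the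
    integral. Then x tends to 1, and continuity on the union of the domain and the torus identifies
    the limit. *)
Lemma laurent_coeff F (z2 : R[i]) (a : nat) (p : R) : Ak m n k F ->
  0 < p -> p ^+ m < nc z2 ^+ n -> nc z2 < 1 ->
  circ p (fun w1 => F (w1, z2) / w1 ^+ a) * z2 ^+ (k + n * a %/ m) * (2 * pi)%:C =
  torus_integral (LI F z2 a).
Proof.
move=> AF p0 py y1.
have p1 : p < 1.
  rewrite -(@expr_lt1 _ m)//; last exact: ltW.
  by apply: (lt_trans py); exact: expr_lt_1 n_gt0 (nc_ge0 _) y1.
pose b := (nc z2 + 1) / 2.
have yb : nc z2 < b by rewrite /b; lra.
have b1 : b < 1 by rewrite /b; lra.
rewrite (laurent_coeff_inner m_gt0 n_gt0 a AF p0 py yb b1).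
(* For x in [l, 1] both radii x^m and x^(n+1) exceed max(b, p), so tori only grow and stay beyond
   the pole z2. *)
have [l [l0 l1 lbp]] : exists l : R, [/\ 0 < l, l < 1 &
    Num.max b p < l ^+ (m + n.+1)].
  by apply: ex_lt_pow; rewrite gt_max b1 p1.
have lpow (x : R) j : (j <= m + n.+1)%N -> l <= x -> x <= 1 -> Num.max b p < x ^+ j.
  move=> jmn lx x1; apply: (lt_le_trans lbp).
  apply: (@le_trans _ _ (l ^+ j)); last exact: le_exprn (ltW l0) lx.
  by apply: ler_wiXn2l => //; exact: ltW.
have lm (x : R) : l <= x -> x <= 1 -> b < x ^+ m.
  by move=> lx x1; have := lpow x m (leq_addr _ _) lx x1; rewrite gt_max => /andP[].
have ln (x : R) : l <= x -> x <= 1 -> p < x ^+ n.+1.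
  by move=> lx x1; have := lpow x n.+1 (leq_addl _ _) lx x1; rewrite gt_max => /andP[].
have b0 : 0 < b by exact: le_lt_trans (nc_ge0 _) yb.
have dG w : p <= nc w.1 -> nc z2 < nc w.2 -> hartogs m n w ->
    differentiable (LI F z2 a) w.
  move=> w1 w2 hw; apply: differentiable_laurent_integrand => //.
    by rewrite -nc_gt0; exact: lt_le_trans p0 w1.
  by apply: neq_of_nc; rewrite gt_eqF.
have dil_hartogs (x u v : R) : 0 < x -> x < 1 -> u <= x ^+ n.+1 -> 0 <= u -> v = x ^+ m ->
    u ^+ m < v ^+ n /\ v ^+ n < 1.
  move=> x0 x1 ux u0 ->; split; last first.
    rewrite -exprM; apply: expr_lt_1; [by rewrite muln_gt0 m_gt0|exact: ltW|exact: x1].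
  apply: le_lt_trans (le_exprn m u0 ux) _.
  rewrite -!exprM mulSn exprD mulnC gtr_pMl ?exprn_gt0//.
  exact: expr_lt_1 m_gt0 (ltW x0) x1.
(* The radius in w2 is enlarged first, which makes room for enlarging the one in w1. *)
have move_ (x : R) : l <= x -> x < 1 -> tor p b (LI F z2 a) =
    tor (x ^+ n.+1) (x ^+ m) (LI F z2 a).
  move=> lx x1; have x0 : 0 < x by exact: lt_le_trans l0 lx.
  have lmx := lm x lx (ltW x1); have lnx := ln x lx (ltW x1).
  rewrite (@tor_move2 _ p b (x ^+ m) _ b0 (ltW lmx) (ltW p0)).
    apply: (@tor_move1 _ p (x ^+ n.+1) (x ^+ m) _ p0 (ltW lnx)).
      exact: exprn_ge0 (ltW x0).
    move=> w /andP[w1 w1'] w2; apply: dG => //.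
      by rewrite w2; exact: lt_trans yb lmx.
    by apply/hartogsE; exact: (dil_hartogs x _ _ x0 x1 w1' (nc_ge0 _) w2).
  move=> w w1 /andP[w2 w2']; have w2y := lt_le_trans yb w2.
  apply: dG => //; first by rewrite w1.
  apply/hartogsE; rewrite w1; split.
    exact: lt_le_trans py (le_exprn n (nc_ge0 _) (ltW w2y)).
  apply: le_lt_trans (le_exprn n (nc_ge0 _) w2') _.
  rewrite -exprM; apply: expr_lt_1; [by rewrite muln_gt0 m_gt0|exact: ltW|exact: x1].
(* The largest set on which continuity of F passes to the integrand: no zero of w1 and no pole. *)
pose E := [set w : R[i] * R[i] | (hartogs m n `|` @torus R) w /\
   (w.1 != 0) /\ w.2 != z2].
have cLI : {within E, continuous (LI F z2 a)}.
  have [_ cF _] := AF.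
  pose Q (w : R[i] * R[i]) := w.2 ^+ (k + n * a %/ m) / w.1 ^+ a * (w.2 / (w.2 - z2)).
  have -> : LI F z2 a = fun w => F w * Q w.
    by apply/funext => w; rewrite /laurent_integrand /Q !mulrA.
  apply: within_mul_differentiable cF _ _; first by move=> w [].
  move=> w [_ [w1 w2]].
  have d1 := differentiable_fst w; have d2 := differentiable_snd w.
  apply: differentiableM; last first.
    apply: differentiableM; first exact: d2.
    apply: differentiableV; last by rewrite subr_eq0.
    by apply: differentiableB; [exact: d2|exact: differentiable_cst].
  apply: differentiableM; first exact: differentiableXf.
  by apply: differentiableV; [exact: differentiableXf|rewrite expf_neq0].
pose phi (x : R * (R[i] * R[i])) := ((x.1 ^+ n.+1)%:C * x.2.1, (x.1 ^+ m)%:C * x.2.2).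
have ch : {within `[l, 1]%classic `*` @torus R, continuous (fun x => LI F z2 a (phi x))}.
  apply: within_continuous_comp cLI.
    move=> [x w] [/=]; rewrite in_itv/= => /andP[lx x1] /torusE[w1 w2].
    have x0 : 0 < x by exact: lt_le_trans l0 lx.
    have n1 : nc ((x ^+ n.+1)%:C * w.1) = x ^+ n.+1.
      by rewrite nc_scale// exprn_ge0// ltW.
    have n2 : nc ((x ^+ m)%:C * w.2) = x ^+ m.
      by rewrite nc_scale// exprn_ge0// ltW.
    split; last split.
    - move: x1; rewrite le_eqVlt => /predU1P[xE|x1].
        by right; apply/torusE; rewrite /= n1 n2 xE !expr1n.
      left; apply/hartogsE; rewrite /= n1 n2.
      by apply: (dil_hartogs x) => //; exact: exprn_ge0 (ltW x0).
    - by rewrite -nc_gt0 n1 exprn_gt0.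
    - by apply: neq_of_nc; rewrite n2 gt_eqF// (lt_trans yb)// lm.
  by apply: continuous_subspaceT; exact: continuous_dilation.
pose u j := 1 - (1 - l) * j.+1%:R^-1.
have j0 j : 0 < j.+1%:R^-1 :> R by rewrite invr_gt0.
have j1 j : j.+1%:R^-1 <= 1 :> R by rewrite invf_le1// ler1n.
have ul j : l <= u j /\ u j < 1.
  rewrite /u; move: (j.+1%:R^-1) (j0 j) (j1 j) => s s0 s1.
  have h1 : 0 < (1 - l) * s by rewrite mulr_gt0// subr_gt0.
  have h2 : 0 <= (1 - l) * (1 - s) by rewrite mulr_ge0// subr_ge0// ltW.
  by split; lra.
have uab j : u j \in `[l, 1] by rewrite in_itv/=; have [-> /ltW ->] := ul j.
have u1 : u @ \oo --> (1 : R).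
  rewrite -[X in _ --> X]subr0 -[X in _ --> _ - X](mulr0 (1 - l)).
  by apply: cvgB; [exact: cvg_cst|apply: cvgMr; exact: cvg_harmonic].
have l1' : 1 \in `[l, 1] by rewrite in_itv/= lexx ltW.
have := cvg_torus_integral ch uab l1' u1.
have -> : (fun j => torus_integral (fun w => LI F z2 a (phi (u j, w)))) =
    fun=> tor p b (LI F z2 a).
  by apply/funext => j; rewrite (move_ (u j)) ?(ul j).1 ?(ul j).2.
have -> : torus_integral (fun w => LI F z2 a (phi (1, w))) =
    torus_integral (LI F z2 a).
  congr torus_integral; apply/funext => -[w1 w2].
  by rewrite /phi/= !expr1n !mul1r.
by move/cvg_lim => <- //; rewrite lim_cst.
Qed.

End laurent_boundary.

(** * The kernel *)

Section szego_kernel.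
Context {R : realType}.
Variables (m n k : nat).
Hypotheses (m_gt0 : (0 < m)%N) (n_gt0 : (0 < n)%N).

Definition szego (z w : R[i] * R[i]) : R[i] :=
  1 / (4 * (pi : R)%:C ^+ 2) *
  ((z.2 * conjc w.2) ^- k * Pmn m n (z.1 * conjc w.1) (z.2 * conjc w.2) /
   (((z.2 * conjc w.2) ^+ n - (z.1 * conjc w.1) ^+ m) * (1 - z.2 * conjc w.2))).

(** The kernel without its constant, as a function of two complex variables. With arguments conj(z)
    w it gives the conjugated kernel, holomorphic in w; with z / w it gives the kernel on the
    torus. *)
Definition szego_fun (u v : R[i]) : R[i] :=
  v ^- k * Pmn m n u v / ((v ^+ n - u ^+ m) * (1 - v)).

Lemma conjcM (a b : R[i]) : conjc (a * b) = conjc a * conjc b. Proof. exact: rmorphM. Qed.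
Lemma conjcB (a b : R[i]) : conjc (a - b) = conjc a - conjc b. Proof. exact: rmorphB. Qed.
Lemma conjcX (a : R[i]) j : conjc (a ^+ j) = conjc a ^+ j. Proof. exact: rmorphXn. Qed.

Lemma szego_conj z w : conjc (szego z w) =
  1 / (4 * (pi : R)%:C ^+ 2) * szego_fun (conjc z.1 * w.1) (conjc z.2 * w.2).
Proof.
have P (u v : R[i]) : conjc (Pmn m n u v) = Pmn m n (conjc u) (conjc v).
  rewrite /Pmn -[LHS]/(conjc _) rmorph_sum; apply: eq_bigr => i _ /=.
  by rewrite conjcM !conjcX.
have C : conjc (1 / (4 * (pi : R)%:C ^+ 2)) = 1 / (4 * (pi : R)%:C ^+ 2) :> R[i].
  have -> : 1 / (4 * (pi : R)%:C ^+ 2) = (1 / (4 * pi ^+ 2))%:C :> R[i].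
    by rewrite fmorph_div rmorph1 rmorphM rmorphXn rmorph_nat.
  exact: conjc_real.
rewrite /szego /szego_fun conjcM C; congr (_ * _).
by rewrite !(conjcM, conjc_inv, conjcX, conjcB) P !conjcM conjc1 !conjcK.
Qed.

Lemma szego_fun_neq0 (u v : R[i]) : nc u ^+ m < nc v ^+ n -> nc v < 1 ->
  [/\ v != 0, v ^+ n - u ^+ m != 0 & 1 - v != 0].
Proof.
move=> uv v1; split.
- apply: contraTneq uv => ->; rewrite nc0 expr0n gtn_eqF//=.
  by rewrite -leNgt exprn_ge0// nc_ge0.
- rewrite subr_eq0; apply: contraTneq uv => /(congr1 (@Normc.normc R)).
  by rewrite !ncX => ->; rewrite ltxx.
- by rewrite subr_eq0; apply: contraTneq v1 => <-; rewrite nc1 ltxx.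
Qed.

(** Multiplication by a point of the domain sends the domain together with the torus into the open
    domain. Hence the conjugated kernel has no pole up to and including the torus. *)
Lemma scaled_hartogs (z w : R[i] * R[i]) : hartogs m n z ->
  (hartogs m n `|` @torus R) w ->
  nc (conjc z.1 * w.1) ^+ m < nc (conjc z.2 * w.2) ^+ n /\ nc (conjc z.2 * w.2) < 1.
Proof.
move=> /(hartogs_nc m_gt0 n_gt0)[y0 y1 x1 xy] hw.
have [w12 w20 w21] : [/\ nc w.1 ^+ m <= nc w.2 ^+ n, 0 < nc w.2 & nc w.2 <= 1].
  case: hw => [/(hartogs_nc m_gt0 n_gt0)[? ? ? ?]|/torusE[-> ->]].
    by split=> //; exact: ltW.
  by rewrite !expr1n.
rewrite !ncM !nc_conj !exprMn; split.
  apply: (@le_lt_trans _ _ (nc z.1 ^+ m * nc w.2 ^+ n)).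
    by rewrite ler_wpM2l// exprn_ge0// nc_ge0.
  by rewrite ltr_pM2r// exprn_gt0.
by apply: le_lt_trans (ler_piMr (ltW y0) w21) y1.
Qed.

Lemma differentiable_szego_fun (a b : R[i]) (w : R[i] * R[i]) :
  nc (a * w.1) ^+ m < nc (b * w.2) ^+ n -> nc (b * w.2) < 1 ->
  differentiable (fun w => szego_fun (a * w.1) (b * w.2)) w.
Proof.
move=> h1 h2; have [v0 uv v1] := szego_fun_neq0 h1 h2.
have d1 : differentiable (fun w : R[i] * R[i] => a * w.1) w.
  by apply: differentiableM; [exact: differentiable_cst|exact: differentiable_fst].
have d2 : differentiable (fun w : R[i] * R[i] => b * w.2) w.
  by apply: differentiableM; [exact: differentiable_cst|exact: differentiable_snd].
have dP : differentiable (fun w : R[i] * R[i] => Pmn m n (a * w.1) (b * w.2)) w.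
  have -> : (fun w : R[i] * R[i] => Pmn m n (a * w.1) (b * w.2)) =
     \sum_(r < m) (fun w : R[i] * R[i] => (a * w.1) ^+ r * (b * w.2) ^+ (n - n * r %/ m)).
    by apply/funext => v; rewrite /Pmn fct_sumE.
  apply: differentiable_sum => r; apply: differentiableM; exact: differentiableXf.
apply: differentiableM.
  apply: differentiableM; last exact: dP.
  by apply: differentiableV; [exact: differentiableXf|rewrite expf_neq0].
apply: differentiableV; last by rewrite mulf_neq0.
apply: differentiableM; apply: differentiableB;
  [exact: differentiableXf|exact: differentiableXf|exact: differentiable_cst|exact: d2].
Qed.

(** Differentiability and continuity hold because no denominator vanishes. For the growth at the
    origin, w2^k cancels v^(-k) up to a constant, and numerator and denominator are both of order
    |v|^n. *)
Lemma szego_conj_Ak (z : R[i] * R[i]) : hartogs m n z ->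
  Ak m n k (fun w => conjc (szego z w)).
Proof.
move=> hz; have [y0 y1 x1 xy] := hartogs_nc m_gt0 n_gt0 hz.
have -> : (fun w => conjc (szego z w)) = fun w =>
    1 / (4 * (pi : R)%:C ^+ 2) * szego_fun (conjc z.1 * w.1) (conjc z.2 * w.2).
  by apply/funext => w; exact: szego_conj.
have dS w : (hartogs m n `|` @torus R) w -> differentiable (fun w : R[i] * R[i] =>
    1 / (4 * (pi : R)%:C ^+ 2) * szego_fun (conjc z.1 * w.1) (conjc z.2 * w.2)) w.
  move=> /(scaled_hartogs hz)[h1 h2]; apply: differentiableM.
    exact: differentiable_cst.
  exact: differentiable_szego_fun.
split.
- by move=> w hw; apply: dS; left.
- apply: continuous_in_subspaceT => w; rewrite inE => hw.
  by apply/differentiable_continuous/dS.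
move: (1 / _) => C.
(* With u, v the scaled variables, |u|^m <= c |v|^n and c < 1, so |v^n - u^m| is at least (1 - c)
   |v|^n. *)
pose c := nc z.1 ^+ m / nc z.2 ^+ n.
have yn0 : 0 < nc z.2 ^+ n by rewrite exprn_gt0.
have c1 : 0 < 1 - c by rewrite subr_gt0 ltr_pdivrMr// mul1r.
exists (nc C * (nc z.2 ^- k * (m%:R / (1 - c) / (1 - nc z.2)))).
apply/nbhs_nc2P; exists 1 => // w _ _ hw; rewrite nc_def lecR.
have [_ _ _ w12] := hartogs_nc m_gt0 n_gt0 hw.
have [w20 w21 _ _] := hartogs_nc m_gt0 n_gt0 hw.
have [h1 h2] := scaled_hartogs hz (or_introl hw).
have [v0 uv v1] := szego_fun_neq0 h1 h2.
have [u uE] : exists u, u = conjc z.1 * w.1 by eexists.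
have [v vE] : exists v, v = conjc z.2 * w.2 by eexists.
rewrite /szego_fun -uE -vE; rewrite -uE -vE in h1 h2 v0 uv v1.
have nv0 : 0 < nc v by rewrite nc_gt0.
have -> : w.2 ^+ k * (C * (v ^- k * Pmn m n u v / ((v ^+ n - u ^+ m) * (1 - v)))) =
    C * ((w.2 / v) ^+ k * (Pmn m n u v / (v ^+ n - u ^+ m) / (1 - v))).
  by rewrite exprMn exprVn invfM; ring.
rewrite !ncM; apply: ler_wpM2l; first exact: nc_ge0.
rewrite ncX ncM ncV.
have -> : nc w.2 / nc v = (nc z.2)^-1.
  by rewrite vE ncM nc_conj; field; rewrite !gt_eqF.
rewrite exprVn; apply: ler_wpM2l; first by rewrite invr_ge0 exprn_ge0// ltW.
rewrite !ncV; apply: ler_pM.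
- by rewrite mulr_ge0 ?invr_ge0 ?nc_ge0.
- by rewrite invr_ge0 nc_ge0.
- have den : nc v ^+ n * (1 - c) <= nc (v ^+ n - u ^+ m).
    apply: le_trans (nc_ler_sub _ _); rewrite !ncX mulrBr mulr1 lerD2l lerN2.
    rewrite uE vE !ncM !nc_conj !exprMn /c.
    have -> : nc z.2 ^+ n * nc w.2 ^+ n * (nc z.1 ^+ m / nc z.2 ^+ n) =
       nc z.1 ^+ m * nc w.2 ^+ n by field; rewrite gt_eqF.
    by apply: ler_wpM2l; [exact: exprn_ge0 (nc_ge0 _)|exact: ltW].
  have num : nc (Pmn m n u v) <= m%:R * nc v ^+ n.
    rewrite /Pmn; apply: le_trans (nc_ler_sum _ _) _.
    have -> : m%:R * nc v ^+ n = \sum_(r < m) nc v ^+ n.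
      by rewrite sumr_const card_ord mulr_natl.
    apply: ler_sum => r _; rewrite ncM !ncX.
    have qn : (n * r %/ m <= n)%N.
      by rewrite -[leqRHS](mulnK n m_gt0) leq_div2r// leq_mul2l ltnW ?orbT.
    rewrite -[in leRHS](subnKC qn) exprD; apply: ler_wpM2r.
      exact: exprn_ge0 (nc_ge0 _).
    (* Raised to the power m, the claim |u|^r <= |v|^floor(n r / m) follows from |u|^m < |v|^n, |v|
       < 1 and m floor(n r / m) <= n r. *)
    rewrite -(@ler_pXn2r _ m)// ?nnegrE ?exprn_ge0 ?nc_ge0//.
    rewrite -!exprM mulnC exprM; apply: (@le_trans _ _ ((nc v ^+ n) ^+ r)).
      by apply: le_exprn; [exact: exprn_ge0 (nc_ge0 _)|exact: ltW].
    rewrite -exprM; apply: ler_wiXn2l; [exact: nc_ge0|exact: ltW|].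
    exact: leq_divM.
  have vn0 : 0 < nc v ^+ n by rewrite exprn_gt0.
  have vnc : 0 < nc v ^+ n * (1 - c) by exact: mulr_gt0.
  apply: (@le_trans _ _ (m%:R * nc v ^+ n / (nc v ^+ n * (1 - c)))); last first.
    by rewrite le_eqVlt; apply/orP; left; apply/eqP; field; rewrite !gt_eqF.
  apply: ler_pM; [exact: nc_ge0|by rewrite invr_ge0 nc_ge0|exact: num|].
  by rewrite lef_pV2// posrE (lt_le_trans vnc).
- have h3 : 1 - nc z.2 <= nc (1 - v).
    apply: le_trans (nc_ler_sub _ _); rewrite nc1 lerD2l lerN2 vE ncM nc_conj.
    by apply: ler_piMr; [exact: nc_ge0|exact: ltW].
  by rewrite lef_pV2// posrE ?subr_gt0// (lt_le_trans _ h3)// subr_gt0.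
Qed.

End szego_kernel.

(** * Summation of the kernel and Taylor series in z1 *)

Section reproducing.
Context {R : realType}.
Variables (m n k : nat).
Hypotheses (m_gt0 : (0 < m)%N) (n_gt0 : (0 < n)%N).
Implicit Types (F : R[i] * R[i] -> R[i]).

(** As floor(n (m N + r) / m) = n N + floor(n r / m), the N-th block of m terms is (u^m / v^n)^N
    times the first one, which is a multiple of P(u, v) / v^n. The blocks form a geometric
    progression. *)
Lemma partial_szego_fun (N : nat) (u v : R[i]) :
  v != 0 -> v ^+ n - u ^+ m != 0 -> 1 - v != 0 ->
  \sum_(a < m * N) u ^+ a / v ^+ (k + n * a %/ m) / (1 - v) =
  szego_fun m n k u v * (1 - (u ^+ m / v ^+ n) ^+ N).
Proof.
move=> v0 uv v1; elim: N => [|N ih].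
  by rewrite muln0 big_ord0 expr0 subrr mulr0.
rewrite mulnS addnC big_split_ord /= ih.
have P : \sum_(r < m) u ^+ r / v ^+ (n * r %/ m) = Pmn m n u v / v ^+ n.
  rewrite /Pmn mulr_suml; apply: eq_bigr => r _.
  have qn : (n * r %/ m <= n)%N.
    by rewrite -[leqRHS](mulnK n m_gt0) leq_div2r// leq_mul2l ltnW ?orbT.
  rewrite -[X in _ = _ / v ^+ X](subnKC qn) exprD.
  by field; rewrite !expf_neq0.
have -> : \sum_(r < m) u ^+ (m * N + r) / v ^+ (k + n * (m * N + r) %/ m) / (1 - v) =
    (u ^+ m / v ^+ n) ^+ N * (v ^- k / (1 - v)) * (Pmn m n u v / v ^+ n).
  rewrite -P mulr_sumr; apply: eq_bigr => r _.
  have -> : (n * (m * N + r) %/ m = n * N + n * r %/ m)%N.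
    by rewrite mulnDr mulnCA [(m * _)%N]mulnC divnMDl.
  rewrite exprMn exprVn -!exprM !exprD.
  by field; rewrite v1 !expf_neq0.
rewrite /szego_fun exprS.
by field; rewrite v1 uv !expf_neq0.
Qed.

Lemma geometric_partial (N : nat) (q : R[i]) : 1 - q != 0 ->
  \sum_(a < N) q ^+ a = (1 - q ^+ N) / (1 - q).
Proof.
move=> q1; elim: N => [|N ih]; first by rewrite big_ord0 expr0 subrr mul0r.
by rewrite big_ord_recr /= ih exprS; field.
Qed.

Lemma cvg_expr_nc (q : R[i]) : nc q < 1 -> (fun N => q ^+ N) @ \oo --> (0 : R[i]).
Proof.
move=> q1; apply/cvg_ncP => e e0.
have := @cvg_expr R (nc q); rewrite ger0_norm ?nc_ge0// => /(_ q1).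
move=> /cvgrPdist_lt/(_ _ e0); apply: filterS => N.
by rewrite sub0r normrN ger0_norm ?exprn_ge0 ?nc_ge0// subr0 ncX.
Qed.

Lemma cvg_one_sub_expr (c q : R[i]) : nc q < 1 ->
  (fun N => c * (1 - q ^+ N)) @ \oo --> c.
Proof.
move=> q1; have H : (fun N => c * (1 - q ^+ N)) @ \oo --> c * (1 - 0).
  apply: cvgM; first exact: cvg_cst.
  by apply: cvgB; [exact: cvg_cst|exact: cvg_expr_nc].
by move: H; rewrite subr0 mulr1.
Qed.

Lemma nc_one_sub_expr (q : R[i]) N : nc q < 1 -> nc (1 - q ^+ N) <= 2.
Proof.
move=> q1; apply: le_trans (ncB _ _) _; rewrite nc1 ncX -[2]/(1 + 1) lerD2l.
by rewrite exprn_ile1 ?nc_ge0// ltW.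
Qed.

(** For fixed z2 the whole disc |w| <= p lies in the slice of the domain, so Cauchy's formula in a
    disc applies. Expanding its kernel in powers of z1 / w, the partial sums differ from it by a
    factor 1 - (z1/w)^N of modulus at most 2. *)
Lemma taylor_cvg F (z : R[i] * R[i]) (p : R) : Ak m n k F -> hartogs m n z ->
  nc z.1 < p -> p ^+ m < nc z.2 ^+ n ->
  (fun N => \sum_(a < N) z.1 ^+ a * circ p (fun w => F (w, z.2) / w ^+ a)) @ \oo -->
  F z * (2 * pi)%:C.
Proof.
move=> AF hz xp py; have [y0 y1 x1 xy] := hartogs_nc m_gt0 n_gt0 hz.
have p0 : 0 < p by exact: le_lt_trans (nc_ge0 _) xp.
have dF w : nc w <= p -> differentiable (fun w => F (w, z.2)) w.
  move=> wp; have [dF _ _] := AF; apply: differentiable_slice1; apply: dF.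
  apply/hartogsE; split; first exact: le_lt_trans (le_exprn m (nc_ge0 _) wp) py.
  by have /hartogsE[] := hz.
have <- : circ p (fun w => F (w, z.2) * (w / (w - z.1))) = F z * (2 * pi)%:C.
  by rewrite (cauchy_disc xp dF) -surjective_pairing.
have wn0 (w : R[i]) : nc w = p -> w != 0 by move=> wp; rewrite -nc_gt0 wp.
have q1 (w : R[i]) : nc w = p -> nc (z.1 / w) < 1.
  by move=> wp; rewrite ncM ncV wp ltr_pdivrMr// mul1r.
have q1n (w : R[i]) : nc w = p -> 1 - z.1 / w != 0.
  move=> /q1 q; rewrite subr_eq0; apply: contraTneq q => <-.
  by rewrite nc1 ltxx.
have wz (w : R[i]) : nc w = p -> w - z.1 != 0.
  by move=> wp; rewrite subr_eq0; apply: neq_of_nc; rewrite wp gt_eqF.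
have dterm w a : nc w = p -> differentiable (fun w => F (w, z.2) / w ^+ a) w.
  move=> wp; apply: differentiableM; first by apply: dF; rewrite wp.
  by apply: differentiableV; [exact: differentiableXf|rewrite expf_neq0// wn0].
have iterm (a : nat) : cintegrable (@arclength R) (@unit_circle R)
    (fun w => F (p%:C * w, z.2) / (p%:C * w) ^+ a).
  apply: (@circ_integrable _ p (fun w => F (w, z.2) / w ^+ a)); first exact: ltW.
  by move=> w wp; exact/differentiable_continuous/dterm.
have mC := @measurable_circle R.
pose f N w := \sum_(a < N) z.1 ^+ a * (F (p%:C * w, z.2) / (p%:C * w) ^+ a).
have -> : (fun N => \sum_(a < N) z.1 ^+ a * circ p (fun w => F (w, z.2) / w ^+ a)) =
    fun N => cint (@arclength R) (@unit_circle R) (f N).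
  apply/funext => N; rewrite /f.
  have [_ ->] := @cint_sum _ _ _ (@arclength R) (@unit_circle R) _ (index_enum 'I_N)
      (fun a w => z.1 ^+ a * (F (p%:C * w, z.2) / (p%:C * w) ^+ a)) mC
      (fun a => cintegrableZ _ mC (iterm a)).
  by apply: eq_bigr => a _; rewrite cintZ.
pose g (w : R[i]) := F (p%:C * w, z.2) * (p%:C * w / (p%:C * w - z.1)).
have cg : {within @unit_circle R, continuous g}.
  apply: (@within_circ _ p (fun w => F (w, z.2) * (w / (w - z.1)))); first exact: ltW.
  move=> w wp; apply/differentiable_continuous/differentiableM.
    by apply: dF; rewrite wp.
  by apply: differentiable_cauchy_kernel; rewrite -subr_eq0 wz.
have fE N w : unit_circle w -> f N w = g w * (1 - (z.1 / (p%:C * w)) ^+ N).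
  move=> /unit_circleE w1; have wp : nc (p%:C * w) = p by rewrite nc_scale// ltW.
  rewrite /f /g; transitivity (F (p%:C * w, z.2) * \sum_(a < N) (z.1 / (p%:C * w)) ^+ a).
    rewrite mulr_sumr; apply: eq_bigr => a _; rewrite expr_div_n; ring.
  rewrite (geometric_partial _ (q1n _ wp)).
  move: (p%:C * w) wp => W wp; have W0 := wn0 _ wp; have W1 := wz _ wp.
  have -> : 1 - z.1 / W = (W - z.1) / W by field.
  by field; rewrite W0 W1.
have [M gM] := compact_nc_bounded (@compact_circle R) cg.
apply: (cvg_cint (M := M * 2)).
- exact: mC.
- by apply: arclength_lty.
- move=> N; apply: within_measurable1; first exact: mC.
  apply: (@within_circ _ p (fun w => \sum_(a < N) z.1 ^+ a * (F (w, z.2) / w ^+ a))).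
    exact: ltW.
  move=> w wp; apply/differentiable_continuous.
  have -> : (fun w => \sum_(a < N) z.1 ^+ a * (F (w, z.2) / w ^+ a)) =
      \sum_(a < N) (fun w => z.1 ^+ a * (F (w, z.2) / w ^+ a)).
    by apply/funext => v; rewrite fct_sumE.
  apply: differentiable_sum => a; apply: differentiableM; last exact: dterm.
  exact: differentiable_cst.
- exact: within_measurable1 mC cg.
- move=> N w wC; rewrite fE// ncM; have /unit_circleE w1 := wC.
  apply: ler_pM; [exact: nc_ge0|exact: nc_ge0|exact: gM|].
  by apply/nc_one_sub_expr/q1; rewrite nc_scale// ltW.
- move=> w wC; have -> : (f ^~ w) = fun N => g w * (1 - (z.1 / (p%:C * w)) ^+ N).
    by apply/funext => N; exact: fE.
  have /unit_circleE w1 := wC.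
  by apply/cvg_one_sub_expr/q1; rewrite nc_scale// ltW.
Qed.

End reproducing.

(** * The reproducing formula on A_k *)

Section reproducing_formula.
Context {R : realType}.
Variables (m n k : nat).
Hypotheses (m_gt0 : (0 < m)%N) (n_gt0 : (0 < n)%N).
Implicit Types (F : R[i] * R[i] -> R[i]).

Local Notation LI := (laurent_integrand m n k).

Lemma ex_radius (x y : R) : 0 <= x -> 0 < y -> y < 1 -> x ^+ m < y ^+ n ->
  exists p, [/\ 0 < p, x < p & p ^+ m < y ^+ n].
Proof.
move=> x0 y0 y1 xy.
have yn0 : 0 < y ^+ n by rewrite exprn_gt0.
have yn1 : y ^+ n < 1 by exact: expr_lt_1 n_gt0 (ltW y0) y1.
(* The maximum keeps the radius positive when x = 0; c is then divided by some l < 1 to exceed x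
   strictly. *)
pose c := Num.max x (y ^+ n / 2).
have c0 : 0 < c by rewrite lt_max divr_gt0 ?orbT.
have cm : c ^+ m < y ^+ n.
  have [h|/ltW h] := leP x (y ^+ n / 2); last by rewrite /c (max_l h).
  rewrite /c (max_r h); apply: (@le_lt_trans _ _ (y ^+ n / 2)); last lra.
  rewrite -[leRHS]expr1; apply: ler_wiXn2l; [lra|lra|exact: m_gt0].
have [l [l0 l1 lc]] : exists l : R, [/\ 0 < l, l < 1 & c ^+ m / y ^+ n < l ^+ m].
  by apply: ex_lt_pow; rewrite ltr_pdivrMr// mul1r.
exists (c / l); split; first exact: divr_gt0.
  apply: (@le_lt_trans _ _ c); first by rewrite le_max lexx.
  by rewrite ltr_pdivlMr// gtr_pMr.
rewrite expr_div_n ltr_pdivrMr ?exprn_gt0// mulrC -ltr_pdivrMr//.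
Qed.

Lemma conj_circle (w : R[i]) : nc w = 1 -> conjc w = w^-1.
Proof.
move=> w1; have w0 : w != 0 by rewrite -nc_gt0 w1.
apply: (mulfI w0); rewrite mulfV//.
by rewrite -sqr_normc nc_def w1 expr1n.
Qed.

Lemma continuous_conjc : continuous (@conjc R : R[i] -> R[i]).
Proof.
move=> z; apply/(@cvg_ncP _ _ (nbhs z) (nbhs_filter z)) => e e0.
by apply/nbhs_ncP; exists e => // w; rewrite -rmorphB nc_conj.
Qed.

Lemma within_conj (D : set (R[i] * R[i])) (f : R[i] * R[i] -> R[i]) :
  {within D, continuous (fun w => conjc (f w))} -> {within D, continuous f}.
Proof.
move=> cf; have -> : f = fun w => conjc (conjc (f w)).
  by apply/funext => w; rewrite conjcK.
move=> w; apply: (@continuous_comp _ _ _ (fun w : subspace D => conjc (f w))).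
  exact: cf.
exact: continuous_conjc.
Qed.

Lemma Ak_within_torus F : Ak m n k F -> {within @torus R, continuous F}.
Proof. by move=> [_ cF _]; apply: continuous_subspaceW cF => w; right. Qed.

Lemma within_szego (z : R[i] * R[i]) : hartogs m n z ->
  {within @torus R, continuous (szego m n k z)}.
Proof.
by move=> hz; apply/within_conj/Ak_within_torus; exact: szego_conj_Ak.
Qed.

Lemma szego_torus (z w : R[i] * R[i]) : torus w ->
  szego m n k z w = 1 / (4 * (pi : R)%:C ^+ 2) * szego_fun m n k (z.1 / w.1) (z.2 / w.2).
Proof. by move=> /torusE[w1 w2]; rewrite /szego !conj_circle. Qed.

(** The same sequence of torus integrals has two limits: as partial sums of the Taylor series in z1
    it tends to 2 pi F z, and with the blocks summed under the integral it tends to 2 pi times the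
    integral against the kernel. *)
Theorem Ak_reproducing F (z : R[i] * R[i]) : Ak m n k F -> hartogs m n z ->
  F z = torus_integral (fun w => F w * szego m n k z w).
Proof.
move=> AF hz; have [y0 y1 x1 xy] := hartogs_nc m_gt0 n_gt0 hz.
have [p [p0 xp py]] := ex_radius (nc_ge0 _) y0 y1 xy.
have pi0 : (2 * pi)%:C != 0 :> R[i] by rewrite -nc_gt0 nc_real normr_gt0 gt_eqF ?pi2_gt0.
have z20 : z.2 != 0 by rewrite -nc_gt0.
have mT := @measurable_torus R.
have cF := Ak_within_torus AF.
have cS := within_szego hz.
have cFS : {within @torus R, continuous (fun w => F w * szego m n k z w)}.
  by move=> w; apply: cvgM; [exact: cF|exact: cS].
have cLI a : {within @torus R, continuous (LI F z.2 a)}.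
  pose Q (w : R[i] * R[i]) := w.2 ^+ (k + n * a %/ m) / w.1 ^+ a * (w.2 / (w.2 - z.2)).
  have -> : LI F z.2 a = fun w => F w * Q w.
    by apply/funext => w; rewrite /laurent_integrand /Q !mulrA.
  apply: (@within_mul_differentiable _ (@torus R) (@torus R) F Q cF); first by move=> w.
  move=> w /torusE[w1 w2].
  have d1 := differentiable_fst w; have d2 := differentiable_snd w.
  apply: differentiableM; last first.
    apply: differentiableM; first exact: d2.
    apply: differentiableV.
      by apply: differentiableB; [exact: d2|exact: differentiable_cst].
    by rewrite subr_eq0; apply: neq_of_nc; rewrite w2 gt_eqF.
  apply: differentiableM; first exact: differentiableXf.
  by apply: differentiableV; [exact: differentiableXf|rewrite expf_neq0// -nc_gt0 w1].
have coef a : circ p (fun w => F (w, z.2) / w ^+ a) =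
    torus_integral (LI F z.2 a) / (z.2 ^+ (k + n * a %/ m) * (2 * pi)%:C).
  rewrite -(laurent_coeff m_gt0 n_gt0 a AF p0 py y1).
  by rewrite -[_ * _ * (2 * pi)%:C]mulrA mulfK// mulf_neq0// expf_neq0.
pose c a := z.1 ^+ a / (z.2 ^+ (k + n * a %/ m) * (2 * pi)%:C).
(* Stopping at multiples of m leaves whole blocks only. The factor 2 pi in [c] undoes the Cauchy
   formula in w2; the one belonging to w1 remains in both limits. *)
pose f N w := \sum_(a < m * N) c a * LI F z.2 a w.
have mN : (fun N => m * N)%N @ \oo --> \oo.
  by apply: cvg_mulnl => //; exact: cvg_id.
have lim1 : (fun N => torus_integral (f N)) @ \oo --> F z * (2 * pi)%:C.
  have -> : (fun N => torus_integral (f N)) =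
      (fun N => \sum_(a < N) z.1 ^+ a * circ p (fun w => F (w, z.2) / w ^+ a)) \o
      (fun N => m * N)%N.
    apply/funext => N /=; apply/esym; rewrite /f.
    have [_ E] := @cint_sum _ _ _ (torus_measure R) (@torus R) _ (index_enum 'I_(m * N))
      (fun a w => c a * LI F z.2 a w) mT
      (fun a => cintegrableZ _ mT (continuous_torus_integrable (cLI a))).
    apply: etrans (esym E).
    apply: eq_bigr => a _; rewrite (cintZ _ mT (continuous_torus_integrable (cLI a))).
    by rewrite coef /c mulrA mulrAC.
  exact: cvg_comp mN (taylor_cvg m_gt0 n_gt0 AF hz xp py).
(* The ratio of consecutive blocks; on the torus its modulus is the constant |z1|^m / |z2|^n < 1. *)
pose q w := (z.1 / w.1) ^+ m / (z.2 / w.2) ^+ n.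
have fE N w : torus w -> f N w =
    F w * szego m n k z w * (2 * pi)%:C * (1 - q w ^+ N).
  move=> Tw; have /torusE[w1 w2] := Tw.
  have h1 : nc (z.1 / w.1) ^+ m < nc (z.2 / w.2) ^+ n.
    by rewrite !ncM !ncV w1 w2 !divr1.
  have h2 : nc (z.2 / w.2) < 1 by rewrite ncM ncV w2 divr1.
  have [v0 uv v1] := szego_fun_neq0 n_gt0 h1 h2.
  have w10 : w.1 != 0 by rewrite -nc_gt0 w1.
  have w20 : w.2 != 0 by rewrite -nc_gt0 w2.
  rewrite szego_torus// /q.
  transitivity (F w / (2 * pi)%:C * \sum_(a < m * N)
     (z.1 / w.1) ^+ a / (z.2 / w.2) ^+ (k + n * a %/ m) / (1 - z.2 / w.2)).
    rewrite mulr_sumr; apply: eq_bigr => a _.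
    rewrite /c /laurent_integrand !expr_div_n.
    have -> : w.2 / (w.2 - z.2) = (1 - z.2 / w.2)^-1.
      have -> : 1 - z.2 / w.2 = (w.2 - z.2) / w.2 by field.
      by rewrite invfM invrK mulrC.
    by move: ((1 - z.2 / w.2)^-1) => K; rewrite invf_div !invfM; ring.
  rewrite (@partial_szego_fun R m n k m_gt0 N _ _ v0 uv v1).
  have pi0' : pi%:C != 0 :> R[i].
    by rewrite -nc_gt0 nc_real normr_gt0 gt_eqF ?pi_gt0.
  rewrite rmorphM /= (rmorph_nat (real_complex R) 2).
  move: (szego_fun _ _ _ _ _) (1 - _ ^+ N) (real_complex R pi) pi0' => S D P P0.
  by field.
have q1 w : torus w -> nc (q w) < 1.
  move=> /torusE[w1 w2]; rewrite /q ncM ncV !ncX !ncM !ncV w1 w2 !divr1.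
  by rewrite ltr_pdivrMr ?exprn_gt0// mul1r.
have lim2 : (fun N => torus_integral (f N)) @ \oo -->
    torus_integral (fun w => F w * szego m n k z w * (2 * pi)%:C).
  have cG : {within @torus R, continuous (fun w => F w * szego m n k z w * (2 * pi)%:C)}.
    by move=> w; apply: cvgM; [exact: cFS|exact: cvg_cst].
  have [M gM] := compact_nc_bounded (@compact_torus R) cG.
  apply: (cvg_cint (mu := torus_measure R) (M := M * 2)).
  - exact: mT.
  - exact: torus_measure_lty.
  - move=> N; apply: within_measurable2; first exact: mT.
    rewrite /f; elim: {N}(m * N)%N => [|N ih].
      under eq_fun do rewrite big_ord0.
      by move=> w; exact: cvg_cst.
    under eq_fun do rewrite big_ord_recr /=.
    move=> w; apply: cvgD; first exact: ih.
    by apply: cvgM; [exact: cvg_cst|exact: cLI].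
  - exact: within_measurable2 mT cG.
  - move=> N w Tw; rewrite fE// ncM.
    apply: ler_pM; [exact: nc_ge0|exact: nc_ge0|exact: gM|].
    by apply/nc_one_sub_expr/q1.
  - move=> w Tw; have -> : (f ^~ w) = fun N =>
        F w * szego m n k z w * (2 * pi)%:C * (1 - q w ^+ N).
      by apply/funext => N; exact: fE.
    by apply/cvg_one_sub_expr/q1.
have E := cvg_unique (@norm_hausdorff _ _) lim1 lim2.
apply: (mulIf pi0); rewrite E.
have -> : (fun w => F w * szego m n k z w * (2 * pi)%:C) =
    fun w => (2 * pi)%:C * (F w * szego m n k z w).
  by apply/funext => w; rewrite mulrC.
rewrite [RHS]mulrC.
exact: (cintZ (mu := torus_measure R) _ mT (continuous_torus_integrable cFS)).
Qed.

End reproducing_formula.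

(** * Square-integrable functions on the torus *)

Section L2_torus.
Context {R : realType}.
Implicit Types (f g : R[i] * R[i] -> R[i]).

Local Notation TT := (@torus R).
Local Notation mu := (torus_measure R).

(** The pair of extensions by zero is measurable for the product sigma-algebra, which contains the
    open set that [h] pulls back. *)
Lemma measurable_fun_comp2 (h : R[i] * R[i] -> R[i]) f g : continuous h ->
  measurable_fun TT f -> measurable_fun TT g ->
  measurable_fun TT (fun w => h (f w, g w)).
Proof.
move=> /continuousP ch mf mg.
have mf' : measurable_fun setT (f \_ TT).
  by apply/(measurable_restrictT _ measurable_torus).
have mg' : measurable_fun setT (g \_ TT).
  by apply/(measurable_restrictT _ measurable_torus).
have mh : measurable_fun setT (fun w => h ((f \_ TT) w, (g \_ TT) w)).
  apply: (measurability (open : set (set R[i]))) => // _ [B oB <-].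
  have mB : measurable (h @^-1` B) by apply: open_measurable2; exact: ch.
  have := measurable_fun_pair mf' mg'; move=> /(_ measurableT _ mB).
  exact.
apply: eq_measurable_fun (measurable_funS measurableT (@subsetT _ TT) mh).
by move=> w wT; rewrite !patchE wT.
Qed.

Lemma measurable_fun_subc f g : measurable_fun TT f -> measurable_fun TT g ->
  measurable_fun TT (fun w => f w - g w).
Proof.
move=> mf mg; apply: (@measurable_fun_comp2 (fun x => x.1 - x.2)) mf mg => x.
apply/differentiable_continuous/differentiableB.
  exact: differentiable_fst.
exact: differentiable_snd.
Qed.

Lemma measurable_fun_mulc f g : measurable_fun TT f -> measurable_fun TT g ->
  measurable_fun TT (fun w => f w * g w).
Proof.
move=> mf mg; apply: (@measurable_fun_comp2 (fun x => x.1 * x.2)) mf mg => x.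
apply/differentiable_continuous/differentiableM.
  exact: differentiable_fst.
exact: differentiable_snd.
Qed.

Definition nc_torus f : R[i] * R[i] -> R := (fun w => nc (f w)) \_ TT.

Lemma measurable_nc_torus f : measurable_fun TT f -> measurable_fun setT (nc_torus f).
Proof.
move=> mf; apply/(measurable_restrictT _ measurable_torus).
exact: measurable_fun_nc measurable_torus mf.
Qed.

Lemma L2normE f : L2norm f = 'N[mu]_2%:E[EFin \o nc_torus f]%E.
Proof. by rewrite /L2norm restrict_EFin. Qed.

Lemma L2normE2 f : (L2norm f `^ 2 = \int[mu]_(w in TT) (nc (f w) ^+ 2)%:E)%E.
Proof.
rewrite L2normE powR_Lnorm// [RHS]integral_mkcond; apply: eq_integral => w _.
have P (x : R) : 0 <= x -> (`|x%:E| `^ 2)%E = (x ^+ 2)%:E.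
  by move=> x0; rewrite gee0_abs ?lee_fin// poweR_EFin powR_mulrn.
transitivity ((nc_torus f w ^+ 2)%:E).
  by apply: P; rewrite /nc_torus patchE; case: ifP => // _; exact: nc_ge0.
by rewrite /nc_torus !patchE; case: ifP => // _; rewrite expr0n.
Qed.

Lemma L2_integrable f : L2 f -> mu.-integrable TT (fun w => (nc (f w) ^+ 2)%:E).
Proof.
move=> [mf foo]; apply/integrableP; split.
  apply/measurable_EFinP; apply: measurable_funX.
  exact: measurable_fun_nc measurable_torus mf.
have -> : (\int[mu]_(w in TT) `|(nc (f w) ^+ 2)%:E| = L2norm f `^ 2)%E.
  rewrite L2normE2; apply: eq_integral => w _ /=.
  by rewrite ger0_norm// exprn_ge0// nc_ge0.
by rewrite poweR_lty.
Qed.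

Lemma integrable_L2 f : measurable_fun TT f ->
  mu.-integrable TT (fun w => (nc (f w) ^+ 2)%:E) -> L2 f.
Proof.
move=> mf fi; split => //.
have : (L2norm f `^ 2 < +oo)%E.
  by rewrite L2normE2; exact: (integrable_lty measurable_torus fi).
by apply: lty_poweRy; rewrite pnatr_eq0.
Qed.

Lemma L2B f g : L2 f -> L2 g -> L2 (fun w => f w - g w).
Proof.
move=> Lf Lg; have [mf _] := Lf; have [mg _] := Lg.
have mfg := measurable_fun_subc mf mg.
apply: integrable_L2 => //.
have i2 := integrableD measurable_torus
  (integrableZl measurable_torus 2 (L2_integrable Lf))
  (integrableZl measurable_torus 2 (L2_integrable Lg)).
apply: le_integrable i2 => //.
- exact: measurable_torus.
- apply/measurable_EFinP; apply: measurable_funX.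
  exact: measurable_fun_nc measurable_torus mfg.
- move=> w _ /=; rewrite lee_fin !ger0_norm ?addr_ge0 ?mulr_ge0 ?exprn_ge0 ?nc_ge0//.
  apply: (@le_trans _ _ ((nc (f w) + nc (g w)) ^+ 2)).
    by apply: le_exprn; [exact: nc_ge0|exact: ncB].
  (* From (x + y)^2 <= 2 x^2 + 2 y^2, whence the factors 2 in the dominating function. *)
  have := sqr_ge0 (nc (f w) - nc (g w)); rewrite !expr2; lra.
Qed.

Lemma L2_conj f : L2 (fun w => conjc (f w)) -> L2 f.
Proof.
move=> Lf; have [mf _] := Lf; apply: integrable_L2.
  have -> : f = fun w => conjc (conjc (f w)) by apply/funext => w; rewrite conjcK.
  apply: (@measurable_fun_comp2 (fun x => conjc x.1) _ _ _ mf mf) => x.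
  by apply: (@continuous_comp _ _ _ fst); [exact: cvg_fst|exact: continuous_conjc].
by have := L2_integrable Lf; under eq_fun do rewrite nc_conj.
Qed.

Lemma within_L2 f : {within TT, continuous f} -> L2 f.
Proof.
move=> cf; have mf := within_measurable2 measurable_torus cf.
apply: integrable_L2 => //.
have [M fM] := compact_nc_bounded compact_torus cf.
apply: measurable_bounded_integrable.
- exact: measurable_torus.
- exact: torus_measure_lty.
- by apply: measurable_funX; exact: measurable_fun_nc measurable_torus mf.
- exists (M ^+ 2); split; rewrite ?num_real// => N MN w Tw /=.
  rewrite ger0_norm ?exprn_ge0 ?nc_ge0//; apply: le_trans (ltW MN).
  by apply: le_exprn (nc_ge0 _) _; exact: fM.
Qed.

Lemma L2_mul_integrable f g : L2 f -> L2 g ->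
  cintegrable mu TT (fun w => f w * g w).
Proof.
move=> Lf Lg; have [mf _] := Lf; have [mg _] := Lg.
have mfg := measurable_fun_mulc mf mg.
have [mR mI] := measurable_fun_ReIm mfg.
have i2 := integrableD measurable_torus (L2_integrable Lf) (L2_integrable Lg).
have le (p : R[i] -> R) w : (forall u, `|p u| <= nc u) ->
    (`|(p (f w * g w))%:E| <= `|(nc (f w) ^+ 2)%:E + (nc (g w) ^+ 2)%:E|)%E.
  move=> pn; rewrite /= lee_fin; apply: le_trans (pn _) _; rewrite ncM.
  rewrite ger0_norm ?addr_ge0 ?exprn_ge0 ?nc_ge0//.
  have := sqr_ge0 (nc (f w) - nc (g w)); rewrite !expr2.
  have := mulr_ge0 (nc_ge0 (f w)) (nc_ge0 (g w)); lra.
split; apply: le_integrable i2 => //; try exact: measurable_torus.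
- exact/measurable_EFinP.
- by move=> w _; apply: le; exact: Re_le_nc.
- exact/measurable_EFinP.
- by move=> w _; apply: le; exact: Im_le_nc.
Qed.

(* Cauchy-Schwarz, up to the factor 2 coming from treating the real and
   imaginary parts separately. *)
Lemma torus_integral_L2_bound f g : L2 f -> L2 g ->
  ((nc (torus_integral (fun w => f w * g w)))%:E <= 2%:E * (L2norm f * L2norm g))%E.
Proof.
move=> Lf Lg; have [mf _] := Lf; have [mg _] := Lg.
have [iR iI] := L2_mul_integrable Lf Lg.
have := @hoelder _ _ _ mu (nc_torus f) (nc_torus g) 2 2
  (measurable_nc_torus mf) (measurable_nc_torus mg).
move=> /(_ (ltr0Sn _ 1) (ltr0Sn _ 1)).
have half : 2^-1 + 2^-1 = 1 :> R by rewrite -[2^-1]mul1r -splitr.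
move=> /(_ half); rewrite -!L2normE Lnorm1.
set I := (\int[mu]_x _)%E => HI.
have key (p : R[i] -> R) : measurable_fun setT p -> (forall u, `|p u| <= nc u) ->
    mu.-integrable TT (EFin \o (fun w => p (f w * g w))) ->
    (`|\int[mu]_(w in TT) p (f w * g w)|%:E <= I)%E.
  move=> mp pn ip; rewrite EFin_normr_Rintegral//; last exact: measurable_torus.
  apply: le_trans (le_abse_integral _ measurable_torus (measurable_int _ ip)) _.
  rewrite integral_mkcond; apply: ge0_le_integral => //.
  - by move=> w _; rewrite patchE; case: ifPn => // _; exact: abse_ge0.
  - apply/(measurable_restrictT _ measurable_torus).
    by apply: measurableT_comp => //; exact: measurable_int ip.
  - apply: measurableT_comp => //; apply/measurable_EFinP.
    by apply: measurable_funM; exact: measurable_nc_torus.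
  - move=> w _; rewrite patchE; case: ifPn => [wT|_]; last exact: abse_ge0.
    rewrite -[leLHS]/(`|p (f w * g w)|%:E) -[leRHS]/(`|nc_torus f w * nc_torus g w|%:E).
    rewrite lee_fin /nc_torus !patchE wT -ncM.
    by apply: le_trans (pn _) _; exact: ler_norm.
apply: (@le_trans _ _ (2%:E * I)%E); last by rewrite lee_wpmul2l.
apply: (@le_trans _ _ (`|complex.Re (torus_integral (fun w => f w * g w))|%:E +
                       `|complex.Im (torus_integral (fun w => f w * g w))|%:E)%E).
  by rewrite -EFinD lee_fin nc_le_ReIm.
rewrite [leRHS]mule_natl mule2n; apply: leeD.
  exact: key measurable_Re Re_le_nc iR.
exact: key measurable_Im Im_le_nc iI.
Qed.

End L2_torus.

(** * Evaluation functionals on the Hardy space, and uniqueness of the kernel *)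

Section hardy_space.
Context {R : realType}.
Variables (m n k : nat).
Hypotheses (m_gt0 : (0 < m)%N) (n_gt0 : (0 < n)%N).
Implicit Types (f F : R[i] * R[i] -> R[i]).

Lemma AkB F G : Ak m n k F -> Ak m n k G -> Ak m n k (fun w : R[i] * R[i] => F w - G w).
Proof.
move=> [dF cF [M /nbhs_nc2P[d d0 dM]]] [dG cG [N /nbhs_nc2P[e e0 eN]]]; split.
- by move=> w hw; apply: differentiableB; [exact: dF|exact: dG].
- by move=> w; apply: cvgB; [exact: cF|exact: cG].
- exists (M + N); apply/nbhs_nc2P; exists (Num.min d e).
    by rewrite lt_min d0.
  move=> w; rewrite !lt_min => /andP[w1 w1'] /andP[w2 w2'] hw.
  rewrite mulrBr rmorphD /=; apply: le_trans (ler_normB _ _) _.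
  by apply: lerD; [exact: dM|exact: eN].
Qed.

Lemma Ak_hardy2 F : Ak m n k F -> hardy2 m n k F.
Proof.
move=> AF; split; first exact/within_L2/(Ak_within_torus AF).
move=> e e0; exists F => //.
have -> : (fun w => F w - F w) = fun=> 0 by apply/funext => w; rewrite subrr.
rewrite L2normE (_ : EFin \o nc_torus (fun=> 0) = cst 0%E); last first.
  by apply/funext => w; rewrite /= /nc_torus patchE nc0; case: ifP.
by rewrite Lnorm0// lte_fin.
Qed.

Lemma hardy2B f F : hardy2 m n k f -> Ak m n k F ->
  hardy2 m n k (fun w => f w - F w).
Proof.
move=> [Lf fP] AF; split; first by apply: L2B => //; have [] := Ak_hardy2 AF.
move=> e e0; have [G AG fG] := fP e e0.
exists (fun w => G w - F w); first exact: AkB.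
by under eq_fun do rewrite opprB addrA subrK.
Qed.

Lemma L2norm_fin f : L2 f -> exists2 r : R, 0 <= r & L2norm f = r%:E.
Proof.
move=> [_ foo]; exists (fine (L2norm f)).
  by rewrite fine_ge0// L2normE Lnorm_ge0.
by rewrite fineK// ge0_fin_numE// L2normE Lnorm_ge0.
Qed.

Lemma szego_evaluation z : hartogs m n z ->
  is_evaluation m n k z (fun f => torus_integral (fun w => f w * szego m n k z w)).
Proof.
move=> hz; have Ls := within_L2 (@within_szego R m n k m_gt0 n_gt0 z hz).
have [r r0 rE] := L2norm_fin Ls.
have mT := @measurable_torus R.
split.
- move=> a f g [Lf _] [Lg _].
  have iF := L2_mul_integrable Lf Ls; have iG := L2_mul_integrable Lg Ls.
  transitivity (cint (torus_measure R) (@torus R)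
    (fun w => a * (f w * szego m n k z w) + g w * szego m n k z w)).
    by congr cint; apply/funext => w; rewrite mulrDl mulrA.
  by rewrite (cintD mT (cintegrableZ a mT iF) iG) (cintZ a mT iF).
- exists (2 * r) => f [Lf _].
  apply: le_trans (torus_integral_L2_bound Lf Ls) _.
  by rewrite rE EFinM -muleA [(r%:E * _)%E]muleC.
- by move=> F AF; rewrite -(Ak_reproducing m_gt0 n_gt0 AF hz).
Qed.

(** Two bounded functionals that agree on A_k agree on its closure: for F in A_k close to f, their
    difference at f equals their difference at f - F. *)
Lemma evaluation_unique z E : hartogs m n z -> is_evaluation m n k z E ->
  forall f, hardy2 m n k f -> E f = torus_integral (fun w => f w * szego m n k z w).
Proof.
move=> hz [Elin [M EM] EF] f hf.
have [E' E'E [lin' [M' EM'] EF']] : exists2 E', E' = (fun f => torus_integral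
    (fun w => f w * szego m n k z w)) & is_evaluation m n k z E'.
  by eexists; [reflexivity|exact: szego_evaluation].
transitivity (E' f); last by rewrite E'E.
apply/eqP; rewrite -subr_eq0 -nc_eq0 eq_le nc_ge0 andbT.
apply/ler_addgt0Pl => e e0; rewrite addr0.
have C0 : 0 < `|M| + `|M'| + 1 by rewrite ltr_wpDl ?addr_ge0.
have d0 : 0 < e / (`|M| + `|M'| + 1) by rewrite divr_gt0.
have [F AF fF] := hf.2 _ d0.
have hF := Ak_hardy2 AF.
have hd := hardy2B hf AF.
have dE : (fun w => f w - F w) = fun w => -1 * F w + f w.
  by apply/funext => w; rewrite mulN1r addrC.
have E1 : E f - E' f = E (fun w => f w - F w) - E' (fun w => f w - F w).
  rewrite dE (Elin _ _ _ hF hf) (lin' _ _ _ hF hf) (EF _ AF) (EF' _ AF); ring.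
rewrite E1; apply: le_trans (ncB _ _) _.
have [L L0 LE] := L2norm_fin hd.1.
have Le : L <= e / (`|M| + `|M'| + 1) by rewrite ltW// -lte_fin -LE.
have b1 := EM _ hd; have b2 := EM' _ hd.
rewrite LE -EFinM lee_fin in b1; rewrite LE -EFinM lee_fin in b2.
apply: le_trans (lerD b1 b2) _; rewrite -mulrDl.
apply: (@le_trans _ _ ((`|M| + `|M'| + 1) * (e / (`|M| + `|M'| + 1)))); last first.
  by rewrite mulrC divfK// gt_eqF.
apply: (@le_trans _ _ ((`|M| + `|M'| + 1) * L)); last by rewrite ler_wpM2l// ltW.
apply: ler_wpM2r => //; have := ler_norm M; have := ler_norm M'; lra.
Qed.

Lemma szego_reproduces : reproduces m n k (szego m n k : _ -> _ -> R[i]).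
Proof.
move=> z hz; split.
- exact/Ak_hardy2/szego_conj_Ak.
- by eexists; exact: szego_evaluation hz.
- by move=> E EE f hf; exact: evaluation_unique EE f hf.
Qed.

(** The difference d of the conjugated kernels lies in the Hardy space, so one evaluation functional
    applied to d is given by both kernels. Subtracting, the integral of d (s' - s) = |s' - s|^2 is
    0. *)
Lemma szego_unique s' : reproduces m n k s' -> forall z, hartogs m n z ->
  s' z = szego m n k z %[ae torus_measure R in @torus R].
Proof.
move=> rs z hz.
have [hs' [E EE] Es'] := rs z hz.
have As := @szego_conj_Ak R m n k m_gt0 n_gt0 z hz.
have hd := hardy2B hs' As.
set d := (fun w => _) in hd.
have Ls' : L2 (s' z) by exact: L2_conj hs'.1.
have Ls := within_L2 (@within_szego R m n k m_gt0 n_gt0 z hz).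
have Lss := L2B Ls' Ls.
have mT := @measurable_torus R.
have H1 := Es' _ EE _ hd.
have H2 := evaluation_unique hz EE hd.
have H3 : cint (torus_measure R) (@torus R)
    (fun w => d w * s' z w - d w * szego m n k z w) = 0.
  rewrite cintB//; [|exact: L2_mul_integrable hd.1 _..].
  by rewrite -[X in X - _]/(torus_integral _) -[X in _ - X]/(torus_integral _)
    -H1 -H2 subrr.
have dE w : d w * s' z w - d w * szego m n k z w =
    (nc (s' z w - szego m n k z w) ^+ 2)%:C.
  rewrite -mulrBr /d -[conjc _ - conjc _]conjcB mulrC -sqr_normc nc_def.
  by rewrite rmorphXn.
have H4 : (\int[torus_measure R]_(w in @torus R) (nc (s' z w - szego m n k z w) ^+ 2) = 0)%R.
  have := congr1 (@complex.Re R) H3; rewrite /cint.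
  by rewrite -[LHS]/(\int[torus_measure R]_(w in @torus R) _)%R;
     under eq_Rintegral do rewrite dE.
have H5 : (\int[torus_measure R]_(w in @torus R)
    `|(nc (s' z w - szego m n k z w) ^+ 2)%:E| = 0)%E.
  have -> : (\int[torus_measure R]_(w in @torus R)
    `|(nc (s' z w - szego m n k z w) ^+ 2)%:E| =
    \int[torus_measure R]_(w in @torus R) (nc (s' z w - szego m n k z w) ^+ 2)%:E)%E.
    by apply: eq_integral => w _; rewrite gee0_abs// lee_fin exprn_ge0// nc_ge0.
  rewrite -[LHS]fineK; last exact: (integrable_fin_num mT (L2_integrable Lss)).
  by congr (_%:E); exact: H4.
have mf : measurable_fun (@torus R)
    (fun w => (nc (s' z w - szego m n k z w) ^+ 2)%:E).
  exact: measurable_int (L2_integrable Lss).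
have := (ae_eq_integral_abs (torus_measure R) mT mf).1 H5.
apply: filterS => w H /H /= [] /eqP.
by rewrite sqrf_eq0 nc_eq0 subr_eq0 => /eqP.
Qed.

End hardy_space.

Theorem theorem6p2 (R : realType) (m n : nat)
    (m_gt0 : (0 < m)%N) (n_gt0 : (0 < n)%N) (mn_coprime : coprime m n)
    (k : nat) :
  is_szego_kernel m n k (fun z w : R[i] * R[i] =>
    1 / (4 * (pi : R)%:C ^+ 2) *
    ((z.2 * (w.2)^*) ^- k * Pmn m n (z.1 * (w.1)^*) (z.2 * (w.2)^*) /
     (((z.2 * (w.2)^*) ^+ n - (z.1 * (w.1)^*) ^+ m) * (1 - z.2 * (w.2)^*)))).
Proof.
(* Inside ring operations [^*] parses as [Num.conj], which is convertible to
   the [conjc] of [szego]. *)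
split; first exact: (@szego_reproduces R m n k m_gt0 n_gt0).
exact: (@szego_unique R m n k m_gt0 n_gt0).
Qed.
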